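(* Let $1\le p<\infty$, $0<q<\infty$, and let $u,v,w$ be weights on $(0,\infty)$ with $\lim_{t\to\infty}\underline{v}(t,\infty)=0$. Assume that $u$ is such that $U$ is admissible and that the measure $w(t)\,dt$ is non-degenerate with respect to $U^{q/p}$. Consider the inequality $$\left(\int_0^{\infty}\left(\frac{1}{U(t)}\int_0^t\left(\int_s^{\infty}h(z)\,dz\right)^p u(s)\,ds\right)^{\frac{q}{p}}w(t)\,dt\right)^{\frac1q}\le c\int_0^\infty h(z)v(z)\,dz. \qquad ( * )$$ (i) Let $1\le q<\infty$. Then $( * )$ holds for every $h\in\mathcal M^+(0,\infty)$ (with some finite constant $c$ independent of $h$) if and only if $$I_3:=\sup_{x>0}\left(\int_0^\infty\mathcal U(x,t)^{\frac qp}w(t)\,dt\right)^{\frac1q}U(x)^{-\frac1p}\sup_{t\in(0,x)}U(t)^{\frac1p}\,\underline v(t,\infty)<\infty .$$ Moreover, the best constant $c$ in $( * )$ satisfies $c\approx I_3$. (ii) Let $0<q<1$. Then $( * )$ holds for every $h\in\mathcal M^+(0,\infty)$ (with some finite constant $c$ independent of $h$) if and only if $$I_4:=\left(\int_0^\infty\left(\int_0^\infty\mathcal U(x,t)^{\frac qp}w(t)\,dt\right)^{q^*}U(x)^{-\frac{q^*}{p}}\left(\sup_{t\in(0,x)}U(t)^{\frac{q^*}{p}}\,\underline v(t,\infty)^{q^*}\right)w(x)\,dx\right)^{\frac1{q^*}}<\infty .$$ Moreover, the best constant $c$ in $( * )$ satisfies $c\approx I_4$.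
   Context: A weight is a locally integrable non-negative function on $(0,\infty)$; $\mathcal M^+(0,\infty)$ is the set of non-negative measurable functions on $(0,\infty)$. Put $U(t)=\int_0^t u(s)\,ds$, with $U(t)>0$ for all $t>0$, and $\mathcal U(x,t)=\dfrac{U(x)}{U(t)+U(x)}$. $U$ is admissible if it is continuous and strictly increasing on $[0,\infty)$, $U(0)=0$ and $\lim_{t\to\infty}U(t)=\infty$. For $r>0$, the measure $w(t)\,dt$ is non-degenerate with respect to $U^{r}$ if $\int_0^\infty \frac{w(s)\,ds}{U(s)^r+U(t)^r}<\infty$ for all $t\in(0,\infty)$ and $\int_0^1\frac{w(s)}{U(s)^r}\,ds=\int_1^\infty w(s)\,ds=\infty$. For $0\le a<b\le\infty$, $\underline v(a,b)=\operatorname{ess\,sup}_{s\in(a,b)}v(s)^{-1}$. For $q\in(0,1)$, $q^*=\frac q{1-q}$. Conventions: $1/0=\infty$, $1/\infty=0$, $0\cdot\infty=0$, $0/0=0$, $\infty/\infty=0$. $a\approx b$ means $\lambda^{-1}a\le b\le\lambda a$ with $\lambda>0$ depending only on inessential parameters (here the exponents $p,q$). *)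

(* Defs.v *)
From mathcomp Require Import all_boot all_order all_algebra.
From mathcomp Require Import all_classical all_reals all_analysis.
From mathcomp Require Import measurable_realfun ess_sup_inf.

Set Implicit Arguments.
Unset Strict Implicit.
Unset Printing Implicit Defensive.

Import Order.TTheory GRing.Theory Num.Theory.
Import numFieldNormedType.Exports.

Local Open Scope classical_set_scope.
Local Open Scope ring_scope.
Local Open Scope ereal_scope.

(* Functions on (0, oo) are represented by functions on R whose values outside
   `]0, +oo[ are irrelevant.  All quantities built from the weights are computed
   in \bar R, where the product and the inverse satisfy 0 * +oo = 0,
   0^-1 = +oo and +oo^-1 = 0, hence 0 / 0 = +oo / +oo = 0. *)

Section weights.
Context {R : realType}.

Local Notation mu := (@lebesgue_measure R).

Definition weight (v : R -> R) : Prop :=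
  locally_integrable `]0%R, +oo[ v /\ (forall t, (0 < t)%R -> (0 <= v t)%R).

Definition nonneg_measurable (h : R -> \bar R) : Prop :=
  measurable_fun (`]0%R, +oo[ : set R) h /\ (forall t, (0 < t)%R -> 0 <= h t).

Definition primitive_wt (u : R -> R) (t : R) : \bar R :=
  \int[mu]_(s in `]0%R, t[) (u s)%:E.

(* Strict monotonicity forces U to be finite on `[0, +oo[. *)
Definition admissible_wt (U : R -> \bar R) : Prop :=
  [/\ {within `[0%R, +oo[, continuous U},
      {in `[0%R, +oo[ &, {homo U : s t / (s < t)%R >-> s < t}},
      U 0%R = 0
    & U t @[t --> +oo%R] --> +oo].

Definition nondegenerate_wrt (U : R -> \bar R) (r : R) (w : R -> R) : Prop :=
  [/\ forall t, (0 < t)%R ->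
        \int[mu]_(s in `]0%R, +oo[) ((w s)%:E / (U s `^ r + U t `^ r)) < +oo,
      \int[mu]_(s in `]0%R, 1%R[) ((w s)%:E / U s `^ r) = +oo
    & \int[mu]_(s in `]1%R, +oo[) (w s)%:E = +oo].

Definition Uquot (U : R -> \bar R) (x t : R) : \bar R := U x / (U t + U x).

Definition ess_sup_inv (v : R -> R) (i : interval R) : \bar R :=
  ess_sup (mrestr mu (measurable_itv i)) (fun s => (v s)%:E^-1).

Definition conj_exp (q : R) : R := (q / (1 - q))%R.

Definition hardy_lhs (p q : R) (u w : R -> R) (h : R -> \bar R) : \bar R :=
  (\int[mu]_(t in `]0%R, +oo[)
     (((primitive_wt u t)^-1 *
       \int[mu]_(s in `]0%R, t[)
          ((\int[mu]_(z in `]s, +oo[) h z) `^ p * (u s)%:E)) `^ (q / p)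
      * (w t)%:E)) `^ q^-1.

Definition hardy_ineq (p q : R) (u v w : R -> R) (c : R) : Prop :=
  forall h, nonneg_measurable h ->
    hardy_lhs p q u w h <=
    c%:E * \int[mu]_(z in `]0%R, +oo[) (h z * (v z)%:E).

(* The infimum is +oo when no constant works. *)
Definition best_constant (p q : R) (u v w : R -> R) : \bar R :=
  ereal_inf [set c%:E | c in [set c : R | (0 <= c)%R /\ hardy_ineq p q u v w c]].

Definition I3 (p q : R) (u v w : R -> R) : \bar R :=
  let U := primitive_wt u in
  ereal_sup [set
    (\int[mu]_(t in `]0%R, +oo[) (Uquot U x t `^ (q / p) * (w t)%:E)) `^ q^-1
    / U x `^ p^-1
    * ereal_sup [set U t `^ p^-1 * ess_sup_inv v `]t, +oo[ | t in `]0%R, x[]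
  | x in `]0%R, +oo[].

Definition I4 (p q : R) (u v w : R -> R) : \bar R :=
  let U := primitive_wt u in
  let q' := conj_exp q in
  (\int[mu]_(x in `]0%R, +oo[)
     ((\int[mu]_(t in `]0%R, +oo[) (Uquot U x t `^ (q / p) * (w t)%:E)) `^ q'
      / U x `^ (q' / p)
      * ereal_sup [set U t `^ (q' / p) * ess_sup_inv v `]t, +oo[ `^ q'
                  | t in `]0%R, x[]
      * (w x)%:E)) `^ q'^-1.

Definition approx_by (l : R) (a b : \bar R) : Prop :=
  l^-1%:E * a <= b /\ b <= l%:E * a.

End weights.

(* Main.v *)
(* Put r = q/p, s = q/(1-q), let V(t) be the essential supremum of 1/v over
   (t,oo) and Phi(x) = \int min(1, U(x)/U(t))^r w(t) dt, which is comparable to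
   the integral of (U(x)/(U(t) + U(x)))^r w(t). Let G(x) = U(x)^(-1/p) sup_{t<x}
   U(t)^(1/p) V(t); then G is nonincreasing, G U^(1/p) is nondecreasing and
   1/v <= G almost everywhere.

   Upper bounds. Minkowski's inequality replaces the left-hand side of the
   inequality by the L^q(w)-norm of the linear operator with kernel
   min(1, U(z)/U(t))^(1/p). For q >= 1 a second use of Minkowski's inequality
   gives the constant ess sup Phi^(1/q)/v. For q < 1 the kernel is split into the
   Hardy operators h |-> \int_t^oo h and h |-> U(t)^(-1/p) \int_0^t h U^(1/p); the
   monotonicity of G and of G U^(1/p) allows to bound both of them by Maurey's
   factorisation criterion, with the constant
   (\int Phi^s G^s w)^(1/s).

   Lower bounds. A function h concentrated beyond z, where 1/v is almost V(z),
   is mapped to at least a multiple of min(1, U(z)/U(t))^(1/p). For q >= 1 one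
   such bump suffices. For q < 1 take finitely many of them, thinned out so that
   their sum is at most four times their maximum; the inequality then bounds the
   integral of the maximum, and monotone convergence over all rational bumps
   yields the integral of Phi^s G^s w. *)

Require Import Defs.
From HB Require Import structures.
From mathcomp Require Import all_boot all_order all_algebra.
From mathcomp Require Import all_classical all_reals all_analysis.
From mathcomp Require Import measurable_realfun ess_sup_inf.
From mathcomp Require Import ring lra.

Set Implicit Arguments.
Unset Strict Implicit.
Unset Printing Implicit Defensive.

Import Order.TTheory GRing.Theory Num.Theory.
Import numFieldNormedType.Exports.

Local Open Scope classical_set_scope.
Local Open Scope ring_scope.
Local Open Scope ereal_scope.

(** * Integral inequalities for kernel operators *)

(** For q < 1 the target is not normed, so Minkowski's inequality is lost and the measure must be
    changed before the integrals are exchanged. Maurey's criterion does so through a density psi,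
    whose choice is the heart of the upper bound: psi^s is the integral of G^s W^(s-1) w over the
    points where W is not much smaller, that is, of G^s d(W^s) up to a constant. Integration by
    parts is avoided: about the mass W one only uses that a level set {W <= l} has mass at most l
    and that the segment ending at z has mass at least W z. In this form one lemma treats both Hardy
    operators, with W the integral of w over (0,x) for the order < and that of w/U^r over [x,oo) for
    the reversed order. In the lower bound for q < 1 each bump gets the mass for which its cost
    equals its w-integral. If N is the integral of the sum of the bumps and Y that of their maximum,
    then Y^(1/q) <= c N <= 4 c Y, and Y, being finite, can be cancelled. Non-degeneracy makes Phi
    finite, makes both masses W positive, and excludes an infinite supremum when I_4 is finite. *)

Lemma powRDgt0 (R : realType) (x a b : R) :
  (0 < x)%R -> (x `^ (a + b) = x `^ a * x `^ b)%R.
Proof. by move=> x0; rewrite powRD// (gt_eqF x0) implybT. Qed.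

Lemma measurable_fun_invr_gt0 d (T : measurableType d) (R : realType)
    (D : set T) (f : T -> R) : measurable_fun D f ->
  (forall x, D x -> (0 < f x)%R) -> measurable_fun D (fun x => (f x)^-1%R).
Proof.
move=> mf f0; apply: (eq_measurable_fun (fun x => (f x `^ (-1))%R)).
  by move=> x /[1!inE] Dx; rewrite powR_inv1// ltW// f0.
exact: (measurableT_comp (measurable_powR (-1)) mf).
Qed.

(** Cut-offs are kept as boolean factors of the integrand. The domain of integration then stays
    fixed, and a region depending on two variables becomes a kernel on a rectangle, to which
    Tonelli's theorem applies. *)
Lemma integral_boolM d (T : measurableType d) (R : realType)
    (mu : {measure set T -> \bar R}) (D : set T) (b : T -> bool) (f : T -> R) :
  \int[mu]_(x in D) ((b x)%:R * f x)%:E = \int[mu]_(x in D `&` [set x | b x]) (f x)%:E.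
Proof.
rewrite integral_mkcondr; apply: eq_integral => x _; rewrite patchE.
have [/set_mem/= ->|] := boolP (x \in _); first by rewrite mul1r.
by move=> /negP; rewrite inE /= => /negP/negbTE ->; rewrite mul0r.
Qed.

Lemma integral_boolMe d (T : measurableType d) (R : realType)
    (mu : {measure set T -> \bar R}) (D : set T) (b : T -> bool) (f : T -> \bar R) :
  \int[mu]_(x in D) ((b x)%:R%:E * f x) = \int[mu]_(x in D `&` [set x | b x]) f x.
Proof.
rewrite integral_mkcondr; apply: eq_integral => x _; rewrite patchE.
have [/set_mem/= ->|] := boolP (x \in _); first by rewrite mul1e.
by move=> /negP; rewrite inE /= => /negP/negbTE ->; rewrite mul0e.
Qed.

Lemma measurable_boolR d (T : measurableType d) (R : realType) (D : set T)
    (b : T -> bool) : measurable_fun D b ->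
  measurable_fun D (fun x => (b x)%:R : R).
Proof.
move=> mb; rewrite (_ : (fun x => _) = (fun c : bool => c%:R : R) \o b)//.
exact: (measurableT_comp _ mb).
Qed.

Section geometric_hoelder.
Context d (T : measurableType d) (R : realType).
Variable mu : {measure set T -> \bar R}.

(** An infinite argument makes the right-hand side infinite because both weights are positive;
    finite arguments reduce to Young's inequality with the exponents 1/a and 1/(1-a). *)
Lemma poweR_young (x y : \bar R) (a : R) : (0 < a < 1)%R -> 0 <= x -> 0 <= y ->
  x `^ a * y `^ (1 - a) <= a%:E * x + (1 - a)%:E * y.
Proof.
move=> /andP[a0 a1] x0 y0; have a1' : (0 < 1 - a)%R by rewrite subr_gt0.
case: x x0 => [x||//] x0; last first.
  rewrite (@gt0_muley _ a%:E) ?lte_fin// addye ?leey//.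
  by rewrite gt_eqF// (lt_le_trans _ (mule_ge0 _ y0)) ?ltNy0// lee_fin ltW.
case: y y0 => [y||//] y0; last first.
  by rewrite (@gt0_muley _ (1 - a)%:E) ?lte_fin// addey ?leey.
have := @conjugate_powR _ (x `^ a)%R (y `^ (1 - a))%R a^-1%R (1 - a)^-1%R
  (powR_ge0 _ _) (powR_ge0 _ _).
rewrite !invr_gt0 !invrK -!powRrM !divff ?gt_eqF// !powRr1//.
move=> /(_ a0 a1'); rewrite addrC subrK => /(_ erefl).
by rewrite !poweR_EFin -!EFinM -EFinD lee_fin [(a * x)%R]mulrC [((1 - a) * y)%R]mulrC.
Qed.

Lemma ge0_integral_eq0 (D : set T) (f : T -> \bar R) : measurable D ->
  measurable_fun D f -> (forall x, D x -> 0 <= f x) ->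
  \int[mu]_(x in D) f x = 0 -> ae_eq mu D f (cst 0).
Proof.
move=> mD mf f0 int0; apply/ae_eq_integral_abs => //.
rewrite -[RHS]int0; apply: eq_integral => x /[1!inE] Dx.
by rewrite gee0_abs// f0.
Qed.

Let mpow (D : set T) (f g : T -> \bar R) (a b : R) :
  measurable_fun D f -> measurable_fun D g ->
  measurable_fun D (fun x => f x `^ a * g x `^ b).
Proof.
move=> mf mg; apply: emeasurable_funM.
  exact: (measurableT_comp (measurable_poweR a) mf).
exact: (measurableT_comp (measurable_poweR b) mg).
Qed.

(** Dividing f and g by their integrals turns the claim into an integrated [poweR_young]. A zero
    integral is treated apart, since the other one may be infinite: the integrand on the left then
    vanishes almost everywhere. *)
Lemma geometric_hoelder (D : set T) (f g : T -> \bar R) (a : R) :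
  (0 < a < 1)%R -> measurable D ->
  measurable_fun D f -> measurable_fun D g ->
  (forall x, D x -> 0 <= f x) -> (forall x, D x -> 0 <= g x) ->
  \int[mu]_(x in D) (f x `^ a * g x `^ (1 - a)) <=
  (\int[mu]_(x in D) f x) `^ a * (\int[mu]_(x in D) g x) `^ (1 - a).
Proof.
move=> /[dup] a01 /andP[a0 a1] mD mf mg f0 g0.
have a1' : (0 < 1 - a)%R by rewrite subr_gt0.
have mfg := mpow a (1 - a) mf mg.
have intf0 : 0 <= \int[mu]_(x in D) f x by exact: integral_ge0.
have intg0 : 0 <= \int[mu]_(x in D) g x by exact: integral_ge0.
have [fe|fne] := eqVneq (\int[mu]_(x in D) f x) 0.
  rewrite (@ge0_ae_eq_integral _ _ _ _ _ _ (cst 0)) ?integral0//.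
  - by rewrite mule_ge0// poweR_ge0.
  - by move=> x _; rewrite mule_ge0// poweR_ge0.
  - have := ge0_integral_eq0 mD mf f0 fe.
    by apply: filterS => x /[apply] /= ->; rewrite poweR0r ?gt_eqF// mul0e.
have [ge|gne] := eqVneq (\int[mu]_(x in D) g x) 0.
  rewrite (@ge0_ae_eq_integral _ _ _ _ _ _ (cst 0)) ?integral0//.
  - by rewrite mule_ge0// poweR_ge0.
  - by move=> x _; rewrite mule_ge0// poweR_ge0.
  - have := ge0_integral_eq0 mD mg g0 ge.
    by apply: filterS => x /[apply] /= ->; rewrite poweR0r ?gt_eqF// mule0.
have fgt0 : 0 < \int[mu]_(x in D) f x by rewrite lt0e fne.
have ggt0 : 0 < \int[mu]_(x in D) g x by rewrite lt0e gne.
have [->|fy] := eqVneq (\int[mu]_(x in D) f x) +oo.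
  by rewrite poweRyr ?gt_eqF// gt0_mulye ?leey// poweR_gt0.
have [->|gy] := eqVneq (\int[mu]_(x in D) g x) +oo.
  by rewrite poweRyr ?gt_eqF// gt0_muley ?leey// poweR_gt0.
have [A A0 AE] : exists2 A : R, (0 < A)%R & \int[mu]_(x in D) f x = A%:E.
  exists (fine (\int[mu]_(x in D) f x)).
    by rewrite fine_gt0// fgt0 ltey.
  by rewrite fineK// ge0_fin_numE// ltey.
have [B B0 BE] : exists2 A : R, (0 < A)%R & \int[mu]_(x in D) g x = A%:E.
  exists (fine (\int[mu]_(x in D) g x)).
    by rewrite fine_gt0// ggt0 ltey.
  by rewrite fineK// ge0_fin_numE// ltey.
rewrite AE BE !poweR_EFin -EFinM.
set C := (A `^ a * B `^ (1 - a))%R.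
have C0 : (0 <= C)%R by rewrite mulr_ge0// powR_ge0.
(* After normalisation the two terms of Young's bound integrate to a and 1 - a, which add up to
   1. *)
have E1 : \int[mu]_(x in D) ((a / A)%:E * f x) = a%:E.
  rewrite ge0_integralZl_EFin//; last by rewrite divr_ge0// ltW.
  by rewrite AE -EFinM divfK// gt_eqF.
have E2 : \int[mu]_(x in D) (((1 - a) / B)%:E * g x) = (1 - a)%:E.
  rewrite ge0_integralZl_EFin//; last by rewrite divr_ge0// ltW.
  by rewrite BE -EFinM divfK// gt_eqF.
have m1 : measurable_fun D (fun x => (a / A)%:E * f x) by exact: measurable_funeM.
have m2 : measurable_fun D (fun x => ((1 - a) / B)%:E * g x) by exact: measurable_funeM.
have p1 x : D x -> 0 <= (a / A)%:E * f x.
  by move=> Dx; rewrite mule_ge0 ?f0// lee_fin divr_ge0// ltW.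
have p2 x : D x -> 0 <= ((1 - a) / B)%:E * g x.
  by move=> Dx; rewrite mule_ge0 ?g0// lee_fin divr_ge0// ltW.
apply: (@le_trans _ _ (\int[mu]_(x in D)
    (C%:E * ((a / A)%:E * f x + ((1 - a) / B)%:E * g x)))); last first.
  rewrite ge0_integralZl_EFin//; last 2 first.
  - by move=> x Dx; rewrite adde_ge0 ?p1 ?p2.
  - exact: emeasurable_funD.
  by rewrite ge0_integralD// E1 E2 -EFinD addrC subrK mule1.
apply: ge0_le_integral => //.
- by move=> x Dx; rewrite mule_ge0// poweR_ge0.
- by apply: measurable_funeM; exact: emeasurable_funD.
- move=> x Dx.
  have A' : 0 <= A^-1%:E by rewrite lee_fin invr_ge0 ltW.
  have B' : 0 <= B^-1%:E by rewrite lee_fin invr_ge0 ltW.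
  have := @poweR_young (A^-1%:E * f x) (B^-1%:E * g x) a a01.
  rewrite !mule_ge0 ?f0 ?g0// => /(_ isT isT).
  have -> : f x `^ a * g x `^ (1 - a) =
      C%:E * ((A^-1%:E * f x) `^ a * (B^-1%:E * g x) `^ (1 - a)).
    rewrite !poweRM ?f0 ?g0// muleACA !poweR_EFin -EFinM !muleA -EFinM.
    suff -> : (C * (A^-1 `^ a * B^-1 `^ (1 - a)) = 1)%R by rewrite mul1e.
    rewrite /C mulrACA -!powRM ?invr_ge0 ?(ltW A0) ?(ltW B0)//.
    by rewrite !divff ?gt_eqF// !powR1 mulr1.
  rewrite muleA -EFinM (muleA (1 - a)%:E) -EFinM => le_young.
  by apply: lee_wpmul2l.
Qed.

End geometric_hoelder.

Section fubini_on_rectangles.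
Context d1 d2 (T1 : measurableType d1) (T2 : measurableType d2) (R : realType).
Variables (m1 : {sigma_finite_measure set T1 -> \bar R})
          (m2 : {sigma_finite_measure set T2 -> \bar R}).
Variables (D1 : set T1) (D2 : set T2) (f : T1 * T2 -> \bar R).
Hypotheses (mD1 : measurable D1) (mD2 : measurable D2).
Hypotheses (mf : measurable_fun (D1 `*` D2) f)
           (f0 : forall x y, D1 x -> D2 y -> 0 <= f (x, y)).

(** Measurability and sign of f are known on the rectangle only; the extension by zero satisfies
    them everywhere, and its sections integrate to the restricted integrals. *)
Let g := f \_ (D1 `*` D2).

Let mg : measurable_fun setT g.
Proof. by apply/(measurable_restrictT f) => //; exact: measurableX. Qed.

Let g0 z : 0 <= g z.
Proof.
rewrite /g patchE; case: ifPn => [/set_mem|//].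
by case: z => x y [] /= Dx Dy; exact: f0.
Qed.

Let gF x : \int[m2]_y g (x, y) = ((fun x => \int[m2]_(y in D2) f (x, y)) \_ D1) x.
Proof.
rewrite patchE; case: ifPn => [/set_mem|/negP] Dx.
- rewrite [RHS]integral_mkcond; apply: eq_integral => y _; rewrite /g !patchE.
  have [Dy|Dy] := pselect (D2 y); first by rewrite !mem_set.
  by rewrite !memNset//= => -[].
- by apply: integral0_eq => y _; rewrite /g patchE memNset//= => -[] /mem_set.
Qed.

Let gG y : \int[m1]_x g (x, y) = ((fun y => \int[m1]_(x in D1) f (x, y)) \_ D2) y.
Proof.
rewrite patchE; case: ifPn => [/set_mem|/negP] Dy.
- rewrite [RHS]integral_mkcond; apply: eq_integral => x _; rewrite /g !patchE.
  have [Dx|Dx] := pselect (D1 x); first by rewrite !mem_set.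
  by rewrite !memNset//= => -[].
- by apply: integral0_eq => x _; rewrite /g patchE memNset//= => -[] _ /mem_set.
Qed.

Lemma measurable_integral2 :
  measurable_fun D1 (fun x => \int[m2]_(y in D2) f (x, y)).
Proof.
apply/(measurable_restrictT _ mD1).
rewrite (_ : _ \_ _ = fun x => \int[m2]_y g (x, y)); last first.
  by apply/funext => x; rewrite gF.
exact: measurable_fun_fubini_tonelli_F.
Qed.

Lemma measurable_integral1 :
  measurable_fun D2 (fun y => \int[m1]_(x in D1) f (x, y)).
Proof.
apply/(measurable_restrictT _ mD2).
rewrite (_ : _ \_ _ = fun y => \int[m1]_x g (x, y)); last first.
  by apply/funext => x; rewrite gG.
exact: measurable_fun_fubini_tonelli_G.
Qed.

Lemma fubini_tonelli_rectangle :
  \int[m1]_(x in D1) \int[m2]_(y in D2) f (x, y) =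
  \int[m2]_(y in D2) \int[m1]_(x in D1) f (x, y).
Proof.
rewrite [LHS]integral_mkcond [RHS]integral_mkcond.
under eq_integral do rewrite -gF.
by under [RHS]eq_integral do rewrite -gG; exact: fubini_tonelli.
Qed.

End fubini_on_rectangles.

Section kernel_operators.
Context d1 d2 (T1 : measurableType d1) (T2 : measurableType d2) (R : realType).
Variables (m1 : {sigma_finite_measure set T1 -> \bar R})
          (m2 : {sigma_finite_measure set T2 -> \bar R}).
Variables (D1 : set T1) (D2 : set T2).
Hypotheses (mD1 : measurable D1) (mD2 : measurable D2).
Variables (K : T1 * T2 -> R) (w : T1 -> R) (h : T2 -> \bar R) (N : T2 -> R).
Hypotheses (mK : measurable_fun (D1 `*` D2) K) (mw : measurable_fun D1 w)
  (mh : measurable_fun D2 h) (mN : measurable_fun D2 N).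
Hypotheses (K0 : forall x z, D1 x -> D2 z -> (0 <= K (x, z))%R)
  (w0 : forall x, D1 x -> (0 <= w x)%R) (h0 : forall z, D2 z -> 0 <= h z)
  (N0 : forall z, D2 z -> (0 < N z)%R).

Lemma measurable_fst_rectangle d' (T' : measurableType d') (f : T1 -> T') :
  measurable_fun D1 f -> measurable_fun (D1 `*` D2) (f \o fst).
Proof.
move=> mf; apply: (measurable_comp mD1 _ mf); last exact: measurable_funTS.
by move=> _ [[x z]] [] /= ? ? <-.
Qed.

Lemma measurable_snd_rectangle d' (T' : measurableType d') (f : T2 -> T') :
  measurable_fun D2 f -> measurable_fun (D1 `*` D2) (f \o snd).
Proof.
move=> mf; apply: (measurable_comp mD2 _ mf); last exact: measurable_funTS.
by move=> _ [[x z]] [] /= ? ? <-.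
Qed.

Lemma measurable_section2 d' (T' : measurableType d') (f : T1 * T2 -> T') x :
  D1 x -> measurable_fun (D1 `*` D2) f -> measurable_fun D2 (fun z => f (x, z)).
Proof.
move=> Dx mf; apply: (measurable_comp (measurableX mD1 mD2) _ mf).
  by move=> _ [z] Dz <-.
exact: measurable_funTS.
Qed.

Lemma measurable_section1 d' (T' : measurableType d') (f : T1 * T2 -> T') z :
  D2 z -> measurable_fun (D1 `*` D2) f -> measurable_fun D1 (fun x => f (x, z)).
Proof.
move=> Dz mf; apply: (measurable_comp (measurableX mD1 mD2) _ mf).
  by move=> _ [x] Dx <-.
exact: measurable_funTS.
Qed.

Let mKh x : D1 x -> measurable_fun D2 (fun z => (K (x, z))%:E * h z).
Proof.
move=> Dx; apply: emeasurable_funM => //; apply/measurable_EFinP.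
exact: measurable_section2.
Qed.

Let mhN : measurable_fun D2 (fun z => h z * (N z)%:E).
Proof. by apply: emeasurable_funM => //; exact/measurable_EFinP. Qed.

Let hN0 z : D2 z -> 0 <= h z * (N z)%:E.
Proof. by move=> Dz; rewrite mule_ge0 ?h0// lee_fin ltW// N0. Qed.

Lemma measurable_kernel_integral :
  measurable_fun D1 (fun x => \int[m2]_(z in D2) ((K (x, z))%:E * h z)).
Proof.
apply: (@measurable_integral2 _ _ _ _ _ m2 D1 D2 (fun xz => (K xz)%:E * h xz.2)) => //=.
  apply: emeasurable_funM; first exact/measurable_EFinP.
  exact: measurable_snd_rectangle.
by move=> x z Dx Dz; rewrite mule_ge0 ?h0// lee_fin K0.
Qed.

(* Hoelder's inequality for
   K h = (K^p h N^(1-p))^(1/p) (h N)^(1-1/p). *)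
Let pointwise_minkowski (p : R) x : (1 <= p)%R -> D1 x ->
  (\int[m2]_(z in D2) ((K (x, z))%:E * h z)) `^ p <=
  (\int[m2]_(z in D2) (h z * (N z)%:E)) `^ (p - 1) *
  \int[m2]_(z in D2) ((K (x, z) `^ p * N z `^ (1 - p))%:E * h z).
Proof.
move=> p1 Dx; have p0 : (0 < p)%R by exact: lt_le_trans p1.
move: p1; rewrite le_eqVlt => /predU1P[<-|p1].
  rewrite subrr poweRe0 mul1e poweRe1.
    rewrite le_eqVlt; apply/orP; left; apply/eqP.
    by apply: eq_integral => z /[1!inE] Dz; rewrite powRr1 ?K0// powRr0 mulr1.
  by apply: integral_ge0 => z Dz; rewrite mule_ge0 ?h0// lee_fin K0.
have a01 : (0 < p^-1 < 1)%R by rewrite invr_gt0 p0 invf_lt1.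
have mg : measurable_fun D2 (fun z => (K (x, z) `^ p * N z `^ (1 - p))%:E * h z).
  apply: emeasurable_funM => //; apply/measurable_EFinP; apply: measurable_funM.
    apply: (measurableT_comp (measurable_powR p)); exact: measurable_section2.
  exact: (measurableT_comp (measurable_powR (1 - p)) mN).
have g0 z : D2 z -> 0 <= (K (x, z) `^ p * N z `^ (1 - p))%:E * h z.
  by move=> Dz; rewrite mule_ge0 ?h0// lee_fin mulr_ge0// powR_ge0.
have := geometric_hoelder m2 a01 mD2 mg mhN g0 hN0.
set I := \int[m2]_(z in D2) ((K (x, z))%:E * h z).
set J := \int[m2]_(z in D2) ((_ * _)%:E * h z).
rewrite [X in X <= _](_ : _ = I) => [IJ|]; last first.
  apply: eq_integral => z /[1!inE] Dz.
  rewrite !poweRM ?h0 ?lee_fin ?(ltW (N0 Dz)) ?mulr_ge0 ?powR_ge0//.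
  rewrite -muleA [h z `^ _ * (_ * _)]muleA -poweRD; last first.
    by rewrite add_neq0_poweRD_def// addrC subrK.
  rewrite [(p^-1 + _)%R]addrC subrK poweRe1 ?h0// [h z * _]muleC muleA.
  rewrite !poweR_EFin -EFinM; congr (_%:E * _).
  rewrite powRM ?powR_ge0// -!powRrM mulfV ?gt_eqF// powRr1 ?K0//.
  rewrite -mulrA -powRDgt0 ?N0//.
  suff -> : ((1 - p) * p^-1 + (1 - p^-1) = 0)%R by rewrite powRr0 mulr1.
  by field; rewrite gt_eqF.
have J0 : 0 <= J by exact: integral_ge0.
have HN0 : 0 <= \int[m2]_(z in D2) (h z * (N z)%:E) by exact: integral_ge0.
have I0 : 0 <= I.
  by apply: integral_ge0 => z Dz; rewrite mule_ge0 ?h0// lee_fin K0.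
have := gt0_ler_poweR (ltW p0) _ _ IJ.
rewrite !in_itv/= !leey !andbT I0 mule_ge0 ?poweR_ge0// => /(_ isT isT).
move=> /le_trans; apply.
rewrite poweRM ?poweR_ge0// -!poweRrM mulVf ?gt_eqF// poweRe1// muleC.
by rewrite mulrBl mul1r mulVf ?gt_eqF.
Qed.

(** Integrating [pointwise_minkowski] against w and exchanging the integrals leaves N^(1-p) times
    the p-th power of the norm of K(., z), hence at most N^(1-p) N^p = N. Taking a positive finite
    majorant N in place of the norm keeps the factor N^(1-p) meaningful. *)
Lemma kernel_minkowski (p : R) : (1 <= p)%R ->
  (forall z, D2 z ->
    \int[m1]_(x in D1) (K (x, z) `^ p * w x)%:E <= (N z `^ p)%:E) ->
  \int[m1]_(x in D1)
    ((\int[m2]_(z in D2) ((K (x, z))%:E * h z)) `^ p * (w x)%:E) <=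
  (\int[m2]_(z in D2) (h z * (N z)%:E)) `^ p.
Proof.
move=> p1 KN; have p0 : (0 < p)%R by exact: lt_le_trans p1.
set M := \int[m2]_(z in D2) (h z * (N z)%:E).
have M0 : 0 <= M by exact: integral_ge0.
pose f (xz : T1 * T2) :=
  (K xz `^ p * N xz.2 `^ (1 - p) * w xz.1)%:E * h xz.2.
have mf : measurable_fun (D1 `*` D2) f.
  apply: emeasurable_funM; last exact: measurable_snd_rectangle.
  apply/measurable_EFinP; apply: measurable_funM.
    apply: measurable_funM; first exact: (measurableT_comp (measurable_powR p)).
    apply: (measurableT_comp (measurable_powR (1 - p))).
    exact: measurable_snd_rectangle.
  exact: measurable_fst_rectangle.
have f0 x z : D1 x -> D2 z -> 0 <= f (x, z).
  move=> Dx Dz; rewrite mule_ge0 ?h0// lee_fin !mulr_ge0// ?powR_ge0//.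
  exact: w0.
have Ff x : D1 x -> \int[m2]_(z in D2) ((K (x, z) `^ p * N z `^ (1 - p))%:E * h z)
   * (w x)%:E = \int[m2]_(z in D2) f (x, z).
  move=> Dx; rewrite muleC -ge0_integralZl_EFin ?w0//.
  - by apply: eq_integral => z _; rewrite muleA -EFinM mulrC.
  - by move=> z Dz; rewrite mule_ge0 ?h0// lee_fin mulr_ge0// powR_ge0.
  - apply: emeasurable_funM => //; apply/measurable_EFinP; apply: measurable_funM.
      apply: (measurableT_comp (measurable_powR p)); exact: measurable_section2.
    exact: (measurableT_comp (measurable_powR (1 - p)) mN).
have mF := measurable_integral2 m2 mD1 mD2 mf f0.
have F0 x : D1 x -> 0 <= \int[m2]_(z in D2) f (x, z).
  by move=> Dx; apply: integral_ge0 => z Dz; exact: f0.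
apply: (@le_trans _ _ (\int[m1]_(x in D1)
    (M `^ (p - 1) * \int[m2]_(z in D2) f (x, z)))).
  apply: ge0_le_integral => //.
  - by move=> x Dx; rewrite mule_ge0 ?poweR_ge0// lee_fin w0.
  - apply: emeasurable_funM; last exact/measurable_EFinP.
    apply: (measurableT_comp (measurable_poweR p)).
    exact: measurable_kernel_integral.
  - exact: measurable_funeM.
  - move=> x Dx; rewrite -Ff// muleA; apply: lee_wpmul2r.
      by rewrite lee_fin w0.
    exact: pointwise_minkowski.
rewrite ge0_integralZl ?poweR_ge0// (fubini_tonelli_rectangle m1 m2 mD1 mD2 mf f0).
have -> : M `^ p = M `^ (p - 1) * M.
  rewrite -[X in _ = _ * X]poweRe1// -poweRD ?subrK//.
  by rewrite add_neq0_poweRD_def// subrK gt_eqF.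
apply: lee_wpmul2l; first exact: poweR_ge0.
apply: ge0_le_integral => //.
- by move=> z Dz; apply: integral_ge0 => x Dx; exact: f0.
- exact: measurable_integral1.
- move=> z Dz.
  have mKw : measurable_fun D1 (fun x => (K (x, z) `^ p * w x)%:E).
    apply/measurable_EFinP; apply: measurable_funM => //.
    apply: (measurableT_comp (measurable_powR p)); exact: measurable_section1.
  rewrite (_ : \int[m1]_(x in D1) f (x, z) =
      (N z `^ (1 - p))%:E * h z * \int[m1]_(x in D1) (K (x, z) `^ p * w x)%:E).
    rewrite -[in leRHS](_ : (N z `^ (1 - p))%:E * h z * (N z `^ p)%:E
        = h z * (N z)%:E).
      by apply: lee_wpmul2l (KN z Dz); rewrite mule_ge0 ?h0// lee_fin powR_ge0.
    rewrite muleC muleA -EFinM -powRDgt0 ?N0//.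
    by rewrite addrC subrK powRr1 ?(ltW (N0 Dz))// muleC.
  rewrite -ge0_integralZl//.
  - by apply: eq_integral => x _; rewrite /f/= muleAC -EFinM mulrAC mulrC mulrA.
  - by move=> x Dx; rewrite lee_fin mulr_ge0 ?powR_ge0 ?w0.
  - by rewrite mule_ge0 ?h0// lee_fin powR_ge0.
Qed.

(* Maurey's criterion: Hoelder's inequality for
   (K h)^q w = (psi^s w)^(1-q) (K h w / psi)^q with s = q/(1-q). *)
Lemma kernel_maurey (q : R) (psi : T1 -> R) : (0 < q < 1)%R ->
  measurable_fun D1 psi -> (forall x, D1 x -> (0 < psi x)%R) ->
  (forall z, D2 z ->
    \int[m1]_(x in D1) (K (x, z) * (w x / psi x))%:E <= (N z)%:E) ->
  \int[m1]_(x in D1)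
    ((\int[m2]_(z in D2) ((K (x, z))%:E * h z)) `^ q * (w x)%:E) <=
  (\int[m1]_(x in D1) (psi x `^ (q / (1 - q)) * w x)%:E) `^ (1 - q) *
  (\int[m2]_(z in D2) (h z * (N z)%:E)) `^ q.
Proof.
move=> /andP[q0 q1] mpsi psi0 KN; have q1' : (0 < 1 - q)%R by rewrite subr_gt0.
pose F x := \int[m2]_(z in D2) ((K (x, z))%:E * h z).
have F0 x : D1 x -> 0 <= F x.
  by move=> Dx; apply: integral_ge0 => z Dz; rewrite mule_ge0 ?h0// lee_fin K0.
have mF : measurable_fun D1 F := measurable_kernel_integral.
have mwpsi : measurable_fun D1 (fun x => w x / psi x)%R.
  apply: measurable_funM => //.
  exact: measurable_fun_invr_gt0.
have mpw : measurable_fun D1 (fun x => psi x `^ (q / (1 - q)) * w x)%R.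
  apply: measurable_funM => //.
  exact: (measurableT_comp (measurable_powR _) mpsi).
pose g x := (psi x `^ (q / (1 - q)) * w x)%:E.
pose k x := (w x / psi x)%:E * F x.
have mg : measurable_fun D1 g by exact/measurable_EFinP.
have mk : measurable_fun D1 k.
  by apply: emeasurable_funM => //; exact/measurable_EFinP.
have g0 x : D1 x -> 0 <= g x.
  by move=> Dx; rewrite lee_fin mulr_ge0 ?powR_ge0 ?w0.
have k0 x : D1 x -> 0 <= k x.
  by move=> Dx; rewrite mule_ge0 ?F0// lee_fin divr_ge0 ?w0// ltW// psi0.
have q01 : (0 < 1 - q < 1)%R by rewrite q1' ltrBlDr ltrDl.
have := geometric_hoelder m1 q01 mD1 mg mk g0 k0.
rewrite subKr.
rewrite [X in X <= _](_ : _ = \int[m1]_(x in D1) (F x `^ q * (w x)%:E)).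
  move=> /le_trans; apply; apply: lee_wpmul2l; first exact: poweR_ge0.
  apply: (gt0_ler_poweR (ltW q0)); rewrite ?in_itv/= ?leey ?andbT//.
  - exact: integral_ge0.
  - by apply: integral_ge0 => z Dz; rewrite mule_ge0 ?h0// lee_fin ltW// N0.
  pose f (xz : T1 * T2) := (K xz * (w xz.1 / psi xz.1))%:E * h xz.2.
  have mf : measurable_fun (D1 `*` D2) f.
    apply: emeasurable_funM; last exact: measurable_snd_rectangle.
    apply/measurable_EFinP; apply: measurable_funM => //.
    exact: (measurable_fst_rectangle mwpsi).
  have f0 x z : D1 x -> D2 z -> 0 <= f (x, z).
    move=> Dx Dz; rewrite mule_ge0 ?h0// lee_fin mulr_ge0 ?K0//=.
    by rewrite divr_ge0 ?w0 ?(ltW (psi0 _ _)).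
  rewrite (_ : \int[m1]_(x in D1) k x =
      \int[m1]_(x in D1) \int[m2]_(z in D2) f (x, z)); last first.
    apply: eq_integral => x /[1!inE] Dx.
    rewrite /k -ge0_integralZl_EFin//.
    - by apply: eq_integral => z _; rewrite muleA -EFinM mulrC.
    - by move=> z Dz; rewrite mule_ge0 ?h0// lee_fin K0.
    - exact: mKh.
    - by rewrite divr_ge0 ?w0 ?(ltW (psi0 _ _)).
  rewrite (fubini_tonelli_rectangle m1 m2 mD1 mD2 mf f0).
  apply: ge0_le_integral => //.
  - by move=> z Dz; apply: integral_ge0 => x Dx; exact: f0.
  - exact: (measurable_integral1 m1 mD1 mD2 mf f0).
  - move=> z Dz; rewrite /f/=.
    under eq_integral do rewrite muleC.
    rewrite ge0_integralZl ?h0//.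
    + by apply: lee_wpmul2l (KN z Dz); exact: h0.
    + apply/measurable_EFinP; apply: measurable_funM => //.
      exact: measurable_section1.
    + by move=> x Dx; rewrite lee_fin mulr_ge0 ?K0// divr_ge0 ?w0 ?(ltW (psi0 _ _)).
apply: eq_integral => x /[1!inE] Dx.
have psix := psi0 _ Dx; have wx := w0 Dx.
rewrite /g /k poweRM ?F0// ?lee_fin ?divr_ge0 ?(ltW psix)//.
rewrite muleA !poweR_EFin -EFinM muleC; congr (_ * _%:E).
(* The powers of psi cancel: the first factor contributes s (1 - q) = q, the second -q. *)
rewrite !powRM ?powR_ge0 ?invr_ge0 ?(ltW psix)// -powRrM divfK ?gt_eqF//.
transitivity ((w x `^ (1 - q) * w x `^ q) *
  (psi x `^ q * (psi x)^-1 `^ q))%R; first by ring.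
rewrite -powRD ?subrK ?oner_eq0// powRr1// -powRM ?invr_ge0 ?(ltW psix)//.
by rewrite divff ?gt_eqF// powR1 mulr1.
Qed.
End kernel_operators.

(** The exponent s - 1 may have either sign, so monotonicity of the power is of no use. Writing
    a^(s-1) as a^s / a allows to use the lower bound of a for the numerator and the upper bound for
    the denominator. *)
Lemma half_powR_le (R : realType) (a b s : R) : (0 < s)%R -> (0 < b)%R ->
  (b / 2 < a)%R -> (a <= b)%R -> (2 `^ (- s) * b `^ (s - 1) <= a `^ (s - 1))%R.
Proof.
move=> s0 b0 ba ab; have a0 : (0 < a)%R by lra.
rewrite !powRDgt0// !powR_inv1 ?(ltW a0) ?(ltW b0)//.
have -> : (2 `^ (- s) * (b `^ s / b) = (b / 2) `^ s / b)%R.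
  by rewrite powRM ?(ltW b0)// -(@powR_inv1 _ 2%R)// -powRrM mulN1r; ring.
rewrite ler_pM ?powR_ge0 ?invr_ge0 ?(ltW b0)//.
- by rewrite ge0_ler_powR ?nnegrE ?(ltW s0)//; lra.
- by rewrite lef_pV2.
Qed.

(** * Hardy operators along an order, with a monotone weight *)

Section hardy_monotone_weight.
Context d (T : measurableType d) (R : realType).
Variable m : {sigma_finite_measure set T -> \bar R}.
Variables (D : set T) (P : T -> T -> bool) (w W G : T -> R) (f : T -> \bar R).
Hypotheses (mD : measurable D)
  (mP : measurable_fun (D `*` D) (fun xz => P xz.1 xz.2))
  (mw : measurable_fun D w) (mW : measurable_fun D W)
  (mG : measurable_fun D G) (mf : measurable_fun D f).
Hypotheses (w0 : forall x, D x -> (0 <= w x)%R)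
  (W0 : forall x, D x -> (0 < W x)%R) (G0 : forall x, D x -> (0 < G x)%R)
  (f0 : forall x, D x -> 0 <= f x).
(** P is an order on D and W its distribution function for the measure w. Two inequalities for
    masses replace the relation dW = w, so the same argument serves < with the lower mass and the
    reversed order with the upper mass. *)
Hypotheses
  (W_le : forall z, D z -> (W z)%:E <= \int[m]_(t in D) ((P t z)%:R * w t)%:E)
  (level_le : forall l : R, (0 < l)%R ->
    \int[m]_(t in D) ((W t <= l)%R%:R * w t)%:E <= l%:E)
  (P_mono : forall t z, D t -> D z -> P t z -> (W t <= W z)%R /\ (G z <= G t)%R).
Variable q : R.
Hypothesis q01 : (0 < q < 1)%R.

Let s := (q / (1 - q))%R.

Let q0 : (0 < q)%R. Proof. by case/andP: q01. Qed.
Let q1 : (0 < 1 - q)%R. Proof. by rewrite subr_gt0; case/andP: q01. Qed.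
Let s0 : (0 < s)%R. Proof. by rewrite divr_gt0. Qed.

Let J := \int[m]_(x in D) (G x `^ s * W x `^ s * w x)%:E.
Hypothesis J_fin : J < +oo.

(** Formally this is the density of G^s d(W^s), up to the factor s. Its tail integral [E] should
    majorise (G W)^s and decrease as W grows; the factor 2 in the cut-off of [E] leaves room for the
    points where W lies between W z / 2 and W z. *)
Let dens y := (G y `^ s * W y `^ (s - 1) * w y)%R.
Let E x := \int[m]_(y in D) ((W x <= 2 * W y)%R%:R * dens y)%:E.

Let mdens : measurable_fun D dens.
Proof.
apply: measurable_funM => //; apply: measurable_funM.
- exact: (measurableT_comp (measurable_powR _) mG).
- exact: (measurableT_comp (measurable_powR _) mW).
Qed.

Let dens0 y : D y -> (0 <= dens y)%R.
Proof. by move=> Dy; rewrite !mulr_ge0 ?powR_ge0 ?w0. Qed.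

Let mlevel : measurable_fun (D `*` D)
  (fun xy => (W xy.1 <= 2 * W xy.2)%R%:R : R).
Proof.
apply: measurable_boolR; apply: measurable_fun_ler.
- exact: (measurable_fst_rectangle _ mW).
- apply: measurable_funM; first exact: measurable_cst.
  exact: (measurable_snd_rectangle _ mW).
Qed.

Let mE : measurable_fun D E.
Proof.
apply: (@measurable_integral2 _ _ _ _ _ m D D
  (fun xy => ((W xy.1 <= 2 * W xy.2)%R%:R * dens xy.2)%:E)) => //.
- apply/measurable_EFinP; apply: measurable_funM => //.
  exact: (measurable_snd_rectangle _ mdens).
- by move=> x y Dx Dy; rewrite lee_fin mulr_ge0//= dens0.
Qed.

Let mPw z : D z -> measurable_fun D (fun t => (P t z)%:R * w t)%R.
Proof.
move=> Dz; apply: measurable_funM => //; apply: measurable_boolR.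
exact: (measurable_section1 mD mD Dz mP).
Qed.

(** Of the mass at least W z preceding z, the level set {W <= W z / 2} can hold at most half of W
    z. *)
Let mass_above z : D z -> (W z / 2)%:E <=
  \int[m]_(t in D) ((P t z && (W z / 2 < W t)%R)%:R * w t)%:E.
Proof.
move=> Dz; have Wz2 : (0 < W z / 2)%R by rewrite divr_gt0 ?W0.
set I := \int[m]_(t in D) _.
have mA : measurable_fun D (fun t => (P t z && (W z / 2 < W t)%R)%:R * w t)%R.
  apply: measurable_funM => //; apply: measurable_boolR; apply: measurable_and.
    exact: (measurable_section1 mD mD Dz mP).
  exact: measurable_fun_ltr.
have mB : measurable_fun D (fun t => (W t <= W z / 2)%R%:R * w t)%R.
  by apply: measurable_funM => //; apply: measurable_boolR; exact: measurable_fun_ler.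
have : (W z)%:E <= I + (W z / 2)%:E.
  apply: (le_trans (W_le Dz)); apply: le_trans (leeD2l _ (level_le Wz2)).
  rewrite /I -ge0_integralD//; last 4 first.
  - by move=> t Dt; rewrite lee_fin mulr_ge0// w0.
  - exact/measurable_EFinP.
  - by move=> t Dt; rewrite lee_fin mulr_ge0// w0.
  - exact/measurable_EFinP.
  apply: ge0_le_integral => //.
  - by move=> t Dt; rewrite lee_fin mulr_ge0// w0.
  - by apply/measurable_EFinP; exact: mPw.
  - by apply: emeasurable_funD; exact/measurable_EFinP.
  - move=> t Dt; rewrite -EFinD lee_fin -mulrDl ler_wpM2r ?w0//.
    by rewrite ltNge; case: (P t z) (W t <= W z / 2)%R => -[] /=; lra.
case: I => [r||//].
- rewrite -EFinD !lee_fin; lra.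
- by move=> _; rewrite leey.
Qed.

(** The points of [mass_above] satisfy W x <= W z < 2 W t, so all of them count in [E x]. On them G
    is at least G z and W^(s-1) at least 2^(-s) W(z)^(s-1); their mass W z / 2 supplies the
    remaining power of W z and the remaining factor 1/2. *)
Let E_ge x z : D x -> D z -> (W x <= W z)%R ->
  (2 `^ (- (s + 1)) * (G z * W z) `^ s)%:E <= E x.
Proof.
move=> Dx Dz Wxz; have Wz := W0 Dz.
pose c := (G z `^ s * (2 `^ (- s) * W z `^ (s - 1)))%R.
have c0 : (0 <= c)%R by rewrite !mulr_ge0// powR_ge0.
have -> : (2 `^ (- (s + 1)) * (G z * W z) `^ s = c * (W z / 2))%R.
  rewrite powRM ?(ltW (G0 Dz)) ?(ltW Wz)// opprD powRDgt0// powR_inv1// /c.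
  rewrite -[in LHS](subrK 1%R s) [(W z `^ (_ + 1))%R]powRDgt0// powRr1 ?(ltW Wz)//.
  by rewrite subrK; ring.
have mA : measurable_fun D (fun t => (P t z && (W z / 2 < W t)%R)%:R * w t)%R.
  apply: measurable_funM => //; apply: measurable_boolR; apply: measurable_and.
    exact: (measurable_section1 mD mD Dz mP).
  exact: measurable_fun_ltr.
have A0 t : D t -> 0 <= ((P t z && (W z / 2 < W t)%R)%:R * w t)%:E.
  by move=> Dt; rewrite lee_fin mulr_ge0// w0.
rewrite EFinM; apply: (le_trans (lee_wpmul2l _ (mass_above Dz))) => //.
rewrite -ge0_integralZl_EFin//; last exact/measurable_EFinP.
apply: ge0_le_integral => //.
- by move=> t Dt; rewrite mule_ge0// A0.
- by apply: measurable_funeM; exact/measurable_EFinP.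
- apply/measurable_EFinP; apply: measurable_funM => //.
  exact: (measurable_section2 mD mD Dx mlevel).
- move=> t Dt; rewrite -EFinM lee_fin.
  have [/andP[Ptz Wzt]|_] := boolP (P t z && _); last first.
    by rewrite mul0r mulr0 mulr_ge0// dens0.
  have [Wtz Gzt] := P_mono Dt Dz Ptz.
  have -> : (W x <= 2 * W t)%R by lra.
  rewrite !mul1r /dens /c ler_wpM2r ?w0// ler_pM ?powR_ge0 ?mulr_ge0 ?powR_ge0//.
    by rewrite ge0_ler_powR ?nnegrE ?(ltW s0) ?(ltW (G0 _)).
  exact: half_powR_le.
Qed.

(** On the cut-off 1 / W y is at most 2 / W x, which bounds the density by 2 / W x times the
    integrand of J. *)
Let E_fin x : D x -> E x < +oo.
Proof.
move=> Dx; have Wx := W0 Dx.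
have mGW : measurable_fun D (fun y => G y `^ s * W y `^ s * w y)%R.
  apply: measurable_funM => //; apply: measurable_funM.
  - exact: (measurableT_comp (measurable_powR _) mG).
  - exact: (measurableT_comp (measurable_powR _) mW).
apply: (@le_lt_trans _ _ ((2 / W x)%:E * J)); last first.
  rewrite lte_mul_pinfty// ?lee_fin ?divr_ge0 ?(ltW Wx)//.
rewrite /J -ge0_integralZl_EFin//; last 3 first.
- by move=> y Dy; rewrite lee_fin !mulr_ge0 ?powR_ge0 ?w0.
- exact/measurable_EFinP.
- by rewrite divr_ge0// ltW.
apply: ge0_le_integral => //.
- by move=> y Dy; rewrite lee_fin mulr_ge0// dens0.
- apply/measurable_EFinP; apply: measurable_funM => //.
  exact: (measurable_section2 mD mD Dx mlevel).
- by apply: measurable_funeM; exact/measurable_EFinP.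
- move=> y Dy; have Wy := W0 Dy; rewrite -EFinM lee_fin.
  have [Wxy|_] := boolP (W x <= 2 * W y)%R; last first.
    by rewrite mul0r mulr_ge0 ?divr_ge0 ?(ltW Wx)// !mulr_ge0 ?powR_ge0 ?w0.
  rewrite mul1r /dens mulrA ler_wpM2r ?w0// mulrCA ler_wpM2l ?powR_ge0//.
  rewrite powRDgt0// powR_inv1 ?(ltW Wy)// mulrC ler_wpM2r ?powR_ge0//.
  by rewrite ler_pdivlMr// mulrC ler_pdivrMr.
Qed.

(** After exchanging the integrals the inner one is the mass of {W <= 2 W y}, at most 2 W y, which
    raises the exponent s - 1 of the density back to s. *)
Let int_E : \int[m]_(x in D) (E x * (w x)%:E) <= 2%:E * J.
Proof.
rewrite /E.
pose g (xy : T * T) := ((W xy.1 <= 2 * W xy.2)%R%:R * dens xy.2 * w xy.1)%:E.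
have mg : measurable_fun (D `*` D) g.
  apply/measurable_EFinP; apply: measurable_funM; last first.
    exact: (measurable_fst_rectangle _ mw).
  apply: measurable_funM => //; exact: (measurable_snd_rectangle _ mdens).
have g0 x y : D x -> D y -> 0 <= g (x, y).
  by move=> Dx Dy; rewrite lee_fin !mulr_ge0 ?powR_ge0 ?w0.
rewrite (_ : \int[m]_(x in D) _ = \int[m]_(x in D) \int[m]_(y in D) g (x, y)).
  rewrite (fubini_tonelli_rectangle m m mD mD mg g0) /J.
  rewrite -ge0_integralZl_EFin//; last 2 first.
  - by move=> x Dx; rewrite lee_fin !mulr_ge0 ?powR_ge0 ?w0.
  - apply/measurable_EFinP; apply: measurable_funM => //; apply: measurable_funM.
    + exact: (measurableT_comp (measurable_powR _) mG).
    + exact: (measurableT_comp (measurable_powR _) mW).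
  apply: ge0_le_integral => //.
  - by move=> y Dy; apply: integral_ge0 => x Dx; exact: g0.
  - exact: (measurable_integral1 m mD mD mg g0).
  - apply: measurable_funeM; apply/measurable_EFinP; apply: measurable_funM => //.
    apply: measurable_funM.
    + exact: (measurableT_comp (measurable_powR _) mG).
    + exact: (measurableT_comp (measurable_powR _) mW).
  - move=> y Dy; have Wy := W0 Dy.
    have -> : (2%:E * (G y `^ s * W y `^ s * w y)%:E = (dens y)%:E * (2 * W y)%:E)%E.
      rewrite -!EFinM /dens -[in LHS](subrK 1%R s).
      by rewrite [(W y `^ (_ + 1))%R]powRDgt0// powRr1 ?(ltW Wy)// subrK;
        congr EFin; ring.
    have l0 : (0 < 2 * W y)%R by rewrite mulr_gt0.
    apply: le_trans (lee_wpmul2l _ (level_le l0)); last by rewrite lee_fin dens0.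
    rewrite -ge0_integralZl_EFin ?dens0//.
    + rewrite le_eqVlt; apply/predU1P; left; apply: eq_integral => x _.
      by rewrite /g/= -EFinM; congr EFin; ring.
    + by move=> x Dx; rewrite lee_fin mulr_ge0// w0.
    + apply/measurable_EFinP; apply: measurable_funM => //; apply: measurable_boolR.
      exact: measurable_fun_ler.
apply: eq_integral => x /[1!inE] Dx.
rewrite muleC -ge0_integralZl_EFin ?w0//.
- by apply: eq_integral => y _; rewrite /g/= -EFinM mulrC.
- by move=> y Dy; rewrite lee_fin mulr_ge0// dens0.
- apply/measurable_EFinP; apply: measurable_funM => //.
  exact: (measurable_section2 mD mD Dx mlevel).
Qed.

(* Maurey's criterion with [psi = E^(1/s)]: the mass of [{t | P t z}] where
   [W > W z / 2] is at least [W z / 2], which bounds [E] from below by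
   [(G z * W z)^s] and makes [\int w / psi] over [{x | P x z}] at most a
   multiple of [1 / G z]. *)
Lemma hardy_monotone_weight :
  \int[m]_(x in D)
    ((\int[m]_(z in D) ((P x z)%:R%:E * f z)) `^ q * (w x)%:E) <=
  4%:E * J `^ (1 - q) * (\int[m]_(z in D) (f z * (G z)^-1%:E)) `^ q.
Proof.
have E0 x : D x -> (0 < fine (E x))%R.
  move=> Dx; rewrite fine_gt0// E_fin// andbT.
  apply: (lt_le_trans _ (E_ge Dx Dx (lexx _))).
  by rewrite lte_fin mulr_gt0 ?powR_gt0 ?mulr_gt0 ?W0 ?G0.
have EE x : D x -> (fine (E x))%:E = E x.
  move=> Dx; rewrite fineK// ge0_fin_numE ?E_fin//.
  by apply: integral_ge0 => y Dy; rewrite lee_fin mulr_ge0// dens0.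
pose psi x := (fine (E x) `^ s^-1)%R.
have mpsi : measurable_fun D psi.
  apply: (measurableT_comp (measurable_powR _)).
  apply: (measurable_comp (F := setT)) => //; exact: fine_measurable.
have psi0 x : D x -> (0 < psi x)%R by move=> Dx; rewrite powR_gt0// E0.
(* The s-th root of the constant 2^(s+1) lost in [E_ge]. *)
pose c := (2 `^ ((s + 1) / s) : R)%R.
have c0 : (0 < c)%R by rewrite powR_gt0.
have mPr : measurable_fun (D `*` D) (fun xz => (P xz.1 xz.2)%:R : R).
  exact: measurable_boolR.
have mN : measurable_fun D (fun z => c * (G z)^-1)%R.
  apply: measurable_funM => //.
  exact: measurable_fun_invr_gt0.
have N0 z : D z -> (0 < c * (G z)^-1)%R by move=> Dz; rewrite mulr_gt0// invr_gt0 G0.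
have psi_ge x z : D x -> D z -> P x z -> (G z * W z <= c * psi x)%R.
  move=> Dx Dz Pxz; have [Wxz _] := P_mono Dx Dz Pxz.
  have := E_ge Dx Dz Wxz; rewrite -(EE x Dx) lee_fin => H.
  have GW0 : (0 <= G z * W z)%R by rewrite mulr_ge0 ?(ltW (G0 _)) ?(ltW (W0 _)).
  have := ge0_ler_powR (_ : 0 <= s^-1)%R _ _ H.
  rewrite !nnegrE invr_ge0 (ltW s0) mulr_ge0 ?powR_ge0// (ltW (E0 _ Dx)).
  move=> /(_ isT isT isT); rewrite powRM ?powR_ge0//.
  rewrite -!powRrM mulfV ?gt_eqF// powRr1// mulNr powRN => H'.
  by rewrite -ler_pdivrMl.
have KN z : D z -> \int[m]_(x in D) ((P x z)%:R * (w x / psi x))%:E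
    <= (c * (G z)^-1)%:E.
  move=> Dz; have Wz := W0 Dz; have Gz := G0 Dz.
  apply: (@le_trans _ _ (\int[m]_(x in D)
      ((c / (G z * W z))%:E * ((W x <= W z)%R%:R * w x)%:E))).
    apply: ge0_le_integral => //.
    - by move=> x Dx; rewrite lee_fin !mulr_ge0 ?invr_ge0 ?powR_ge0 ?w0.
    - apply/measurable_EFinP; apply: measurable_funM.
        exact: (measurable_section1 mD mD Dz mPr).
      apply: measurable_funM => //.
      exact: measurable_fun_invr_gt0.
    - apply: measurable_funeM; apply/measurable_EFinP; apply: measurable_funM => //.
      by apply: measurable_boolR; exact: measurable_fun_ler.
    - move=> x Dx; rewrite -EFinM lee_fin.
      have [Pxz|_] := boolP (P x z); last first.
        by rewrite mul0r !mulr_ge0 ?invr_ge0 ?mulr_ge0 ?(ltW c0) ?(ltW Gz) ?(ltW Wz) ?w0.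
      have [-> _] := P_mono Dx Dz Pxz.
      rewrite !mul1r mulrC ler_wpM2r ?w0// ler_pdivlMr ?mulr_gt0//.
      by rewrite ler_pdivrMl ?psi0// [leRHS]mulrC psi_ge.
  rewrite ge0_integralZl_EFin//; last 3 first.
  - by move=> x Dx; rewrite lee_fin mulr_ge0// w0.
  - apply/measurable_EFinP; apply: measurable_funM => //.
    by apply: measurable_boolR; exact: measurable_fun_ler.
  - by rewrite divr_ge0 ?mulr_ge0 ?(ltW c0) ?(ltW Gz) ?(ltW Wz).
  apply: (@le_trans _ _ ((c / (G z * W z))%:E * (W z)%:E)).
    apply: lee_wpmul2l (level_le Wz).
    by rewrite lee_fin divr_ge0 ?mulr_ge0 ?(ltW c0) ?(ltW Gz) ?(ltW Wz).
  rewrite -EFinM lee_fin invfM -!mulrA mulVf ?gt_eqF// mulr1//.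
have := @kernel_maurey _ _ T T R m m D D mD mD
  (fun xz => (P xz.1 xz.2)%:R%R) w f (fun z => c * (G z)^-1)%R mPr mw mf mN
  (fun x z _ _ => ler0n _ _) w0 f0 N0 q psi q01 mpsi psi0 KN.
rewrite /= -/s => /le_trans; apply.
have -> : \int[m]_(x in D) (psi x `^ s * w x)%:E = \int[m]_(x in D) (E x * (w x)%:E).
  apply: eq_integral => x /[1!inE] Dx.
  by rewrite /psi -powRrM mulVf ?gt_eqF// powRr1 ?(ltW (E0 _ _))// EFinM EE.
have -> : \int[m]_(z in D) (f z * (c * (G z)^-1)%:E) =
    c%:E * \int[m]_(z in D) (f z * (G z)^-1%:E).
  rewrite -ge0_integralZl_EFin ?(ltW c0)//.
  - by apply: eq_integral => z _; rewrite EFinM muleCA.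
  - by move=> z Dz; rewrite mule_ge0 ?f0// lee_fin invr_ge0 (ltW (G0 Dz)).
  - apply: emeasurable_funM => //; apply/measurable_EFinP.
    exact: measurable_fun_invr_gt0.
have J0 : 0 <= J.
  by apply: integral_ge0 => x Dx; rewrite lee_fin !mulr_ge0 ?powR_ge0 ?w0.
rewrite poweRM ?lee_fin ?(ltW c0)//; last first.
  by apply: integral_ge0 => z Dz; rewrite mule_ge0 ?f0// lee_fin invr_ge0 (ltW (G0 Dz)).
rewrite muleA; apply: lee_wpmul2r; first exact: poweR_ge0.
apply: (@le_trans _ _ ((2%:E * J) `^ (1 - q) * c%:E `^ q)).
  apply: lee_wpmul2r; first exact: poweR_ge0.
  apply: (gt0_ler_poweR (ltW q1)); rewrite ?in_itv/= ?leey ?andbT ?mule_ge0//.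
  apply: integral_ge0 => x Dx; rewrite mule_ge0 ?lee_fin ?w0//.
  by rewrite -(EE x Dx) lee_fin ltW// E0.
rewrite poweRM// !poweR_EFin muleAC -EFinM; apply: lee_wpmul2r.
  exact: poweR_ge0.
rewrite lee_fin /c -powRrM -powRDgt0//.
(* [int_E] costs 2^(1-q), and c^q = 2 because (s + 1) / s = 1 / q; the product 2^(2-q) is at most
   4. *)
have -> : (4 = 2 `^ 2 :> R)%R by rewrite powR_mulrn// -natrX.
rewrite ler_powR ?ler1n//.
have -> : (1 - q + (s + 1) / s * q = 1 - q + 1 :> R)%R.
  by rewrite /s; field; rewrite !gt_eqF.
by have := q0; lra.
Qed.
End hardy_monotone_weight.

(** * Sparse families and initial segments *)

Section sparse_subset.
Context (R : realFieldType) (I : finType).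
Implicit Types (b e : I -> R) (S : {set I}).

Local Open Scope ring_scope.

(** Greedy selection: keep an index j of largest e, discard the indices whose b is at most twice b
    j, and continue with the rest. The selected values of b more than double at each step, so those
    below tau form a geometric sum. The correction -m by a lower bound of the selected values is
    what makes the induction close. *)
Lemma doubling_subset b e S : (forall i, 0 < b i) -> exists S' : {set I},
  [/\ S' \subset S,
      forall i, i \in S -> exists2 j, j \in S' & b i <= 2 * b j /\ e i <= e j &
      forall m tau, (forall i, i \in S' -> m <= b i) -> m <= 2 * tau ->
        \sum_(i in S' | b i <= tau) b i <= 2 * tau - m].
Proof.
move=> b0; have [n] := ubnP #|S|; elim: n S => // n IH S; rewrite ltnS => Sn.
have [->|[k kS]] := finset.set_0Vmem S.
  exists finset.set0; split => [|i|m tau _ mtau]; rewrite ?finset.sub0set ?inE//.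
  by rewrite big1 ?subr_ge0// => i; rewrite inE.
case: (@Order.TotalTheory.arg_maxP _ _ _ k (mem S) e kS) => j jS0 je0.
have jS : j \in S := jS0.
have {je0} je i : i \in S -> e i <= e j := je0 i.
(* What is left out of [S1] is dominated by j: in e by maximality, in b up to the factor 2. *)
pose S1 := [set i in S | 2 * b j < b i].
have jS1 : j \notin S1.
  by rewrite !inE jS/= -leNgt; have := b0 j; lra.
have S1S : S1 \subset S by apply/fintype.subsetP => i; rewrite !inE => /andP[].
have S1n : (#|S1| < n)%N.
  apply: leq_trans Sn; apply: proper_card; apply/fintype.properP; split => //.
  by exists j.
have [S2 [S21 dom sparse]] := IH S1 S1n.
have jS2 : j \notin S2 by apply: contra jS1; exact: (fintype.subsetP S21).
have big i : i \in S2 -> 2 * b j < b i.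
  by move=> /(fintype.subsetP S21); rewrite !inE => /andP[].
exists (j |: S2)%SET; split.
- by rewrite finset.subUset finset.sub1set jS/=; exact: fintype.subset_trans S21 S1S.
- move=> i iS; have [bi|bi] := leP (b i) (2 * b j).
    by exists j; rewrite ?finset.setU11//; split => //; exact: je.
  have /dom[l lS2 [? ?]] : i \in S1 by rewrite !inE iS.
  by exists l => //; rewrite finset.setU1r.
- move=> m tau mb mtau; rewrite big_mkcondr/= big_setU1//= -big_mkcondr/=.
  have mbj : m <= b j by apply: mb; rewrite finset.setU11.
  have [bj|bj] := leP (b j) tau.
    (* The later values exceed 2 b j, so they sum up to at most 2 tau - 2 b j; adding b j itself
       leaves 2 tau - b j, and m <= b j. *)
    have := sparse (2 * b j) tau (fun i iS => ltW (big _ iS)).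
    by rewrite ler_pM2l// => /(_ bj); lra.
  rewrite add0r big_pred0 ?subr_ge0// => i.
  apply/negbTE/negP => /andP[/big]; have := b0 j; lra.
Qed.

(* Thinning first by [b] and then by [e] leaves values of [b] and of [e] that
   grow geometrically, so both the terms equal to [b i] and those equal to
   [e i * y] sum up to a multiple of the largest one. *)
Lemma sparse_subset b e S : (forall i, 0 < b i) -> (forall i, 0 < e i) ->
  exists S' : {set I},
  [/\ S' \subset S,
      forall i, i \in S -> exists2 j, j \in S' & b i <= 2 * b j /\ e i <= 2 * e j &
      forall y tau, 0 < y -> 0 <= tau ->
        (forall i, i \in S' -> Num.min (b i) (e i * y) <= tau) ->
        \sum_(i in S') Num.min (b i) (e i * y) <= 4 * tau].
Proof.
move=> b0 e0; have [S1 [S1S dom1 sp1]] := doubling_subset e S b0.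
have [S2 [S21 dom2 sp2]] := doubling_subset b S1 e0.
exists S2; split; first exact: fintype.subset_trans S21 S1S.
  move=> i /dom1[j /dom2[k kS [? ?]] [? ?]]; exists k => //; split; lra.
move=> y tau y0 tau0 le_tau.
have sum_b : \sum_(i in S2 | b i <= tau) b i <= 2 * tau.
  have := sp1 0 tau (fun i _ => ltW (b0 i)); rewrite subr0 mulr_ge0//.
  move=> /(_ isT); apply: le_trans.
  rewrite [leLHS]big_mkcondr [leRHS]big_mkcondr/=.
  rewrite [leRHS](finset.big_setID S2)/= (finset.setIidPr S21) lerDl sumr_ge0// => i _.
  by case: ifP => // _; exact: ltW.
have sum_e : \sum_(i in S2 | e i <= tau / y) e i <= 2 * (tau / y).
  have := sp2 0 (tau / y) (fun i _ => ltW (e0 i)); rewrite subr0.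
  by apply; rewrite mulr_ge0// divr_ge0// ltW.
have sum_ey : \sum_(i in S2 | e i <= tau / y) e i * y <= 2 * tau.
  by rewrite -mulr_suml -ler_pdivlMr// -mulrA.
(* A minimum bounded by tau has b i <= tau or e i * y <= tau, so each term is counted in one of two
   geometric sums, both at most 2 tau. *)
apply: (@le_trans _ _ (\sum_(i in S2 | b i <= tau) b i +
                       \sum_(i in S2 | e i <= tau / y) e i * y)); last by lra.
rewrite [X in _ <= X + _]big_mkcondr [X in _ <= _ + X]big_mkcondr -big_split/=.
apply: ler_sum => i iS; have := le_tau i iS; rewrite ge_min ler_pdivlMr//.
have bi := b0 i; have eyi : 0 < e i * y by rewrite mulr_gt0.
move=> /orP[bt|et].
- by rewrite bt ge_min lerDl; case: ifP => _; rewrite ?lexx// ltW.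
- by rewrite et ge_min lerDr; case: ifP => _; rewrite ?(ltW bi) ?lexx ?orbT.
Qed.

End sparse_subset.

(** * Measure of a set whose initial segments are small *)

Section initial_segments.
Context (R : realType).
Local Notation mu := (@lebesgue_measure R).
Variables (P : rel R) (D : set R) (w : R -> R).
Hypotheses (P_trans : transitive P)
  (P_total : forall x y, x != y -> P x y || P y x)
  (P_dense : forall x y, P x y -> exists q : rat, P x (ratr q) && P (ratr q) y)
  (mP : forall x, measurable [set t | P t x]).
Hypotheses (mD : measurable D) (mw : measurable_fun D w)
  (w0 : forall x, D x -> (0 <= w x)%R).

(* Up to its last point, [S] is a countable union of nested initial segments
   with rational endpoints. *)
Lemma integral_initial_segments (S : set R) (l : \bar R) :
  measurable S -> S `<=` D -> 0 <= l ->
  (forall x, S x -> \int[mu]_(t in D `&` [set t | P t x]) (w t)%:E <= l) ->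
  \int[mu]_(t in S) (w t)%:E <= l.
Proof.
move=> mS SD l0 Sl.
(* Each [A k] is the initial segment ending at the rational with code k, or empty when no point of S
   lies beyond that rational. *)
pose A k : set R := if unpickle k is Some q then
  [set t | D t /\ P t (ratr q) /\ exists2 x, S x & P (ratr q) x] else set0.
pose F n := \big[setU/set0]_(k < n.+1) A k.
have mA k : measurable (A k).
  rewrite /A; case: unpickle => // q.
  have [[x Sx qx]|nx] := pselect (exists2 x, S x & P (ratr q) x).
    rewrite (_ : [set _ | _] = D `&` [set t | P t (ratr q)]); first exact: measurableI.
    by apply/seteqP; split => t /= => [[? []]|[? ?]] //;
      split => //; split => //; exists x.
  by rewrite (_ : [set _ | _] = set0)//; apply/seteqP; split => t //= [_ []].
have AD k : A k `<=` D by rewrite /A; case: unpickle => // q t [].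
have mF n : measurable (F n) by exact: bigsetU_measurable.
have FD n : F n `<=` D.
  by rewrite /F -bigcup_mkord => t [k _] /AD.
(* The order is total, so finitely many segments lie inside a single one ending at a point of S,
   where the hypothesis applies. *)
have F_le n : \int[mu]_(t in F n) (w t)%:E <= l.
  have [->|[x Sx Fx]] : F n = set0 \/ exists2 x, S x & F n `<=` [set t | P t x].
    rewrite /F; elim: n.+1 => [|m IH]; first by left; rewrite big_ord0.
    rewrite big_ord_recr/=.
    have AE : A m = set0 \/ exists2 x, S x & A m `<=` [set t | P t x].
      rewrite /A; case: unpickle => [q|]; last by left.
      have [[x Sx qx]|nx] := pselect (exists2 x, S x & P (ratr q) x).
        by right; exists x => // t [_ [tq _]]; exact: P_trans qx.
      by left; apply/seteqP; split => t //= [_ []].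
    case: IH AE => [->|[x Sx Fx]] [->|[y Sy Ay]].
    - by left; rewrite setU0.
    - by right; exists y; rewrite ?set0U.
    - by right; exists x; rewrite ?setU0.
    - right; have [xy|xy] := eqVneq x y.
        by exists x => // t [/Fx//|/Ay]; rewrite xy.
      have /orP[Pxy|Pyx] := P_total xy.
        by exists y => // t [/Fx/= tx|/Ay//]; exact: P_trans Pxy.
      by exists x => // t [/Fx//|/Ay/= ty]; exact: P_trans Pyx.
    by rewrite integral_set0.
  apply: le_trans (Sl x Sx); apply: ge0_subset_integral => //.
  - exact: mF.
  - exact: (measurableI _ _ mD (mP x)).
  - apply/measurable_EFinP; apply: measurable_funS mw => //.
  - by move=> t [Dt _]; rewrite lee_fin w0.
  - by move=> t Ft; split; [exact: FD Ft|exact: Fx].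
have bigF_le : \int[mu]_(t in \bigcup_n F n) (w t)%:E <= l.
  apply: (cvge_to_le (ge0_nondecreasing_set_cvg_integral _ _ _ _)) => //.
  - move=> m n mn; apply/subsetPset; apply: subset_bigsetU; exact: leq_trans mn _.
  - by move=> n; apply/measurable_EFinP; apply: measurable_funS mw.
  - by move=> n t /FD Dt; rewrite lee_fin w0.
  - by near=> n; exact: F_le.
have mbF : measurable (\bigcup_n F n) by exact: bigcup_measurable.
pose M := S `\` \bigcup_n F n.
(* A rational strictly between two points of S puts the smaller one into some [A k]; hence at most
   one point, the last one, is missed, and it is negligible. *)
have M1 x y : M x -> M y -> x = y.
  suff H : forall x y, M x -> M y -> ~ P x y.
    move=> Mx My; apply: contrapT => /eqP /P_total/orP[].
      exact: H.
    exact: H.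
  move=> {}x {}y [Sx Fx] [Sy _] /P_dense[q /andP[xq qy]]; apply: Fx.
  have [k kq] : exists k, unpickle k = Some q by exists (pickle q); rewrite pickleK.
  exists k => //; rewrite /F -bigcup_mkord; exists k; first exact: ltnSn.
  by rewrite /A kq; split; [exact: SD|split => //; exists y].
have M0 : mu M = 0.
  have [->|/set0P[x Mx]] := eqVneq M set0; first exact: measure0.
  rewrite (_ : M = [set x]) ?lebesgue_measure_set1//.
  by apply/seteqP; split => y => [/M1|->//]; exact.
rewrite (@ge0_negligible_integral _ _ R mu S M)//.
- apply: le_trans bigF_le; apply: ge0_subset_integral => //.
  + by apply: measurableD => //; exact: measurableD.
  + by apply/measurable_EFinP; apply: measurable_funS mw => // t [n _] /FD.
  + by move=> t [n _ /FD Dt]; rewrite lee_fin w0.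
  + by move=> t [St nM]; apply: contrapT => nF; exact: nM.
- exact: measurableD.
- by apply/measurable_EFinP; apply: measurable_funS mw.
- by move=> t /SD Dt; rewrite lee_fin w0.
Unshelve. all: by end_near. Qed.

End initial_segments.

(** * The functions V, U, Phi and G *)

Section essential_supremum_of_inverse.
Context (R : realType) (v : R -> R).
Local Notation mu := (@lebesgue_measure R).
Hypotheses (mv : measurable_fun (`]0%R, +oo[ : set R) v)
  (v0 : forall t : R, (0 < t)%R -> (0 <= v t)%R).
Let V (t : R) := ess_sup_inv v `]t, +oo[.

(** The restricted measure does not see the complement of (t, oo), so exceptional sets are
    transferred by intersecting with the half-line in one direction and by adjoining the complement
    in the other. *)
Lemma ess_sup_invP (t : R) y :
  V t <= y <-> {ae mu, forall s, (t < s)%R -> (v s)%:E^-1 <= y}.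
Proof.
split.
- move=> /ess_supP[A [mA muA0 nA]]; exists (A `&` `]t, +oo[); split => //.
  + by apply: measurableI => //; exact: measurable_itv.
  + move=> s /= ns; split; last first.
      by rewrite /= in_itv/= andbT ltNge; apply/negP => st; apply: ns; rewrite ltNge st.
    by apply: nA => /= sy; apply: ns.
- move=> [A [mA muA0 nA]]; apply/ess_supP; exists (A `|` ~` `]t, +oo[); split => //.
  + by apply: measurableU => //; apply: measurableC; exact: measurable_itv.
  + apply: subset_measure0 muA0 => //.
      by apply: measurableI; [apply: measurableU => //; apply: measurableC|];
        exact: measurable_itv.
    by move=> s [[]].
  + move=> s /= ns; have [ts|ts] := ltP t s.
      by left; apply: nA => /= /(_ ts).
    by right; rewrite /= in_itv/= andbT; apply/negP; rewrite -leNgt.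
Qed.

Lemma ess_sup_inv_nincr (s t : R) : (s <= t)%R -> V t <= V s.
Proof.
move=> st; apply/ess_sup_invP.
have /ess_sup_invP := lexx (V s).
apply: (@filterS _ _ (ae_filter_ringOfSetsType mu)) => x sx tx.
by apply: sx; exact: le_lt_trans tx.
Qed.

(** Since v takes finite values, 1/v is positive at every point (it is +oo where v vanishes), and a
    half-line is not negligible. *)
Lemma ess_sup_inv_gt0 (t : R) : (0 <= t)%R -> 0 < V t.
Proof.
move=> t0; rewrite ltNge; apply/negP => /ess_sup_invP[A [mA muA0 nA]].
have mI : measurable (`]t, +oo[ : set R) by exact: measurable_itv.
have : mu `]t, +oo[ = 0.
  apply/eqP; rewrite -measure_le0 -muA0; apply: le_measure; rewrite ?inE//.
  move=> s /=; rewrite in_itv/= andbT => ts; apply: nA => /= /(_ ts).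
  have s0 : (0 < s)%R by exact: le_lt_trans ts.
  rewrite inver; case: eqP => [|/eqP] vs; first by rewrite leye_eq.
  by rewrite lee_fin invr_le0 leNgt lt_neqAle eq_sym vs v0.
by rewrite lebesgue_measure_itv/= ltry.
Qed.

(** Supplies the support of a test function. The set where 1/v > rho beyond t has positive but
    possibly infinite measure, so it is cut by the bounded windows (t, t + n). *)
Lemma ess_sup_inv_witness (t rho : R) : (0 <= t)%R -> (0 < rho)%R -> rho%:E < V t ->
  exists A : set R, [/\ measurable A, A `<=` `]t, +oo[, 0 < mu A, mu A < +oo &
    forall s, A s -> (v s <= rho^-1)%R].
Proof.
move=> t0 rho0 rhoV; pose A0 : set R := `]t, +oo[ `&` [set s | (v s < rho^-1)%R].
have mA0 : measurable A0.
  have mI : measurable (`]t, +oo[ : set R) by exact: measurable_itv.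
  have mvt : measurable_fun (`]t, +oo[ : set R) v.
    apply: measurable_funS mv => //.
    by apply: subset_itvr; rewrite bnd_simp.
  rewrite (_ : A0 = `]t, +oo[ `&` v @^-1` `]-oo, rho^-1%R[).
    by apply: mvt => //; exact: measurable_itv.
  by apply/seteqP; split => s []; rewrite /= !in_itv.
pose A n : set R := A0 `&` `]t, (t + n%:R)%R[.
have mA n : measurable (A n) by apply: measurableI => //; exact: measurable_itv.
(* If all windows were null, 1/v <= rho would hold almost everywhere beyond t, against rho < V t. *)
have [n An] : exists n, mu (A n) != 0.
  apply: contrapT => /forallNP nA; move: rhoV; rewrite ltNge => /negP; apply.
  have A0E : A0 = \bigcup_n A n.
    apply/seteqP; split => [s A0s|s [n _] []//].
    have [n sn] : exists n, (s - t < n%:R)%R.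
      exists (Num.bound (s - t)%R); apply: archi_boundP.
      by case: A0s => /=; rewrite in_itv/= andbT subr_ge0 => /ltW.
    exists n => //; split => //; rewrite /= in_itv/= -ltrBlDl sn andbT.
    by case: A0s => /=; rewrite in_itv/= andbT.
  have [B [mB muB A0B]] : mu.-negligible A0.
    rewrite A0E; apply: negligible_bigcup => k; exists (A k); split => //.
    - exact: mA.
    - by apply/eqP; have := nA k; move/negP; rewrite negbK.
  apply/ess_sup_invP; exists B; split => // s /= /not_implyP[ts]; move/negP.
  rewrite -ltNge => rs; apply: A0B; split.
    by rewrite /= in_itv/= ts.
  rewrite /= ltNge; apply/negP => vs.
  have rv : (0 < rho^-1)%R by rewrite invr_gt0.
  move: rs; rewrite inver gt_eqF ?(lt_le_trans rv)// lte_fin ltNge => /negP; apply.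
  by rewrite -[leRHS]invrK lef_pV2 ?posrE// (lt_le_trans rv).
exists (A n); split => //.
- by move=> s [[]].
- by rewrite lt0e An measure_ge0.
- apply: (@le_lt_trans _ _ (mu `]t, (t + n%:R)%R[)).
    apply: le_measure; rewrite ?inE; [exact: mA|exact: measurable_itv|].
    by move=> s [].
  by rewrite lebesgue_measure_itv/=; case: ifP => _; rewrite ?ltry// -EFinD ltry.
- by move=> s [[_ /ltW]].
Qed.

End essential_supremum_of_inverse.

(** Real-valued copy of U, for arithmetic outside the extended reals. It loses nothing on [0, oo),
    where U t < U (t + 1) forces finiteness; the lock keeps simplification from unfolding the
    integral. *)
HB.lock Definition fine_primitive (R : realType) (u : R -> R) (t : R) : R :=
  fine (primitive_wt u t).

Section primitive_of_weight.
Context (R : realType) (u : R -> R).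
Local Notation mu := (@lebesgue_measure R).
Hypotheses (hu : weight u) (hU : admissible_wt (primitive_wt u)).

Let mu_ : measurable_fun (`]0%R, +oo[ : set R) u.
Proof. by case: hu => -[]. Qed.

Local Notation U := (fine_primitive u).

Lemma fine_primitiveE (t : R) : (0 <= t)%R -> primitive_wt u t = (U t)%:E.
Proof.
move=> t0; rewrite fine_primitive.unlock fineK// ge0_fin_numE.
- case: hU => _ mono _ _; apply: (@lt_le_trans _ _ (primitive_wt u (t + 1))).
    by apply: mono; rewrite ?in_itv/= ?andbT// ?ltrDl ?addr_ge0.
  by rewrite leey.
- apply: integral_ge0 => s /=; rewrite in_itv/= => /andP[s0 _].
  by rewrite lee_fin; case: hu => _; exact.
Qed.

Lemma fine_primitive_le0 (t : R) : (t <= 0)%R -> U t = 0%R.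
Proof.
move=> t0; rewrite fine_primitive.unlock /primitive_wt set_itv_ge ?integral_set0//.
by rewrite bnd_simp -leNgt.
Qed.

Lemma fine_primitive_lt (s t : R) : (0 <= s)%R -> (s < t)%R -> (U s < U t)%R.
Proof.
move=> s0 st; have t0 : (0 <= t)%R by rewrite (le_trans s0)// ltW.
rewrite -lte_fin -!fine_primitiveE//; case: hU => _ mono _ _; apply: mono => //;
  by rewrite in_itv/= andbT.
Qed.

Lemma fine_primitive_gt0 (t : R) : (0 < t)%R -> (0 < U t)%R.
Proof.
by move=> t0; rewrite -(@fine_primitive_le0 0%R)// fine_primitive_lt.
Qed.

Lemma fine_primitive_ge0 (t : R) : (0 <= U t)%R.
Proof.
have [t0|/fine_primitive_gt0/ltW//] := leP t 0%R.
by rewrite fine_primitive_le0.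
Qed.

Lemma fine_primitive_le (s t : R) : (s <= t)%R -> (U s <= U t)%R.
Proof.
have [s0 _|s0] := leP s 0%R.
  by rewrite (fine_primitive_le0 s0) fine_primitive_ge0.
rewrite le_eqVlt => /predU1P[->//|st].
by rewrite ltW// fine_primitive_lt// ltW.
Qed.

Lemma measurable_fine_primitive (D : set R) : measurable D -> measurable_fun D U.
Proof.
by move=> mD; apply: nondecreasing_measurable => // s t; exact: fine_primitive_le.
Qed.

(** Continuity of U lets a strict lower bound survive slightly to the left of t, which makes room
    for a rational point there. *)
Lemma fine_primitive_left (t a : R) : (0 < t)%R -> (a < U t)%R ->
  exists2 s, (0 < s < t)%R & (a < U s)%R.
Proof.
move=> t0 aU; case: hU => /subspace_continuousP cU _ _ _.
have /cU : `[0%R, +oo[%classic t by rewrite /= in_itv/= andbT ltW.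
move=> /(_ [set y | a%:E < y]) /=.
have nb : nbhs (primitive_wt u t) [set y | a%:E < y].
  by apply: open_nbhs_nbhs; split; [exact: open_ereal_gt_ereal|
    rewrite /= fine_primitiveE ?lte_fin// ltW].
move=> /(_ nb) -[e/= e0 te].
(* The maximum keeps s positive while staying within e of t and strictly below it. *)
pose s := Num.max (t / 2)%R (t - e / 2)%R.
have s0 : (0 < s)%R by rewrite lt_max divr_gt0.
have st : (s < t)%R by rewrite gt_max ltr_pdivrMr// ltrBlDr; lra.
exists s; rewrite ?s0//.
have : a%:E < primitive_wt u s.
  apply: te; rewrite /= ?in_itv/= ?andbT ?(ltW s0)//.
  rewrite /ball_ ger0_norm ?subr_ge0 ?(ltW st)// ltrBlDr -ltrBlDl lt_max.
  by apply/orP; right; lra.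
by rewrite fine_primitiveE ?(ltW s0)// lte_fin.
Qed.

(** Origin of the kernel: a unit mass at z has tail 1 on (0, z), and averaging that tail against u
    over (0, t) gives min(U z, U t) / U t, which is [cap]. *)
Lemma integral_weight_min (t z : R) : (0 < t)%R -> (0 < z)%R ->
  \int[mu]_(s in `]0%R, t[) ((s < z)%R%:R * u s)%:E = (Num.min (U z) (U t))%:E.
Proof.
move=> t0 z0.
have -> : Num.min (U z) (U t) = U (Num.min z t).
  by rewrite /Num.min; case: (ltP z t) => [/(fine_primitive_lt (ltW z0))->//|tz];
    case: ltP => // /lt_geF; rewrite fine_primitive_le.
have m0 : (0 < Num.min z t)%R by rewrite lt_min z0.
rewrite -fine_primitiveE ?(ltW m0)// /primitive_wt integral_boolM.
congr (integral _ _ _); apply/seteqP; split => s /=; rewrite !in_itv/= lt_min.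
- by move=> [/andP[-> ->] ->].
- by move=> /and3P[-> -> ->].
Qed.

End primitive_of_weight.

(** Compares the kernel of Phi with the kernel 1 / (U(s)^r + U(t)^r) of the non-degeneracy
    condition, whose integral is known to be finite. *)
Lemma min1_quot_powR_le (R : realType) (a b r : R) : (0 < r)%R ->
  (0 < a)%R -> (0 < b)%R ->
  (Num.min 1 (a / b) `^ r <= 2 * a `^ r / (b `^ r + a `^ r))%R.
Proof.
move=> r0 a0 b0.
have ar : (0 < a `^ r)%R by exact: powR_gt0.
have br : (0 < b `^ r)%R by exact: powR_gt0.
rewrite ler_pdivlMr ?addr_gt0// /Num.min ltr_pdivlMr// mul1r.
case: ltP => [ba|ab].
  have : (b `^ r <= a `^ r)%R by rewrite ge0_ler_powR ?nnegrE// ltW.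
  by rewrite powR1 mul1r; lra.
have ab' : (a `^ r <= b `^ r)%R by rewrite ge0_ler_powR ?nnegrE// ltW.
have -> : ((a / b) `^ r = a `^ r / b `^ r)%R.
  rewrite powRM ?invr_ge0 ?(ltW a0) ?(ltW b0)//; congr (_ * _)%R.
  by rewrite -powR_inv1 ?(ltW b0)// -powRrM mulN1r powRN.
rewrite -mulrA [leRHS]mulrC ler_pM2l// ler_pdivrMl//; lra.
Qed.

Lemma min1_quot_bounds (R : realFieldType) (a b : R) : (0 < a)%R -> (0 < b)%R ->
  (a / (b + a) <= Num.min 1 (a / b) <= 2 * (a / (b + a)))%R.
Proof.
move=> a0 b0; have ab : (0 < b + a)%R by rewrite addr_gt0.
have ab1 : (a / (b + a) <= 1)%R by rewrite ler_pdivrMr// mul1r lerDr ltW.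
have aab : (a / (b + a) <= a / b)%R.
  by rewrite ler_pM2l// lef_pV2// lerDl ltW.
rewrite le_min ab1 aab/= ge_min mulrA.
have [ba|ab'] := leP b a.
  by rewrite ler_pdivlMr// mul1r; apply/orP; left; lra.
apply/orP; right; rewrite ler_pdivrMr// mulrAC ler_pdivlMr//; nra.
Qed.

(* The factor [min(1, U z / U t)] is comparable to the quotient [Uquot U z t];
   its [1/p]-th power is the image of a unit mass at [z] under the operator. *)
HB.lock Definition cap (R : realType) (u : R -> R) (z t : R) : R :=
  Num.min 1%R (fine_primitive u z / fine_primitive u t)%R.

Definition fundamental (R : realType) (u w : R -> R) (r x : R) : \bar R :=
  \int[@lebesgue_measure R]_(t in `]0%R, +oo[) (cap u x t `^ r * w t)%:E.

HB.lock Definition Phi (R : realType) (u w : R -> R) (r x : R) : R :=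
  fine (fundamental u w r x).

(** Splitting the integral of [Phi] at x gives this mass plus U(x)^r times [upper_mass]: the kernel
    is 1 before x and (U x / U t)^r after it. The two masses are the functions W of the two Hardy
    operators. *)
HB.lock Definition lower_mass (R : realType) (w : R -> R) (x : R) : R :=
  fine (\int[@lebesgue_measure R]_(t in `]0%R, +oo[) ((t < x)%R%:R * w t)%:E).

HB.lock Definition upper_mass (R : realType) (u w : R -> R) (r x : R) : R :=
  fine (\int[@lebesgue_measure R]_(t in `]0%R, +oo[)
    ((x <= t)%R%:R * (w t / fine_primitive u t `^ r))%:E).

Section fundamental_function.
Context (R : realType) (u w : R -> R) (r : R).
Local Notation mu := (@lebesgue_measure R).
Local Notation D := (`]0%R, +oo[%classic : set R).
Local Notation U := (fine_primitive u).
Hypotheses (hu : weight u) (hU : admissible_wt (primitive_wt u)) (hw : weight w).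
Hypotheses (r0 : (0 < r)%R) (hnd : nondegenerate_wrt (primitive_wt u) r w).

Lemma setDE (t : R) : D t -> (0 < t)%R. Proof. by rewrite /= in_itv/= andbT. Qed.
Lemma setDI (t : R) : (0 < t)%R -> D t. Proof. by rewrite /= in_itv/= andbT. Qed.
Lemma measurableD0 : measurable D. Proof. exact: measurable_itv. Qed.

Let mD := measurableD0.
Let mw : measurable_fun D w. Proof. by case: hw => -[]. Qed.
Let w0 (t : R) : (0 < t)%R -> (0 <= w t)%R. Proof. by case: hw => _; exact. Qed.
Let U0 (t : R) : (0 < t)%R -> (0 < U t)%R. Proof. exact: fine_primitive_gt0. Qed.
Let mU : measurable_fun D U. Proof. exact: measurable_fine_primitive. Qed.
Let mUV : measurable_fun D (fun t => (U t)^-1)%R.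
Proof. by apply: measurable_fun_invr_gt0 => // t /setDE; exact: U0. Qed.

Local Notation cap := (cap u).

Lemma cap_gt0 (z t : R) : (0 < z)%R -> (0 < t)%R -> (0 < cap z t)%R.
Proof. by move=> z0 t0; rewrite cap.unlock lt_min ltr01 divr_gt0// fine_primitive_gt0. Qed.

(** The quotients of U multiply exactly, and truncating the factors at 1 can only lower the
    product. *)
Lemma cap_triangle (z x t : R) : (0 < x)%R -> (0 < t)%R ->
  (cap z x * cap x t <= cap z t)%R.
Proof.
move=> x0 t0; have Ux := fine_primitive_gt0 hu hU x0.
have Ut := fine_primitive_gt0 hu hU t0; have Uz := fine_primitive_ge0 hu hU z.
rewrite cap.unlock.
have a0 : (0 <= Num.min 1 (U z / U x))%R by rewrite le_min ler01 divr_ge0// ltW.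
have b0 : (0 <= Num.min 1 (U x / U t))%R by rewrite le_min ler01 divr_ge0// ltW.
rewrite le_min; apply/andP; split.
  by rewrite mulr_ile1// ge_min lexx.
have -> : (U z / U t = (U z / U x) * (U x / U t))%R.
  by rewrite mulrA divfK// gt_eqF.
by rewrite ler_pM// ge_min lexx orbT.
Qed.

Lemma cap1 (z t : R) : (0 < t)%R -> (t <= z)%R -> cap z t = 1%R.
Proof.
move=> t0 tz; have Ut := fine_primitive_gt0 hu hU t0.
by rewrite cap.unlock; apply/min_idPl; rewrite ler_pdivlMr// mul1r fine_primitive_le.
Qed.

Lemma cap_quot (z t : R) : (0 < t)%R -> (z <= t)%R -> (cap z t = U z / U t)%R.
Proof.
move=> t0 tz; have Ut := fine_primitive_gt0 hu hU t0.
by rewrite cap.unlock; apply/min_idPr; rewrite ler_pdivrMr// mul1r fine_primitive_le.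
Qed.

Lemma measurable_cap : measurable_fun (D `*` D) (fun zt => cap zt.1 zt.2).
Proof.
rewrite cap.unlock; apply: measurable_minr => //; apply: measurable_funM.
  exact: (measurable_fst_rectangle mD mU).
exact: (measurable_snd_rectangle mD mUV).
Qed.

Lemma measurable_capr z : measurable_fun D (cap z).
Proof. by rewrite cap.unlock; apply: measurable_minr => //; exact: measurable_funM. Qed.

Local Notation fundamental := (fundamental u w r).
Local Notation Phi := (Phi u w r).

Let mcapw x : measurable_fun D (fun t => cap x t `^ r * w t)%R.
Proof.
apply: measurable_funM => //.
exact: (measurableT_comp (measurable_powR r) (measurable_capr x)).
Qed.

Let mnd (x : R) : (0 < x)%R ->
  measurable_fun D (fun t => (U t `^ r + U x `^ r)^-1)%R.
Proof.
move=> x0; apply: measurable_fun_invr_gt0.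
  apply: measurable_funD; last exact: measurable_cst.
  exact: (measurableT_comp (measurable_powR r) mU).
move=> t /setDE t0; apply: addr_gt0; apply: powR_gt0; first exact: U0.
exact: fine_primitive_gt0.
Qed.

Lemma fundamental_lty (x : R) : (0 < x)%R -> fundamental x < +oo.
Proof.
move=> x0; have Ux := fine_primitive_gt0 hu hU x0.
have Uxr : (0 < U x `^ r)%R by rewrite powR_gt0.
case: hnd => /(_ x x0) nd _ _.
apply: (@le_lt_trans _ _ (\int[mu]_(s in D)
    ((2 * U x `^ r)%:E * (w s / (U s `^ r + U x `^ r))%:E))).
  apply: ge0_le_integral => //.
  - by move=> t /setDE t0; rewrite lee_fin; apply: mulr_ge0; [exact: powR_ge0|exact: w0].
  - by apply/measurable_EFinP; exact: mcapw.
  - apply/measurable_EFinP; apply: measurable_funM => //.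
    apply: measurable_funM => //; exact: mnd.
  - move=> t /setDE t0; rewrite -EFinM lee_fin [leLHS]mulrC [leRHS]mulrCA.
    apply: ler_wpM2l; first exact: w0.
    by rewrite cap.unlock; apply: min1_quot_powR_le => //; exact: U0.
rewrite ge0_integralZl_EFin//.
- apply: lte_mul_pinfty; rewrite ?lee_fin ?mulr_ge0 ?powR_ge0//.
  rewrite (_ : \int[mu]_(s in D) _ = \int[mu]_(s in D)
    ((w s)%:E / (primitive_wt u s `^ r + primitive_wt u x `^ r)))//.
  apply: eq_integral => t /[1!inE] /setDE t0; have Ut := U0 t0.
  rewrite !fine_primitiveE ?(ltW x0) ?(ltW t0)// !poweR_EFin -EFinD inver.
  by rewrite (gt_eqF (addr_gt0 (powR_gt0 r Ut) Uxr)).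
- by move=> t /setDE t0; rewrite lee_fin; apply: divr_ge0; [exact: w0|
    exact: addr_ge0 (powR_ge0 _ _) (powR_ge0 _ _)].
- apply/measurable_EFinP; apply: measurable_funM => //; exact: mnd.
- by apply: mulr_ge0 => //; exact: powR_ge0.
Qed.

Lemma fundamental_ge0 x : 0 <= fundamental x.
Proof.
apply: integral_ge0 => t /setDE t0; rewrite lee_fin.
by apply: mulr_ge0; [exact: powR_ge0|exact: w0].
Qed.

Lemma PhiE (x : R) : (0 < x)%R -> fundamental x = (Phi x)%:E.
Proof.
by move=> x0; rewrite Phi.unlock fineK// ge0_fin_numE ?fundamental_lty// fundamental_ge0.
Qed.

Let capw_le (z x t : R) : (0 < z)%R -> (0 < x)%R -> (0 < t)%R ->
  (cap z x `^ r * (cap x t `^ r * w t) <= cap z t `^ r * w t)%R.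
Proof.
move=> z0 x0 t0; have c1 := ltW (cap_gt0 z0 x0); have c2 := ltW (cap_gt0 x0 t0).
rewrite mulrA; apply: ler_wpM2r; first exact: w0.
rewrite -powRM//; apply: ge0_ler_powR; rewrite ?nnegrE ?(ltW r0)//.
- exact: mulr_ge0.
- exact: ltW (cap_gt0 z0 t0).
- exact: cap_triangle.
Qed.

(** Integrated form of [cap_triangle]. It expresses quasiconcavity: for x <= z that Phi is
    nondecreasing, for z <= x that Phi / U^r is nonincreasing. *)
Lemma Phi_cap (z x : R) : (0 < z)%R -> (0 < x)%R -> (cap z x `^ r * Phi x <= Phi z)%R.
Proof.
move=> z0 x0.
suff : (cap z x `^ r)%:E * fundamental x <= fundamental z.
  by rewrite (PhiE x0) (PhiE z0) -EFinM lee_fin.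
rewrite /fundamental -ge0_integralZl_EFin//; last 3 first.
- by move=> t /setDE t0; rewrite lee_fin; apply: mulr_ge0; [exact: powR_ge0|exact: w0].
- by apply/measurable_EFinP; exact: mcapw.
- exact: powR_ge0.
apply: ge0_le_integral => //.
- move=> t /setDE t0; apply: mule_ge0; rewrite lee_fin; first exact: powR_ge0.
  by apply: mulr_ge0; [exact: powR_ge0|exact: w0].
- by apply: measurable_funeM; apply/measurable_EFinP; exact: mcapw.
- by apply/measurable_EFinP; exact: mcapw.
- by move=> t /setDE t0; rewrite -EFinM lee_fin; exact: capw_le.
Qed.

Lemma measurable_Phi : measurable_fun D Phi.
Proof.
rewrite Phi.unlock.
have mf : measurable_fun D fundamental.
  apply: (@measurable_integral2 _ _ _ _ _ mu D D
      (fun xt => (cap xt.1 xt.2 `^ r * w xt.2)%:E)) => //.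
  - apply/measurable_EFinP; apply: measurable_funM.
      exact: (measurableT_comp (measurable_powR r) measurable_cap).
    exact: (measurable_snd_rectangle mD mw).
  - move=> x t /setDE x0 /setDE t0; rewrite lee_fin.
    by apply: mulr_ge0; [exact: powR_ge0|exact: w0].
exact: (measurable_comp measurableT (@subsetT _ _) (fine_measurable measurableT) mf).
Qed.

Lemma UquotE (x t : R) : (0 < x)%R -> (0 < t)%R ->
  Uquot (primitive_wt u) x t = (U x / (U t + U x))%:E.
Proof.
move=> x0 t0; rewrite /Uquot !fine_primitiveE ?(ltW x0) ?(ltW t0)// -EFinD inver.
by rewrite gt_eqF// addr_gt0// fine_primitive_gt0.
Qed.

Local Notation avg x := (\int[mu]_(t in D)
  (Uquot (primitive_wt u) x t `^ r * (w t)%:E)).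

Let avgE (x : R) : (0 < x)%R ->
  avg x = \int[mu]_(t in D) ((U x / (U t + U x)) `^ r * w t)%:E.
Proof.
move=> x0; apply: eq_integral => t /[1!inE] /setDE t0.
by rewrite UquotE// poweR_EFin -EFinM.
Qed.

Let mquot (x : R) : (0 < x)%R ->
  measurable_fun D (fun t => (U x / (U t + U x)) `^ r * w t)%R.
Proof.
move=> x0; apply: measurable_funM => //.
apply: (measurableT_comp (measurable_powR r)); apply: measurable_funM => //.
apply: measurable_fun_invr_gt0; first exact: measurable_funD.
by move=> t /setDE t0; rewrite addr_gt0// fine_primitive_gt0.
Qed.

Lemma avg_le_Phi (x : R) : (0 < x)%R -> avg x <= (Phi x)%:E.
Proof.
move=> x0; rewrite avgE// -PhiE// /fundamental; apply: ge0_le_integral => //.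
- move=> t /setDE t0; rewrite lee_fin.
  by apply: mulr_ge0; [exact: powR_ge0|exact: w0].
- by apply/measurable_EFinP; exact: mquot.
- by apply/measurable_EFinP; exact: mcapw.
- move=> t /setDE t0; rewrite lee_fin; apply: ler_wpM2r; first exact: w0.
  have Ux := U0 x0; have Ut := U0 t0.
  apply: ge0_ler_powR; rewrite ?nnegrE ?(ltW r0)//.
  + by rewrite divr_ge0 ?addr_ge0 ?(ltW Ux) ?(ltW Ut).
  + by rewrite ltW// cap_gt0.
  + by rewrite cap.unlock; case/andP: (min1_quot_bounds Ux Ut).
Qed.

Lemma Phi_le_avg (x : R) : (0 < x)%R -> (Phi x)%:E <= (2 `^ r)%:E * avg x.
Proof.
move=> x0; rewrite avgE// -PhiE// /fundamental -ge0_integralZl_EFin//; last 2 first.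
- move=> t /setDE t0; rewrite lee_fin.
  by apply: mulr_ge0; [exact: powR_ge0|exact: w0].
- by apply/measurable_EFinP; exact: mquot.
apply: ge0_le_integral => //.
- move=> t /setDE t0; rewrite lee_fin.
  by apply: mulr_ge0; [exact: powR_ge0|exact: w0].
- by apply/measurable_EFinP; exact: mcapw.
- by apply: measurable_funeM; apply/measurable_EFinP; exact: mquot.
- move=> t /setDE t0; rewrite -EFinM lee_fin mulrA.
  apply: ler_wpM2r; first exact: w0.
  have Ux := U0 x0; have Ut := U0 t0.
  have q0 : (0 <= U x / (U t + U x))%R.
    by rewrite divr_ge0 ?addr_ge0 ?(ltW Ux) ?(ltW Ut).
  rewrite -powRM//; apply: ge0_ler_powR; rewrite ?nnegrE ?(ltW r0)//.
  + by rewrite ltW// cap_gt0.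
  + by rewrite mulr_ge0.
  + by rewrite cap.unlock; case/andP: (min1_quot_bounds Ux Ut).
Qed.

Local Notation Wl := (lower_mass w).
Local Notation Om := (upper_mass u w r).

Let wd t := (w t / U t `^ r)%R.
Let mwd : measurable_fun D wd.
Proof.
apply: measurable_funM => //; apply: measurable_fun_invr_gt0.
  exact: (measurableT_comp (measurable_powR r) mU).
by move=> t /setDE t0; rewrite powR_gt0// U0.
Qed.
Let wd0 (t : R) : (0 < t)%R -> (0 <= wd t)%R.
Proof. by move=> t0; apply: divr_ge0; [exact: w0|exact: powR_ge0]. Qed.

Let mltw (x : R) : measurable_fun D (fun t : R => (t < x)%R%:R * w t)%R.
Proof.
apply: measurable_funM => //; apply: measurable_boolR.
by apply: measurable_fun_ltr => //; exact: measurable_cst.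
Qed.
Let mlewd (x : R) : measurable_fun D (fun t : R => (x <= t)%R%:R * wd t)%R.
Proof.
apply: measurable_funM => //; apply: measurable_boolR.
by apply: measurable_fun_ler => //; exact: measurable_cst.
Qed.

Lemma lower_mass_le (x : R) : (0 < x)%R ->
  \int[mu]_(t in D) ((t < x)%R%:R * w t)%:E <= (Phi x)%:E.
Proof.
move=> x0; rewrite -PhiE// /fundamental; apply: ge0_le_integral => //.
- by move=> t /setDE t0; rewrite lee_fin; apply: mulr_ge0 => //; exact: w0.
- by apply/measurable_EFinP; exact: mltw.
- by apply/measurable_EFinP; exact: mcapw.
- move=> t /setDE t0; rewrite lee_fin; apply: ler_wpM2r; first exact: w0.
  by have [tx|_] := ltP t x; rewrite ?powR_ge0// cap1 ?powR1// ltW.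
Qed.

Lemma upper_mass_le (x : R) : (0 < x)%R ->
  (U x `^ r)%:E * \int[mu]_(t in D) ((x <= t)%R%:R * (w t / U t `^ r))%:E
  <= (Phi x)%:E.
Proof.
move=> x0; rewrite -PhiE// /fundamental -ge0_integralZl_EFin ?powR_ge0//; last 2 first.
- by move=> t /setDE t0; rewrite lee_fin; apply: mulr_ge0 => //; exact: wd0.
- by apply/measurable_EFinP; exact: mlewd.
apply: ge0_le_integral => //.
- move=> t /setDE t0; apply: mule_ge0; rewrite lee_fin ?powR_ge0//.
  by apply: mulr_ge0 => //; exact: wd0.
- by apply: measurable_funeM; apply/measurable_EFinP; exact: mlewd.
- by apply/measurable_EFinP; exact: mcapw.
- move=> t /setDE t0; rewrite -EFinM lee_fin.
  have Ux := U0 x0; have Ut := U0 t0.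
  have [xt|_] := leP x t; last first.
    by rewrite mul0r mulr0; apply: mulr_ge0; [exact: powR_ge0|exact: w0].
  rewrite mul1r cap_quot// powRM ?invr_ge0 ?(ltW Ux) ?(ltW Ut)//.
  rewrite -[((U t)^-1)%R]powR_inv1 ?(ltW Ut)// -powRrM mulN1r powRN.
  by rewrite [(w t / _)%R]mulrC mulrA.
Qed.

Lemma lower_massE (x : R) : (0 < x)%R ->
  \int[mu]_(t in D) ((t < x)%R%:R * w t)%:E = (Wl x)%:E.
Proof.
move=> x0; rewrite lower_mass.unlock fineK// ge0_fin_numE.
  by apply: le_lt_trans (lower_mass_le x0) _; rewrite ltry.
apply: integral_ge0 => t /setDE t0; rewrite lee_fin.
by apply: mulr_ge0 => //; exact: w0.
Qed.

Lemma upper_massE (x : R) : (0 < x)%R ->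
  \int[mu]_(t in D) ((x <= t)%R%:R * (w t / U t `^ r))%:E = (Om x)%:E.
Proof.
move=> x0; rewrite upper_mass.unlock fineK// ge0_fin_numE.
  have Uxr : (0 < U x `^ r)%R by rewrite powR_gt0// U0.
  have := le_lt_trans (upper_mass_le x0) (ltry _).
  apply: contraTT; rewrite -!leNgt !leye_eq => /eqP ->.
  by rewrite gt0_muley// lte_fin.
apply: integral_ge0 => t /setDE t0; rewrite lee_fin.
by apply: mulr_ge0 => //; exact: wd0.
Qed.

Lemma lower_mass_le_Phi (x : R) : (0 < x)%R -> (Wl x <= Phi x)%R.
Proof. by move=> x0; rewrite -lee_fin -lower_massE//; exact: lower_mass_le. Qed.

Lemma upper_mass_le_Phi (x : R) : (0 < x)%R -> (U x `^ r * Om x <= Phi x)%R.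
Proof.
by move=> x0; rewrite -lee_fin EFinM -upper_massE//; exact: upper_mass_le.
Qed.

Let lower_ge0 (x : R) : (0 < x)%R -> (0 <= Wl x)%R.
Proof.
move=> x0; rewrite -lee_fin -lower_massE//; apply: integral_ge0 => t /setDE t0.
by rewrite lee_fin; apply: mulr_ge0 => //; exact: w0.
Qed.

Let upper_ge0 (x : R) : (0 < x)%R -> (0 <= Om x)%R.
Proof.
move=> x0; rewrite -lee_fin -upper_massE//; apply: integral_ge0 => t /setDE t0.
by rewrite lee_fin; apply: mulr_ge0 => //; exact: wd0.
Qed.

Lemma lower_mass_ndecr (x y : R) : (0 < x)%R -> (x <= y)%R -> (Wl x <= Wl y)%R.
Proof.
move=> x0 xy; rewrite -lee_fin -!lower_massE//; last exact: lt_le_trans xy.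
apply: ge0_le_integral => //.
- by move=> t /setDE t0; rewrite lee_fin; apply: mulr_ge0 => //; exact: w0.
- by apply/measurable_EFinP; exact: mltw.
- by apply/measurable_EFinP; exact: mltw.
- move=> t /setDE t0; rewrite lee_fin; apply: ler_wpM2r; first exact: w0.
  by have [tx|//] := ltP t x; rewrite (lt_le_trans tx).
Qed.

Lemma upper_mass_nincr (x y : R) : (0 < x)%R -> (x <= y)%R -> (Om y <= Om x)%R.
Proof.
move=> x0 xy; rewrite -lee_fin -!upper_massE//; last exact: lt_le_trans xy.
apply: ge0_le_integral => //.
- by move=> t /setDE t0; rewrite lee_fin; apply: mulr_ge0 => //; exact: wd0.
- by apply/measurable_EFinP; exact: mlewd.
- by apply/measurable_EFinP; exact: mlewd.
- move=> t /setDE t0; rewrite lee_fin; apply: ler_wpM2r; first exact: wd0.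
  by have [yt|//] := leP y t; rewrite (le_trans xy).
Qed.

Lemma measurable_lower_mass : measurable_fun D Wl.
Proof.
rewrite lower_mass.unlock.
have mf : measurable_fun D
    (fun x => \int[mu]_(t in D) ((t < x)%R%:R * w t)%:E).
  apply: (@measurable_integral2 _ _ _ _ _ mu D D
      (fun xt : R * R => ((xt.2 < xt.1)%R%:R * w xt.2)%:E)) => //.
  - apply/measurable_EFinP; apply: measurable_funM.
      apply: measurable_boolR; apply: measurable_fun_ltr.
        exact: measurable_funTS.
      exact: measurable_funTS.
    exact: (measurable_snd_rectangle mD mw).
  - move=> x t /setDE x0 /setDE t0; rewrite lee_fin.
    by apply: mulr_ge0 => //; exact: w0.
exact: (measurable_comp measurableT (@subsetT _ _) (fine_measurable measurableT) mf).
Qed.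

Lemma measurable_upper_mass : measurable_fun D Om.
Proof.
rewrite upper_mass.unlock.
have mf : measurable_fun D
    (fun x => \int[mu]_(t in D) ((x <= t)%R%:R * (w t / U t `^ r))%:E).
  apply: (@measurable_integral2 _ _ _ _ _ mu D D
      (fun xt : R * R => ((xt.1 <= xt.2)%R%:R * wd xt.2)%:E)) => //.
  - apply/measurable_EFinP; apply: measurable_funM.
      apply: measurable_boolR; apply: measurable_fun_ler.
        exact: measurable_funTS.
      exact: measurable_funTS.
    exact: (measurable_snd_rectangle mD mwd).
  - move=> x t /setDE x0 /setDE t0; rewrite lee_fin.
    by apply: mulr_ge0 => //; exact: wd0.
exact: (measurable_comp measurableT (@subsetT _ _) (fine_measurable measurableT) mf).
Qed.

Let rat_dense (x y : R) : (x < y)%R -> exists a : rat, (x < ratr a)%R && (ratr a < y)%R.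
Proof. by move=> /rat_in_itvoo[a]; rewrite in_itv/=; exists a. Qed.

(** Every point x of the level set has mass [Wl x], at most l, before it, so the exhaustion by
    initial segments applies. This takes the place of a change of variables by [Wl]. *)
Lemma lower_mass_level (l : R) : (0 < l)%R ->
  \int[mu]_(t in D) ((Wl t <= l)%R%:R * w t)%:E <= l%:E.
Proof.
move=> l0; rewrite integral_boolM.
apply: (@integral_initial_segments R (fun s t => s < t)%R D w) => //.
- by move=> y x z; exact: lt_trans.
- by move=> x y; rewrite neq_lt.
- move=> x; rewrite (_ : [set _ | _] = `]-oo, x[%classic); first exact: measurable_itv.
  by apply/seteqP; split => t /=; rewrite in_itv.
- by move=> t /setDE; exact: w0.
- rewrite (_ : _ `&` _ = D `&` Wl @^-1` `]-oo, l]%classic).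
    by apply: measurable_lower_mass => //; exact: measurable_itv.
  by apply/seteqP; split => t [Dt]; rewrite /= in_itv.
- by rewrite lee_fin ltW.
- move=> x [/setDE x0 /= Wx]; rewrite -integral_boolM lower_massE//.
Qed.

(** The same argument for the reversed order, whose initial segments are the open half-lines (x,
    oo). Since [Om x] is defined with the closed half-line, one more comparison is needed. *)
Lemma upper_mass_level (l : R) : (0 < l)%R ->
  \int[mu]_(t in D) ((Om t <= l)%R%:R * (w t / U t `^ r))%:E <= l%:E.
Proof.
move=> l0; rewrite integral_boolM.
apply: (@integral_initial_segments R (fun s t => t < s)%R D wd) => //.
- by move=> y x z yx zy; exact: lt_trans yx.
- by move=> x y; rewrite neq_lt orbC.
- by move=> x y /rat_dense[a /andP[? ?]]; exists a; apply/andP.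
- move=> x; rewrite (_ : [set _ | _] = `]x, +oo[%classic); first exact: measurable_itv.
  by apply/seteqP; split => t /=; rewrite in_itv/= andbT.
- by move=> t /setDE; exact: wd0.
- rewrite (_ : _ `&` _ = D `&` Om @^-1` `]-oo, l]%classic).
    by apply: measurable_upper_mass => //; exact: measurable_itv.
  by apply/seteqP; split => t [Dt]; rewrite /= in_itv.
- by rewrite lee_fin ltW.
- move=> x [/setDE x0 /= Wx]; rewrite -integral_boolM.
  apply: (@le_trans _ _ (Om x)%:E) => //; rewrite -upper_massE//.
  apply: ge0_le_integral => //.
  + by move=> t /setDE t0; rewrite lee_fin; apply: mulr_ge0 => //; exact: wd0.
  + apply/measurable_EFinP; apply: measurable_funM => //; apply: measurable_boolR.
    by apply: measurable_fun_ltr => //; exact: measurable_cst.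
  + by apply/measurable_EFinP; exact: mlewd.
  + move=> t /setDE t0; rewrite lee_fin; apply: ler_wpM2r; first exact: wd0.
    by have [/ltW ->|//] := ltP x t; rewrite lexx.
Qed.

(** Otherwise w vanishes almost everywhere on (0, x), and the integral of w / U^r over (0, 1) is at
    most the finite [Om x], against non-degeneracy at 0. *)
Lemma lower_mass_gt0 (x : R) : (0 < x)%R -> (0 < Wl x)%R.
Proof.
move=> x0; rewrite lt_neqAle lower_ge0// andbT eq_sym; apply/eqP => W0.
have m1 : measurable_fun D (fun t => ((t < x)%R%:R * w t)%:E).
  by apply/measurable_EFinP; exact: mltw.
have ae0 : ae_eq mu D (fun t => ((t < x)%R%:R * w t)%:E) (cst 0).
  apply: ge0_integral_eq0 => //; last by rewrite lower_massE// W0.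
  by move=> t /setDE t0; rewrite lee_fin; apply: mulr_ge0 => //; exact: w0.
case: hnd => _ nd _.
suff : \int[mu]_(s in `]0%R, 1%R[) ((w s)%:E / primitive_wt u s `^ r) <= (Om x)%:E.
  by rewrite nd leye_eq.
have -> : \int[mu]_(s in `]0%R, 1%R[) ((w s)%:E / primitive_wt u s `^ r) =
    \int[mu]_(s in `]0%R, 1%R[) (wd s)%:E.
  apply: eq_integral => t /[1!inE]/=; rewrite in_itv/= => /andP[t0 _].
  rewrite fine_primitiveE ?(ltW t0)// poweR_EFin inver gt_eqF ?powR_gt0 ?U0//.
apply: (@le_trans _ _ (\int[mu]_(s in D) (wd s)%:E)).
  apply: ge0_subset_integral => //.
  - exact/measurable_EFinP.
  - by move=> t /setDE t0; rewrite lee_fin wd0.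
  - by apply: subset_itvl; rewrite bnd_simp.
rewrite -upper_massE//; apply: ae_ge0_le_integral => //.
- by move=> t /setDE t0; rewrite lee_fin wd0.
- exact/measurable_EFinP.
- by move=> t /setDE t0; rewrite lee_fin; apply: mulr_ge0 => //; exact: wd0.
- by apply/measurable_EFinP; exact: mlewd.
- apply: (@filterS _ _ (ae_filter_ringOfSetsType mu) _ _ _ ae0) => t Ht /[dup] Dt /Ht[].
  have [xt _|tx] := leP x t; first by rewrite mul1r.
  by rewrite !mul1r /wd => ->; rewrite !mul0r.
Qed.

(** Otherwise w vanishes almost everywhere beyond x, and the integral of w over (1, oo) is at most
    the finite [Wl x], against non-degeneracy at infinity. *)
Lemma upper_mass_gt0 (x : R) : (0 < x)%R -> (0 < Om x)%R.
Proof.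
move=> x0; rewrite lt_neqAle upper_ge0// andbT eq_sym; apply/eqP => W0.
have m1 : measurable_fun D (fun t => ((x <= t)%R%:R * wd t)%:E).
  by apply/measurable_EFinP; exact: mlewd.
have ae0 : ae_eq mu D (fun t => ((x <= t)%R%:R * wd t)%:E) (cst 0).
  apply: ge0_integral_eq0 => //; last by rewrite upper_massE// W0.
  by move=> t /setDE t0; rewrite lee_fin; apply: mulr_ge0 => //; exact: wd0.
case: hnd => _ _ nd.
suff : \int[mu]_(s in `]1%R, +oo[) (w s)%:E <= (Wl x)%:E.
  by rewrite nd leye_eq.
apply: (@le_trans _ _ (\int[mu]_(s in D) (w s)%:E)).
  apply: ge0_subset_integral => //.
  - exact/measurable_EFinP.
  - by move=> t /setDE t0; rewrite lee_fin w0.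
  - by apply: subset_itvr; rewrite bnd_simp.
rewrite -lower_massE//; apply: ae_ge0_le_integral => //.
- by move=> t /setDE t0; rewrite lee_fin w0.
- exact/measurable_EFinP.
- by move=> t /setDE t0; rewrite lee_fin; apply: mulr_ge0 => //; exact: w0.
- by apply/measurable_EFinP; exact: mltw.
- apply: (@filterS _ _ (ae_filter_ringOfSetsType mu) _ _ _ ae0) => t Ht /[dup] Dt /Ht[].
  have t0 := setDE Dt; have Utr : (0 < U t `^ r)%R by rewrite powR_gt0// U0.
  have [xt|tx _] := leP x t; last by rewrite mul1r.
  rewrite mul1r mul0r /wd => /eqP; rewrite mulf_eq0 invr_eq0 (gt_eqF Utr) orbF.
  by move=> /eqP ->.
Qed.

End fundamental_function.

(** One inequality is monotonicity of the power, the other follows by applying the power 1/s to an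
    upper bound. It identifies the supremum inside I_4 with the s-th power of the one inside I_3. *)
Lemma ereal_sup_poweR (R : realType) (T : Type) (A : set T) (f : T -> \bar R)
    (s : R) : (0 < s)%R -> A !=set0 -> (forall t, A t -> 0 <= f t) ->
  ereal_sup [set f t `^ s | t in A] = ereal_sup [set f t | t in A] `^ s.
Proof.
move=> s0 [t0 At0] f0; apply/eqP; rewrite eq_le; apply/andP; split.
  apply: ge_ereal_sup => _ [t At <-].
  have le_sup : f t <= ereal_sup [set f t | t in A].
    by apply: ereal_sup_ubound; exists t.
  apply: (gt0_ler_poweR (ltW s0)) => //; rewrite in_itv/= leey andbT ?f0//.
  exact: le_trans (f0 _ At) le_sup.
set M := ereal_sup [set f t `^ s | t in A].
have M0 : 0 <= M.
  by apply: le_trans (poweR_ge0 (f t0) s) _; apply: ereal_sup_ubound; exists t0.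
have -> : M = (M `^ s^-1) `^ s by rewrite -poweRrM mulVf ?gt_eqF// poweRe1.
have sV : (0 <= s^-1)%R by rewrite invr_ge0 ltW.
have H t : A t -> f t <= M `^ s^-1.
  move=> At; have -> : f t = (f t `^ s) `^ s^-1.
    by rewrite -poweRrM mulfV ?gt_eqF// poweRe1// f0.
  apply: (gt0_ler_poweR sV); rewrite ?in_itv/= ?leey ?andbT ?poweR_ge0//.
  by apply: ereal_sup_ubound; exists t.
apply: (gt0_ler_poweR (ltW s0)); rewrite ?in_itv/= ?leey ?andbT ?poweR_ge0//.
  apply: le_trans (f0 _ At0) _.
  by apply: ereal_sup_ubound; exists t0.
by apply: ge_ereal_sup => _ [t At <-]; exact: H.
Qed.

HB.lock Definition weight_sup (R : realType) (u v : R -> R) (p x : R) : \bar R :=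
  ereal_sup [set primitive_wt u t `^ p^-1 * ess_sup_inv v `]t, +oo[
            | t in `]0%R, x[].

(* [U^(1/p)]-quasiconcave majorant of the nonincreasing envelope of [1/v] *)
HB.lock Definition profile (R : realType) (u v : R -> R) (p x : R) : R :=
  (fine (weight_sup u v p x) / fine_primitive u x `^ p^-1)%R.

Section profile.
Context (R : realType) (u v : R -> R) (p : R).
Local Notation mu := (@lebesgue_measure R).
Local Notation D := (`]0%R, +oo[%classic : set R).
Local Notation U := (fine_primitive u).
Local Notation S := (weight_sup u v p).
Local Notation G := (profile u v p).
Local Notation V t := (ess_sup_inv v `]t, +oo[).
Hypotheses (p0 : (0 < p)%R) (hu : weight u) (hU : admissible_wt (primitive_wt u))
  (hv : weight v).

Let mv : measurable_fun D v. Proof. by case: hv => -[]. Qed.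
Let v0 (t : R) : (0 < t)%R -> (0 <= v t)%R. Proof. by case: hv => _; exact. Qed.
Let U0 (t : R) : (0 < t)%R -> (0 < U t)%R. Proof. exact: fine_primitive_gt0. Qed.
Let Up0 (t : R) : (0 < t)%R -> (0 < U t `^ p^-1)%R.
Proof. by move=> t0; apply: powR_gt0; exact: U0. Qed.
Let V0 (t : R) : (0 < t)%R -> 0 < V t.
Proof. by move=> t0; apply: ess_sup_inv_gt0 => //; exact: ltW. Qed.

Lemma weight_supE (x : R) :
  S x = ereal_sup [set (U t `^ p^-1)%:E * V t | t in `]0%R, x[].
Proof.
rewrite weight_sup.unlock; congr ereal_sup.
apply/seteqP; split => _ [t tx <-]; exists t => //;
  by move: tx; rewrite /= in_itv/= => /andP[/ltW t0 _]; rewrite fine_primitiveE.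
Qed.

Lemma weight_sup_ge (t x : R) : (0 < t)%R -> (t < x)%R ->
  (U t `^ p^-1)%:E * V t <= S x.
Proof.
move=> t0 tx; rewrite weight_supE; apply: ereal_sup_ubound; exists t => //.
by rewrite /= in_itv/= t0.
Qed.

Lemma weight_sup_gt0 (x : R) : (0 < x)%R -> 0 < S x.
Proof.
move=> x0; have x2 : (0 < x / 2)%R by rewrite divr_gt0.
apply: lt_le_trans (weight_sup_ge x2 _); last by rewrite ltr_pdivrMr//; lra.
by apply: mule_gt0; [rewrite lte_fin; exact: Up0|exact: V0].
Qed.

Lemma weight_sup_powE (x s : R) : (0 < x)%R -> (0 < s)%R ->
  ereal_sup [set primitive_wt u t `^ (s / p) * ess_sup_inv v `]t, +oo[ `^ s
            | t in `]0%R, x[] = S x `^ s.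
Proof.
move=> x0 s0; rewrite weight_sup.unlock -ereal_sup_poweR//.
- congr ereal_sup; apply/seteqP; split => _ [t tx <-]; exists t => //;
    move: tx; rewrite /= in_itv/= => /andP[t0 _];
    by rewrite poweRM ?poweR_ge0 ?(ltW (V0 _))// -poweRrM [(p^-1 * s)%R]mulrC.
- exists (x / 2)%R; rewrite /= in_itv/= divr_gt0// ltr_pdivrMr//; lra.
- move=> t; rewrite /= in_itv/= => /andP[t0 _].
  by apply: mule_ge0; [exact: poweR_ge0|exact: ltW (V0 t0)].
Qed.

(** Finiteness at x0 makes V(x0 / 2) finite. For t < x0 the terms are bounded by S x0, and for t >=
    x0 by U(x)^(1/p) V(x0 / 2), as V is nonincreasing. *)
Lemma weight_sup_lty (x0 : R) : (0 < x0)%R -> S x0 < +oo ->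
  forall x, (0 < x)%R -> S x < +oo.
Proof.
move=> x00 Sx0 x x_gt0; have x2 : (0 < x0 / 2)%R by rewrite divr_gt0.
have x2x : (x0 / 2 < x0)%R by rewrite ltr_pdivrMr//; lra.
have Vx2 : V (x0 / 2)%R < +oo.
  have := le_lt_trans (weight_sup_ge x2 x2x) Sx0.
  apply: contraTT; rewrite -!leNgt !leye_eq => /eqP ->.
  by rewrite gt0_muley// lte_fin Up0.
apply: (@le_lt_trans _ _ (Order.max (S x0) ((U x `^ p^-1)%:E * V (x0 / 2)%R))).
  rewrite [leLHS]weight_supE; apply: ge_ereal_sup => _ [t tx <-].
  move: tx; rewrite /= in_itv/= => /andP[t0 tx]; rewrite le_max.
  have [tx0|x0t] := ltP t x0; first by rewrite (weight_sup_ge t0 tx0).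
  apply/orP; right; apply: lee_pmul.
  - by rewrite lee_fin; exact: powR_ge0.
  - exact: ltW (V0 t0).
  - rewrite lee_fin; apply: ge0_ler_powR.
    + by rewrite invr_ge0 ltW.
    + by rewrite nnegrE ltW// U0.
    + by rewrite nnegrE ltW// U0.
    + by apply: fine_primitive_le => //; exact: ltW.
  - by apply: ess_sup_inv_nincr; rewrite (le_trans _ x0t)// ltW.
rewrite gt_max Sx0 lte_mul_pinfty// ?lee_fin; exact: powR_ge0.
Qed.

Hypothesis S_fin : forall x : R, (0 < x)%R -> S x < +oo.

Lemma weight_sup_fineE (x : R) : (0 < x)%R -> (fine (S x))%:E = S x.
Proof. by move=> x0; rewrite fineK// gt0_fin_numE ?S_fin// weight_sup_gt0. Qed.

Lemma profileE (x : R) : (0 < x)%R -> (G x * U x `^ p^-1)%:E = S x.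
Proof.
move=> x0; rewrite profile.unlock divfK ?weight_sup_fineE//.
by rewrite gt_eqF// Up0.
Qed.

Lemma profile_gt0 (x : R) : (0 < x)%R -> (0 < G x)%R.
Proof.
move=> x0; have := weight_sup_gt0 x0; rewrite -profileE// lte_fin pmulr_lgt0//.
exact: Up0.
Qed.

Let V_fin (t : R) : (0 < t)%R -> V t < +oo.
Proof.
move=> t0; have t1 : (t < t + 1)%R by rewrite ltrDl.
have := le_lt_trans (weight_sup_ge t0 t1) (S_fin (lt_trans t0 t1)).
apply: contraTT; rewrite -!leNgt !leye_eq => /eqP ->.
by rewrite gt0_muley// lte_fin Up0.
Qed.

(** The supremum stops before x; left continuity of U recovers the value at x itself. Only rational
    points are tested, so the bounds on y may come from countably many statements that hold almost
    everywhere. *)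
Lemma weight_sup_dense (x : R) (y : \bar R) : (0 < x)%R -> 0 <= y ->
  (forall a : rat, (0 < ratr a :> R)%R -> (ratr a < x)%R -> y <= V (ratr a)) ->
  (U x `^ p^-1)%:E * y <= S x.
Proof.
move=> x0 y0 yV; have [a0 /[1!in_itv]/= /andP[a00 a0x]] := rat_in_itvoo x0.
have : y < +oo by apply: le_lt_trans (yV _ a00 a0x) (V_fin a00).
case: y y0 yV => [y||//] y0 yV _; last by have := le_lt_trans (yV _ a00 a0x) (V_fin a00).
rewrite -profileE// -EFinM lee_fin leNgt; apply/negP => lt_y.
have y_gt0 : (0 < y)%R.
  rewrite lt_neqAle -lee_fin y0 andbT eq_sym; apply/eqP => y00.
  move: lt_y; rewrite y00 mulr0 ltNge mulr_ge0 ?powR_ge0//.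
  exact: ltW (profile_gt0 x0).
set sg := (G x * U x `^ p^-1)%R in lt_y.
have sg0 : (0 <= sg)%R by rewrite mulr_ge0 ?powR_ge0// ltW// profile_gt0.
have sgy0 : (0 <= sg / y)%R by rewrite divr_ge0// ltW.
(* If the claim failed, this bound would persist at a rational a < x and give U(a)^(1/p) V(a) > S
   x. *)
have : ((sg / y) `^ p < U x)%R.
  have -> : U x = ((U x `^ p^-1) `^ p)%R.
    by rewrite -powRrM mulVf ?gt_eqF// powRr1// ltW// U0.
  by rewrite gt0_ltr_powR ?nnegrE ?powR_ge0// ltr_pdivrMr.
move=> /(fine_primitive_left hu hU x0)[t /andP[t0 tx] Ut].
have [a /[1!in_itv]/= /andP[ta ax]] := rat_in_itvoo tx.
have a_gt0 : (0 < ratr a :> R)%R by exact: lt_trans ta.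
have := le_trans (lee_wpmul2l (_ : 0 <= (U (ratr a) `^ p^-1)%:E) (yV a a_gt0 ax))
  (weight_sup_ge a_gt0 ax).
rewrite lee_fin powR_ge0 => /(_ isT); rewrite -profileE// -/sg -EFinM lee_fin.
rewrite leNgt => /negP; apply; rewrite -ltr_pdivrMr//.
have -> : (sg / y = ((sg / y) `^ p) `^ p^-1)%R.
  by rewrite -powRrM mulfV ?gt_eqF// powRr1.
apply: gt0_ltr_powR; rewrite ?nnegrE ?powR_ge0 ?invr_gt0//.
  exact: fine_primitive_ge0.
by apply: (lt_le_trans Ut); apply: fine_primitive_le => //; exact: ltW.
Qed.

Lemma profile_ndecr (x y : R) : (0 < x)%R -> (x <= y)%R ->
  (G x * U x `^ p^-1 <= G y * U y `^ p^-1)%R.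
Proof.
move=> x0 xy; have y0 : (0 < y)%R by exact: lt_le_trans xy.
rewrite -lee_fin !profileE// [leLHS]weight_supE; apply: ge_ereal_sup => _ [t tx <-].
move: tx; rewrite /= in_itv/= => /andP[t0 tx].
by apply: weight_sup_ge => //; exact: lt_le_trans xy.
Qed.

(** The supremum defining S y is split at x. The terms with t < x are at most S x = G(x) U(x)^(1/p).
    For t >= x, V t lies below V at every point before x, so V t <= G x by [weight_sup_dense]. *)
Lemma profile_nincr (x y : R) : (0 < x)%R -> (x <= y)%R -> (G y <= G x)%R.
Proof.
move=> x0 xy; have y0 : (0 < y)%R by exact: lt_le_trans xy.
rewrite -(@ler_pM2r _ (U y `^ p^-1)) ?Up0// -lee_fin profileE//.
rewrite weight_supE; apply: ge_ereal_sup => _ [t tx <-].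
move: tx; rewrite /= in_itv/= => /andP[t0 ty].
have Uty : (U t `^ p^-1 <= U y `^ p^-1)%R.
  apply: ge0_ler_powR; rewrite ?nnegrE ?fine_primitive_ge0 ?invr_ge0 ?(ltW p0)//.
  by apply: fine_primitive_le => //; exact: ltW.
have Gx := profile_gt0 x0.
have [tx|xt] := ltP t x.
  apply: le_trans (weight_sup_ge t0 tx) _; rewrite -profileE// lee_fin.
  apply: ler_wpM2l; first exact: ltW.
  apply: ge0_ler_powR; rewrite ?nnegrE ?fine_primitive_ge0 ?invr_ge0 ?(ltW p0)//.
  exact: fine_primitive_le.
have VG : V t <= (G x)%:E.
  have Upx := Up0 x0.
  have : (U x `^ p^-1)%:E * V t <= S x.
    apply: weight_sup_dense => //; first exact: ltW (V0 t0).
    by move=> a a0 ax; apply: ess_sup_inv_nincr; rewrite (le_trans (ltW ax)).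
  by rewrite -profileE// EFinM [leRHS]muleC lee_pmul2l.
apply: (@le_trans _ _ ((U y `^ p^-1)%:E * (G x)%:E)).
  by apply: lee_pmul => //; rewrite ?lee_fin ?powR_ge0// ltW// V0.
by rewrite -EFinM mulrC.
Qed.

Lemma measurable_profile : measurable_fun D G.
Proof.
(* Extended by zero, S is nondecreasing on the whole line, hence measurable; G is its quotient by
   U^(1/p). *)
pose f (x : R) : R := if (0 < x)%R then (G x * U x `^ p^-1)%R else 0%R.
have mf : measurable_fun D f.
  apply: nondecreasing_measurable; first exact: measurableD0.
  move=> x y xy; rewrite /f; case: ltP => x0.
    by rewrite (lt_le_trans x0 xy) profile_ndecr.
  by case: ltP => // y0; rewrite mulr_ge0 ?powR_ge0// ltW// profile_gt0.
have mUp : measurable_fun D (fun x => (U x `^ p^-1)^-1%R).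
  apply: measurable_fun_invr_gt0 => [|x /setDE]; last exact: Up0.
  apply: (measurableT_comp (measurable_powR _)).
  by apply: measurable_fine_primitive => //; exact: measurableD0.
have mfU := measurable_funM mf mUp.
apply: eq_measurable_fun mfU => x /[1!inE] /setDE x0.
by rewrite /f/= x0 mulfK// gt_eqF// Up0.
Qed.

(** For each rational a, 1/v <= V a holds almost everywhere beyond a. Outside the countable union of
    the exceptional sets [weight_sup_dense] applies with y = 1 / v z; its conclusion also excludes v
    z = 0. *)
Lemma profile_inv_le : {ae mu, forall z, D z -> ((G z)^-1 <= v z)%R}.
Proof.
have : {ae mu, forall z, forall n : nat, if unpickle n is Some a then
    (0 < ratr a :> R)%R -> (ratr a < z)%R -> (v z)%:E^-1 <= V (ratr a) else True}.
  apply/ae_foralln => n; case: (unpickle n) => [a|]; last exact: aeW.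
  have /ess_sup_invP := lexx (V (ratr a : R)).
  by apply: (@filterS _ _ (ae_filter_ringOfSetsType mu)) => z H _.
apply: (@filterS _ _ (ae_filter_ringOfSetsType mu)) => z H /setDE z0.
have Upz := Up0 z0; have Gz := profile_gt0 z0.
have : (U z `^ p^-1)%:E * (v z)%:E^-1 <= S z.
  apply: weight_sup_dense => //; first by rewrite inve_ge0 lee_fin v0.
  by move=> a; have := H (pickle a); rewrite pickleK.
rewrite -profileE// EFinM [leRHS]muleC lee_pmul2l// inver.
case: eqP => [_|/eqP vz]; first by rewrite leye_eq.
have vz0 : (0 < v z)%R by rewrite lt_neqAle eq_sym vz v0.
by rewrite lee_fin => vG; rewrite -[leRHS]invrK lef_pV2// posrE invr_gt0.
Qed.

(** An almost optimal t in the supremum is moved left to a rational a: U loses little by continuity,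
    and V can only grow. Rational data make the family of bumps countable. *)
Lemma profile_rat_approx (x k : R) : (0 < x)%R -> (0 <= k)%R -> (k < G x)%R ->
  exists a rho : rat, [/\ (0 < ratr a :> R)%R, (ratr a < x)%R,
    (0 < ratr rho :> R)%R, (ratr rho)%:E < V (ratr a) &
    (k * U x `^ p^-1 < ratr rho * U (ratr a) `^ p^-1)%R].
Proof.
move=> x0 k0 kG; have Upx := Up0 x0.
have : (k * U x `^ p^-1)%:E < S x by rewrite -profileE// lte_fin ltr_pM2r.
rewrite weight_supE => /ereal_sup_gt[_ [t + <-]].
rewrite /= in_itv/= => /andP[t0 tx].
have := V_fin t0; have := V0 t0; case Vt : (V t) => [n||]// n0 _.
rewrite lte_fin in n0; rewrite -EFinM lte_fin -ltr_pdivrMr// => Ut.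
set y := (k * U x `^ p^-1 / n)%R in Ut.
have y0 : (0 <= y)%R by rewrite divr_ge0 ?mulr_ge0 ?(ltW n0) ?(ltW Upx).
have yU : (y `^ p < U t)%R.
  have -> : U t = ((U t `^ p^-1) `^ p)%R.
    by rewrite -powRrM mulVf ?gt_eqF// powRr1// ltW// U0.
  by apply: gt0_ltr_powR => //; rewrite nnegrE// powR_ge0.
have [t' /andP[t'0 t't] Ut'] := fine_primitive_left hu hU t0 yU.
have [a /[1!in_itv]/= /andP[ta at_]] := rat_in_itvoo t't.
have a0 : (0 < ratr a :> R)%R by exact: lt_trans ta.
have Upa := Up0 a0.
have yUa : (y < U (ratr a) `^ p^-1)%R.
  have -> : y = ((y `^ p) `^ p^-1)%R by rewrite -powRrM mulfV ?gt_eqF// powRr1.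
  apply: gt0_ltr_powR; rewrite ?nnegrE ?powR_ge0 ?invr_gt0 ?fine_primitive_ge0//.
  by apply: (lt_le_trans Ut'); apply: fine_primitive_le => //; exact: ltW.
have /rat_in_itvoo[rho /[1!in_itv]/= /andP[lrho rhon]] :
    (k * U x `^ p^-1 / U (ratr a) `^ p^-1 < n)%R.
  by rewrite ltr_pdivrMr// [ltRHS]mulrC -ltr_pdivrMr.
exists a, rho; split => //.
- exact: lt_trans at_ tx.
- by apply: le_lt_trans lrho; rewrite divr_ge0 ?mulr_ge0 ?(ltW Upx) ?(ltW Upa).
- have : (ratr rho)%:E < V t by rewrite Vt lte_fin.
  by move=> /lt_le_trans; apply; apply: ess_sup_inv_nincr; exact: ltW.
- by rewrite -ltr_pdivrMr.
Qed.

End profile.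

(** * Sufficiency *)

Section hardy_operator.
Context (R : realType) (u w : R -> R) (p q : R).
Local Notation mu := (@lebesgue_measure R).
Local Notation D := (`]0%R, +oo[%classic : set R).
Local Notation U := (fine_primitive u).
Local Notation cap := (cap u).
Local Notation Phi := (Phi u w (q / p)).
Local Notation Wl := (lower_mass w).
Local Notation Om := (upper_mass u w (q / p)).
Hypotheses (hp : (1 <= p)%R) (hq : (0 < q)%R).
Hypotheses (hu : weight u) (hU : admissible_wt (primitive_wt u)) (hw : weight w)
  (hnd : nondegenerate_wrt (primitive_wt u) (q / p) w).

Let p0 : (0 < p)%R. Proof. exact: lt_le_trans hp. Qed.
Let r0 : (0 < q / p)%R. Proof. exact: divr_gt0. Qed.
Let mD : measurable D. Proof. exact: measurableD0. Qed.
Let mu_ : measurable_fun D u. Proof. by case: hu => -[]. Qed.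
Let mw : measurable_fun D w. Proof. by case: hw => -[]. Qed.
Let u0 (t : R) : (0 < t)%R -> (0 <= u t)%R. Proof. by case: hu => _; exact. Qed.
Let w0 (t : R) : (0 < t)%R -> (0 <= w t)%R. Proof. by case: hw => _; exact. Qed.
Let U0 (t : R) : (0 < t)%R -> (0 < U t)%R. Proof. exact: fine_primitive_gt0. Qed.
Let mU : measurable_fun D U. Proof. exact: measurable_fine_primitive. Qed.

Section fixed_function.
Variable h : R -> \bar R.
Hypothesis hh : nonneg_measurable h.
Let mh : measurable_fun D h. Proof. by case: hh. Qed.
Let h0 (t : R) : (0 < t)%R -> 0 <= h t. Proof. by case: hh => _; exact. Qed.

Lemma tail_integralE (s : R) : (0 < s)%R ->
  \int[mu]_(z in `]s, +oo[) h z = \int[mu]_(z in D) ((s < z)%R%:R%:E * h z).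
Proof.
move=> s0; rewrite integral_boolMe; congr (integral _ _ _).
apply/seteqP; split => z; rewrite /= !in_itv/= !andbT.
- by move=> sz; rewrite (lt_trans s0).
- by case.
Qed.

Let mltK : measurable_fun (D `*` D) (fun sz : R * R => (sz.1 < sz.2)%R%:R : R).
Proof.
by apply: measurable_boolR; apply: measurable_fun_ltr; exact: measurable_funTS.
Qed.

Lemma measurable_tail_integral :
  measurable_fun D (fun s => \int[mu]_(z in `]s, +oo[) h z).
Proof.
suff mf : measurable_fun D (fun s : R => \int[mu]_(z in D) ((s < z)%R%:R%:E * h z)).
  by apply: eq_measurable_fun mf => s /[1!inE] /setDE s0; rewrite tail_integralE.
apply: (@measurable_integral2 _ _ _ _ _ mu D D
  (fun sz : R * R => (sz.1 < sz.2)%R%:R%:E * h sz.2)) => //.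
- apply: emeasurable_funM; first exact/measurable_EFinP.
  exact: (measurable_snd_rectangle mD mh).
- by move=> s z /setDE s0 /setDE z0; rewrite mule_ge0 ?h0.
Qed.

Lemma tail_integral_ge0 (s : R) : (0 < s)%R -> 0 <= \int[mu]_(z in `]s, +oo[) h z.
Proof.
move=> s0; apply: integral_ge0 => z /=; rewrite in_itv/= andbT => sz.
by rewrite h0// (lt_trans s0).
Qed.

Let g (s : R) : \bar R := (\int[mu]_(z in `]s, +oo[) h z) `^ p * (u s)%:E.

Let mg : measurable_fun D g.
Proof.
apply: emeasurable_funM; last exact/measurable_EFinP.
exact: (measurableT_comp (measurable_poweR p) measurable_tail_integral).
Qed.

Let g0 (s : R) : (0 < s)%R -> 0 <= g s.
Proof. by move=> s0; rewrite mule_ge0 ?poweR_ge0// lee_fin u0. Qed.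

Lemma measurable_hardy_integrand : measurable_fun D (fun t =>
  ((primitive_wt u t)^-1 * \int[mu]_(s in `]0%R, t[) g s) `^ (q / p) * (w t)%:E).
Proof.
apply: emeasurable_funM; last exact/measurable_EFinP.
apply: (measurableT_comp (measurable_poweR (q / p))).
suff mf : measurable_fun D (fun t : R => (U t)^-1%:E *
    \int[mu]_(s in D) ((s < t)%R%:R%:E * g s)).
  apply: eq_measurable_fun mf => t /[1!inE] /setDE t0.
  rewrite fine_primitiveE ?(ltW t0)// inver.
  rewrite (gt_eqF (U0 t0)) integral_boolMe; congr (_ * integral _ _ _).
  apply/seteqP; split => z; rewrite /= !in_itv/= ?andbT.
  - by case=> -> ->.
  - by move=> /andP[-> ->].
apply: emeasurable_funM.
  apply/measurable_EFinP; apply: measurable_fun_invr_gt0 => // t /setDE.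
  exact: U0.
apply: (@measurable_integral2 _ _ _ _ _ mu D D
  (fun ts : R * R => (ts.2 < ts.1)%R%:R%:E * g ts.2)) => //.
- apply: emeasurable_funM; last exact: (measurable_snd_rectangle mD mg).
  apply/measurable_EFinP; apply: measurable_boolR.
  by apply: measurable_fun_ltr; exact: measurable_funTS.
- by move=> s z /setDE s0 /setDE z0; rewrite mule_ge0 ?g0.
Qed.

Lemma hardy_integrand_ge0 (t : R) : (0 < t)%R -> 0 <=
  ((primitive_wt u t)^-1 * \int[mu]_(s in `]0%R, t[) g s) `^ (q / p) * (w t)%:E.
Proof. by move=> t0; rewrite mule_ge0 ?poweR_ge0// lee_fin w0. Qed.

(** Minkowski's inequality for the kernel 1_{s < z} and the measure u ds on (0, t): the p-th power
    of the norm of the kernel is min(U z, U t), by [integral_weight_min]. Division by U t turns it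
    into [cap z t]. *)
Lemma hardy_operator_le (t : R) : (0 < t)%R ->
  ((primitive_wt u t)^-1 * \int[mu]_(s in `]0%R, t[) g s) `^ (q / p) <=
  (\int[mu]_(z in D) ((cap z t `^ p^-1)%:E * h z)) `^ q.
Proof.
move=> t0; have Ut := U0 t0.
have mDt : measurable (`]0%R, t[%classic : set R) by exact: measurable_itv.
have Dt (s : R) : `]0%R, t[%classic s -> (0 < s)%R.
  by rewrite /= in_itv/= => /andP[].
pose N z := (Num.min (U z) (U t) `^ p^-1)%R.
have N0 z : (0 < z)%R -> (0 < N z)%R.
  by move=> z0; rewrite powR_gt0// lt_min U0// U0.
have mN : measurable_fun D N.
  apply: (measurableT_comp (measurable_powR _)).
  by apply: measurable_minr => //; exact: measurable_cst.
have := @kernel_minkowski _ _ _ _ R mu mu (`]0%R, t[%classic) D mDt mD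
  (fun sz => (sz.1 < sz.2)%R%:R%R) u h N _ _ mh mN _ _ _ _ p hp.
move=> mink.
have {mink} H : \int[mu]_(s in `]0%R, t[) g s <=
    (\int[mu]_(z in D) (h z * (N z)%:E)) `^ p.
  have -> : \int[mu]_(s in `]0%R, t[) g s = \int[mu]_(s in `]0%R, t[)
      ((\int[mu]_(z in D) ((s < z)%R%:R%:E * h z)) `^ p * (u s)%:E).
    by apply: eq_integral => s /[1!inE] /Dt s0; rewrite /g tail_integralE.
  apply: mink.
  - by apply: measurable_boolR; apply: measurable_fun_ltr; exact: measurable_funTS.
  - by apply: measurable_funS mu_ => //; apply: subset_itvl; rewrite bnd_simp.
  - by move=> s z _ _.
  - by move=> s /Dt; exact: u0.
  - by move=> z /setDE; exact: h0.
  - by move=> z /setDE; exact: N0.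
  - move=> z /setDE z0; rewrite /N -powRrM mulVf ?gt_eqF// powRr1; last first.
      by rewrite le_min ltW ?U0// ltW.
    rewrite -(integral_weight_min hu hU t0 z0).
    rewrite le_eqVlt; apply/predU1P; left; apply: eq_integral => s _ /=.
    by case: (s < z)%R; rewrite ?powR1// powR0// gt_eqF.
have Up : (0 < U t `^ (- p^-1))%R by rewrite powR_gt0.
have M0 : 0 <= \int[mu]_(z in D) (h z * (N z)%:E).
  by apply: integral_ge0 => z /setDE z0; rewrite mule_ge0 ?h0// lee_fin ltW// N0.
have -> : \int[mu]_(z in D) ((cap z t `^ p^-1)%:E * h z) =
    (U t `^ (- p^-1))%:E * \int[mu]_(z in D) (h z * (N z)%:E).
  rewrite -ge0_integralZl_EFin ?(ltW Up)//.
  - apply: eq_integral => z /[1!inE] /setDE z0.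
    rewrite muleCA -EFinM muleC; congr (_ * _%:E).
    have -> : (cap z t = Num.min (U z) (U t) / U t)%R.
      rewrite cap.unlock minr_pMl ?invr_ge0 ?(ltW Ut)// divff ?gt_eqF//.
      by rewrite minC.
    rewrite powRM ?invr_ge0 ?(ltW Ut)//; last by rewrite le_min ltW ?U0// ltW.
    by rewrite -[((U t)^-1)%R]powR_inv1 ?(ltW Ut)// -powRrM mulN1r mulrC.
  - by move=> z /setDE z0; rewrite mule_ge0 ?h0// lee_fin ltW// N0.
  - by apply: emeasurable_funM => //; exact/measurable_EFinP.
set M := \int[mu]_(z in D) (h z * (N z)%:E).
have qE : q = (p * (q / p))%R by rewrite mulrCA divff ?gt_eqF// mulr1.
have -> : ((U t `^ (- p^-1))%:E * M) `^ q = ((U t)^-1%:E * M `^ p) `^ (q / p).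
  rewrite [in LHS]qE poweRrM poweRM ?lee_fin ?(ltW Up)//.
  by rewrite poweR_EFin -powRrM mulNr mulVf ?gt_eqF// powR_inv1 ?(ltW Ut).
rewrite fine_primitiveE ?(ltW t0)// inver (gt_eqF Ut).
apply: (gt0_ler_poweR (ltW r0)); rewrite ?in_itv/= ?leey ?andbT.
- apply: mule_ge0; first by rewrite lee_fin invr_ge0 ltW.
  by apply: integral_ge0 => s /Dt; exact: g0.
- by rewrite mule_ge0 ?poweR_ge0// lee_fin invr_ge0 ltW.
- by apply: lee_wpmul2l => //; rewrite lee_fin invr_ge0 ltW.
Qed.

Lemma measurable_cap_powR : measurable_fun (D `*` D) (fun tz => cap tz.2 tz.1 `^ p^-1)%R.
Proof.
apply: (measurableT_comp (measurable_powR _)).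
rewrite cap.unlock; apply: measurable_minr; first exact: measurable_cst.
apply: measurable_funM; first exact: (measurable_snd_rectangle mD mU).
have mUV : measurable_fun D (fun t => (U t)^-1%R).
  by apply: measurable_fun_invr_gt0 => // t /setDE; exact: U0.
exact: (measurable_fst_rectangle mD mUV).
Qed.

Lemma measurable_cap_integral :
  measurable_fun D (fun t => \int[mu]_(z in D) ((cap z t `^ p^-1)%:E * h z)).
Proof.
apply: (@measurable_integral2 _ _ _ _ _ mu D D
  (fun tz : R * R => (cap tz.2 tz.1 `^ p^-1)%:E * h tz.2)) => //.
- apply: emeasurable_funM.
    by apply/measurable_EFinP; exact: measurable_cap_powR.
  exact: (measurable_snd_rectangle mD mh).
- by move=> s z /setDE s0 /setDE z0; rewrite mule_ge0 ?h0// lee_fin powR_ge0.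
Qed.

Lemma hardy_lhs_le : hardy_lhs p q u w h <= (\int[mu]_(t in D)
  ((\int[mu]_(z in D) ((cap z t `^ p^-1)%:E * h z)) `^ q * (w t)%:E)) `^ q^-1.
Proof.
have qV : (0 <= q^-1)%R by rewrite invr_ge0 ltW.
rewrite /hardy_lhs; apply: (gt0_ler_poweR qV); rewrite ?in_itv/= ?leey ?andbT.
- by apply: integral_ge0 => t /setDE t0; exact: hardy_integrand_ge0.
- by apply: integral_ge0 => t /setDE t0; rewrite mule_ge0 ?poweR_ge0// lee_fin w0.
apply: ge0_le_integral => //.
- by move=> t /setDE t0; exact: hardy_integrand_ge0.
- exact: measurable_hardy_integrand.
- apply: emeasurable_funM; last exact/measurable_EFinP.
  exact: (measurableT_comp (measurable_poweR q) measurable_cap_integral).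
- move=> t /setDE t0; apply: lee_wpmul2r; first by rewrite lee_fin w0.
  exact: hardy_operator_le.
Qed.

End fixed_function.
End hardy_operator.

(** The sum is at most twice the larger term, and 2^q <= 2. *)
Lemma poweRD_le2 (R : realType) (x y : \bar R) (q : R) : (0 <= q <= 1)%R ->
  0 <= x -> 0 <= y -> (x + y) `^ q <= 2%:E * (x `^ q + y `^ q).
Proof.
move=> /andP[q0 q1] x0 y0.
wlog xy : x y x0 y0 / x <= y.
  move=> H; have /orP[] := le_total x y; first exact: H.
  by rewrite addeC [X in _ * X]addeC; exact: H.
have le1 : x + y <= 2%:E * y by rewrite (_ : 2%:E = 1 + 1)// ge0_muleDl// mul1e leeD2r.
apply: (@le_trans _ _ ((2%:E * y) `^ q)).
  by apply: (gt0_ler_poweR q0) => //; rewrite in_itv/= leey andbT ?adde_ge0 ?mule_ge0.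
rewrite poweRM//; apply: (@le_trans _ _ (2%:E * y `^ q)).
  apply: lee_wpmul2r; first exact: poweR_ge0.
  by rewrite poweR_EFin lee_fin; apply: ler1_powR => //; rewrite ler1n.
by apply: lee_wpmul2l => //; rewrite leeDr// poweR_ge0.
Qed.

(** * The upper bounds for the linear operator *)

Section hardy_sufficiency.
Context (R : realType) (u v w : R -> R) (p q : R).
Local Notation mu := (@lebesgue_measure R).
Local Notation D := (`]0%R, +oo[%classic : set R).
Local Notation U := (fine_primitive u).
Local Notation cap := (cap u).
Local Notation Phi := (Phi u w (q / p)).
Local Notation Wl := (lower_mass w).
Local Notation Om := (upper_mass u w (q / p)).
Hypotheses (hp : (1 <= p)%R) (hq : (0 < q)%R).
Hypotheses (hu : weight u) (hU : admissible_wt (primitive_wt u)) (hw : weight w)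
  (hv : weight v) (hnd : nondegenerate_wrt (primitive_wt u) (q / p) w).

Let p0 : (0 < p)%R. Proof. exact: lt_le_trans hp. Qed.
Let r0 : (0 < q / p)%R. Proof. exact: divr_gt0. Qed.
Let mD : measurable D. Proof. exact: measurableD0. Qed.
Let mw : measurable_fun D w. Proof. by case: hw => -[]. Qed.
Let mv : measurable_fun D v. Proof. by case: hv => -[]. Qed.
Let w0 (t : R) : (0 < t)%R -> (0 <= w t)%R. Proof. by case: hw => _; exact. Qed.
Let v0 (t : R) : (0 < t)%R -> (0 <= v t)%R. Proof. by case: hv => _; exact. Qed.
Let U0 (t : R) : (0 < t)%R -> (0 < U t)%R. Proof. exact: fine_primitive_gt0. Qed.
Let mU : measurable_fun D U. Proof. exact: measurable_fine_primitive. Qed.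
Let mPhi : measurable_fun D Phi. Proof. exact: measurable_Phi. Qed.

Lemma Phi_gt0 (x : R) : (0 < x)%R -> (0 < Phi x)%R.
Proof.
move=> x0; apply: lt_le_trans (lower_mass_le_Phi hu hU hw r0 hnd x0).
exact: (lower_mass_gt0 hu hU hw r0 hnd).
Qed.

Section fixed_function.
Variable h : R -> \bar R.
Hypothesis hh : nonneg_measurable h.
Let mh : measurable_fun D h. Proof. by case: hh. Qed.
Let h0 (t : R) : (0 < t)%R -> 0 <= h t. Proof. by case: hh => _; exact. Qed.

(** The q-th power of the L^q(w)-norm of t |-> cap(z, t)^(1/p) is exactly Phi z, so Minkowski's
    inequality holds with N = Phi^(1/q); the hypothesis then replaces N by C v. *)
Lemma hardy_sufficiency_ge1 (C : R) : (1 <= q)%R -> (0 <= C)%R ->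
  {ae mu, forall z, D z -> (Phi z `^ q^-1 <= C * v z)%R} ->
  hardy_lhs p q u w h <= C%:E * \int[mu]_(z in D) (h z * (v z)%:E).
Proof.
move=> q1 C0 PhiC; apply: (le_trans (hardy_lhs_le hp hq hu hU hw hh)).
have qV : (0 <= q^-1)%R by rewrite invr_ge0 ltW.
pose N z := (Phi z `^ q^-1)%R.
have N0 z : D z -> (0 < N z)%R by move=> /setDE z0; rewrite powR_gt0// Phi_gt0.
have mN : measurable_fun D N by exact: (measurableT_comp (measurable_powR _) mPhi).
have NE z : D z -> (N z `^ q = Phi z)%R.
  move=> /setDE z0; rewrite /N -powRrM mulVf ?gt_eqF// powRr1//.
  by rewrite ltW// Phi_gt0.
have hN0 z : D z -> 0 <= h z * (N z)%:E.
  by move=> Dz; rewrite mule_ge0 ?(h0 (setDE Dz))// lee_fin ltW// N0.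
have I0 : 0 <= \int[mu]_(z in D) (h z * (N z)%:E) by exact: integral_ge0.
have mink : \int[mu]_(t in D)
    ((\int[mu]_(z in D) ((cap z t `^ p^-1)%:E * h z)) `^ q * (w t)%:E) <=
    (\int[mu]_(z in D) (h z * (N z)%:E)) `^ q.
  apply: (@kernel_minkowski _ _ _ _ R mu mu D D mD mD
    (fun tz => (cap tz.2 tz.1 `^ p^-1)%R) w h N) => //.
  - exact: measurable_cap_powR.
  - by move=> x z _ _; exact: powR_ge0.
  - by move=> x /setDE; exact: w0.
  - by move=> z /setDE; exact: h0.
  - move=> z /[dup] Dz /setDE z0; rewrite NE// -(PhiE hu hU hw r0 hnd z0)/= /fundamental.
    rewrite le_eqVlt; apply/predU1P; left; apply: eq_integral => t _.
    by rewrite -powRrM [(p^-1 * q)%R]mulrC.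
apply: (@le_trans _ _ (((\int[mu]_(z in D) (h z * (N z)%:E)) `^ q) `^ q^-1)).
  apply: (gt0_ler_poweR qV) => //; rewrite ?in_itv/= ?leey ?andbT ?poweR_ge0//.
  by apply: integral_ge0 => t /setDE t0; rewrite mule_ge0 ?poweR_ge0// lee_fin w0.
rewrite -poweRrM mulfV ?gt_eqF// poweRe1//.
have mhv : measurable_fun D (fun z => h z * (v z)%:E).
  by apply: emeasurable_funM => //; exact/measurable_EFinP.
have hv0 z : D z -> 0 <= h z * (v z)%:E.
  by move=> /setDE z0; rewrite mule_ge0 ?h0// lee_fin v0.
rewrite -ge0_integralZl_EFin//; apply: ae_ge0_le_integral => //.
- by apply: emeasurable_funM => //; exact/measurable_EFinP.
- by move=> z Dz; rewrite mule_ge0 ?hv0.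
- exact: measurable_funeM.
- apply: (@filterS _ _ (ae_filter_ringOfSetsType mu) _ _ _ PhiC) => z H Dz.
  rewrite muleCA -EFinM; apply: lee_wpmul2l; first exact: h0 (setDE Dz).
  by rewrite lee_fin H.
Qed.

Section below_one.
Hypothesis q1 : (q < 1)%R.
Let s := (q / (1 - q))%R.
Variable G : R -> R.
Hypotheses (mG : measurable_fun D G) (G0 : forall t : R, (0 < t)%R -> (0 < G t)%R)
  (G_nincr : forall x y : R, (0 < x)%R -> (x <= y)%R -> (G y <= G x)%R)
  (GU_ndecr : forall x y : R, (0 < x)%R -> (x <= y)%R ->
    (G x * U x `^ p^-1 <= G y * U y `^ p^-1)%R)
  (Gv : {ae mu, forall z, D z -> ((G z)^-1 <= v z)%R}).
Let J := \int[mu]_(x in D) (Phi x `^ s * G x `^ s * w x)%:E.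
Hypothesis J_fin : J < +oo.

Let q01 : (0 < q < 1)%R. Proof. by rewrite hq. Qed.
Let q1' : (0 < 1 - q)%R. Proof. by rewrite subr_gt0. Qed.
Let s0 : (0 < s)%R. Proof. exact: divr_gt0. Qed.
Let mWl : measurable_fun D Wl. Proof. exact: measurable_lower_mass. Qed.
Let mOm : measurable_fun D Om. Proof. exact: measurable_upper_mass. Qed.
Let Wl0 (x : R) : (0 < x)%R -> (0 < Wl x)%R.
Proof. exact: (lower_mass_gt0 hu hU hw r0 hnd). Qed.
Let Om0 (x : R) : (0 < x)%R -> (0 < Om x)%R.
Proof. exact: (upper_mass_gt0 hu hU hw r0 hnd). Qed.
Let mpowR (a : R) (f : R -> R) : measurable_fun D f ->
  measurable_fun D (fun x => f x `^ a)%R.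
Proof. exact: (measurableT_comp (measurable_powR a)). Qed.

Let K := \int[mu]_(z in D) (h z * (G z)^-1%:E).

Let mJ : measurable_fun D (fun x => (Phi x `^ s * G x `^ s * w x)%:E).
Proof.
apply/measurable_EFinP; apply: measurable_funM => //.
by apply: measurable_funM; exact: mpowR.
Qed.

Let J1 := \int[mu]_(x in D) (G x `^ s * Wl x `^ s * w x)%:E.
Let J1_le : J1 <= J.
Proof.
apply: ge0_le_integral => //.
- move=> x /setDE x0; rewrite lee_fin; apply: mulr_ge0; last exact: w0.
  by apply: mulr_ge0; exact: powR_ge0.
- apply/measurable_EFinP; apply: measurable_funM => //.
  by apply: measurable_funM; exact: mpowR.
- move=> x /setDE x0; rewrite lee_fin [(G x `^ s * _)%R]mulrC.
  apply: ler_wpM2r; first exact: w0.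
  apply: ler_wpM2r; first exact: powR_ge0.
  apply: ge0_ler_powR; rewrite ?nnegrE ?(ltW s0) ?(ltW (Wl0 _)) ?(ltW (Phi_gt0 _))//.
  exact: (lower_mass_le_Phi hu hU hw r0 hnd).
Qed.

(** The part z > t, where the kernel is 1: the relevant mass is the lower one, and G itself is
    nonincreasing along <. *)
Let near_part : \int[mu]_(t in D)
    ((\int[mu]_(z in D) ((t < z)%R%:R%:E * h z)) `^ q * (w t)%:E) <=
  4%:E * J `^ (1 - q) * K `^ q.
Proof.
apply: (@le_trans _ _ (4%:E * J1 `^ (1 - q) * K `^ q)).
  apply: (@hardy_monotone_weight _ _ R mu D (fun x z => (x < z)%R) w Wl G h).
  - exact: mD.
  - by apply: measurable_fun_ltr; exact: measurable_funTS.
  - exact: mw.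
  - exact: mWl.
  - exact: mG.
  - exact: mh.
  - by move=> x /setDE; exact: w0.
  - by move=> x /setDE; exact: Wl0.
  - by move=> x /setDE; exact: G0.
  - by move=> x /setDE; exact: h0.
  - by move=> z /setDE z0; rewrite (lower_massE hu hU hw r0 hnd).
  - move=> l; exact: (lower_mass_level hu hU hw r0 hnd).
  - move=> t z /setDE t0 /setDE z0 /ltW tz; split; last exact: G_nincr.
    exact: (lower_mass_ndecr hu hU hw r0 hnd).
  - exact: q01.
  - exact: le_lt_trans J1_le J_fin.
apply: lee_wpmul2r; first exact: poweR_ge0.
apply: lee_wpmul2l => //; apply: (gt0_ler_poweR (ltW q1')) => //.
- rewrite in_itv/= leey andbT; apply: integral_ge0 => x /setDE x0; rewrite lee_fin.
  by apply: mulr_ge0; [apply: mulr_ge0; exact: powR_ge0|exact: w0].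
- rewrite in_itv/= leey andbT; apply: integral_ge0 => x /setDE x0; rewrite lee_fin.
  by apply: mulr_ge0; [apply: mulr_ge0; exact: powR_ge0|exact: w0].
Qed.

(** On the part z <= t the kernel is (U z / U t)^(1/p). Attaching its numerator to h and its
    denominator to w leaves a Hardy operator with kernel 1 for the reversed order; 1/G then becomes
    the reciprocal of G U^(1/p), which has the monotonicity required for that order. *)
Let wd t := (w t / U t `^ (q / p))%R.
Let mwd : measurable_fun D wd.
Proof.
apply: measurable_funM => //; apply: measurable_fun_invr_gt0; first exact: mpowR.
by move=> t /setDE t0; rewrite powR_gt0// U0.
Qed.
Let wd0 (t : R) : (0 < t)%R -> (0 <= wd t)%R.
Proof. by move=> t0; apply: divr_ge0; [exact: w0|exact: powR_ge0]. Qed.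
Let G2 t := (G t * U t `^ p^-1)%R.
Let mG2 : measurable_fun D G2.
Proof. by apply: measurable_funM => //; exact: mpowR. Qed.
Let G20 (t : R) : (0 < t)%R -> (0 < G2 t)%R.
Proof. by move=> t0; apply: mulr_gt0; [exact: G0|apply: powR_gt0; exact: U0]. Qed.

Let J2 := \int[mu]_(x in D) (G2 x `^ s * Om x `^ s * wd x)%:E.
Let J2_le : J2 <= J.
Proof.
apply: ge0_le_integral => //.
- move=> x /setDE x0; rewrite lee_fin; apply: mulr_ge0; last exact: wd0.
  by apply: mulr_ge0; exact: powR_ge0.
- apply/measurable_EFinP; apply: measurable_funM => //.
  by apply: measurable_funM; exact: mpowR.
- move=> x /setDE x0; rewrite lee_fin.
  have Ux := U0 x0; have Omx := Om0 x0; have Gx := G0 x0.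
  have -> : (G2 x `^ s * Om x `^ s * wd x =
      (U x `^ (q / p) * Om x) `^ s * G x `^ s * w x)%R.
    rewrite /G2 /wd !powRM ?powR_ge0 ?(ltW Gx) ?(ltW Omx)//.
    rewrite -!powRrM -powRN.
    transitivity (U x `^ (p^-1 * s) * U x `^ (- (q / p)) *
      (G x `^ s * Om x `^ s * w x))%R; first by ring.
    rewrite -powRDgt0//.
    (* The identity s (1 - q) = q again: the powers of U left over by the substitution are those
       that turn the upper mass into U^(q/p) [Om], which is at most Phi. *)
    have -> : (p^-1 * s - q / p = q / p * s)%R.
      by rewrite /s; field; rewrite !gt_eqF.
    by ring.
  apply: ler_wpM2r; first exact: w0.
  apply: ler_wpM2r; first exact: powR_ge0.
  apply: ge0_ler_powR; rewrite ?nnegrE ?(ltW s0) ?(ltW (Phi_gt0 _))//.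
    by rewrite mulr_ge0 ?powR_ge0 ?ltW.
  exact: (upper_mass_le_Phi hu hU hw r0 hnd).
Qed.

Let far_part : \int[mu]_(t in D)
    ((\int[mu]_(z in D) ((z <= t)%R%:R%:E * (h z * (U z `^ p^-1)%:E))) `^ q
      * (wd t)%:E) <=
  4%:E * J `^ (1 - q) * K `^ q.
Proof.
have KE : K = \int[mu]_(z in D) (h z * (U z `^ p^-1)%:E * (G2 z)^-1%:E).
  apply: eq_integral => z /[1!inE] /setDE z0; rewrite -muleA -EFinM /G2.
  have Ux := U0 z0; have Gx := G0 z0.
  by rewrite invfM mulrCA mulfV ?mulr1// gt_eqF// powR_gt0.
apply: (@le_trans _ _ (4%:E * J2 `^ (1 - q) * K `^ q)).
  rewrite KE; apply: (@hardy_monotone_weight _ _ R mu D (fun x z => (z <= x)%R) wd Om G2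
    (fun z => h z * (U z `^ p^-1)%:E)).
  - exact: mD.
  - by apply: measurable_fun_ler; exact: measurable_funTS.
  - exact: mwd.
  - exact: mOm.
  - exact: mG2.
  - apply: emeasurable_funM => //; apply/measurable_EFinP; exact: mpowR.
  - by move=> x /setDE; exact: wd0.
  - by move=> x /setDE; exact: Om0.
  - by move=> x /setDE; exact: G20.
  - move=> x /setDE x0; rewrite mule_ge0 ?h0// lee_fin; exact: powR_ge0.
  - by move=> z /setDE z0; rewrite (upper_massE hu hU hw r0 hnd).
  - move=> l; exact: (upper_mass_level hu hU hw r0 hnd).
  - move=> t z /setDE t0 /setDE z0 zt; split; last exact: GU_ndecr.
    exact: (upper_mass_nincr hu hU hw r0 hnd).
  - exact: q01.
  - exact: le_lt_trans J2_le J_fin.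
apply: lee_wpmul2r; first exact: poweR_ge0.
apply: lee_wpmul2l => //; apply: (gt0_ler_poweR (ltW q1')) => //.
- rewrite in_itv/= leey andbT; apply: integral_ge0 => x /setDE x0; rewrite lee_fin.
  by apply: mulr_ge0; [apply: mulr_ge0; exact: powR_ge0|exact: wd0].
- rewrite in_itv/= leey andbT; apply: integral_ge0 => x /setDE x0; rewrite lee_fin.
  by apply: mulr_ge0; [apply: mulr_ge0; exact: powR_ge0|exact: w0].
Qed.

Let F1 (t : R) := \int[mu]_(z in D) ((t < z)%R%:R%:E * h z).
Let F2 (t : R) := \int[mu]_(z in D)
  ((z <= t)%R%:R%:E * (h z * (U z `^ p^-1)%:E)).

Let hU0 (z : R) : (0 < z)%R -> 0 <= h z * (U z `^ p^-1)%:E.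
Proof. by move=> z0; apply: mule_ge0; [exact: h0|rewrite lee_fin; exact: powR_ge0]. Qed.

Let mhU : measurable_fun D (fun z => h z * (U z `^ p^-1)%:E).
Proof. by apply: emeasurable_funM => //; apply/measurable_EFinP; exact: mpowR. Qed.

Let mF1 : measurable_fun D F1.
Proof.
apply: (@measurable_integral2 _ _ _ _ _ mu D D
  (fun tz : R * R => (tz.1 < tz.2)%R%:R%:E * h tz.2)) => //.
- apply: emeasurable_funM; last exact: (measurable_snd_rectangle mD mh).
  apply/measurable_EFinP; apply: measurable_boolR.
  by apply: measurable_fun_ltr; exact: measurable_funTS.
- by move=> t z _ /setDE z0; apply: mule_ge0 => //; exact: h0.
Qed.

Let mF2 : measurable_fun D F2.
Proof.
apply: (@measurable_integral2 _ _ _ _ _ mu D D (fun tz : R * R =>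
  (tz.2 <= tz.1)%R%:R%:E * (h tz.2 * (U tz.2 `^ p^-1)%:E))) => //.
- apply: emeasurable_funM; last exact: (measurable_snd_rectangle mD mhU).
  apply/measurable_EFinP; apply: measurable_boolR.
  by apply: measurable_fun_ler; exact: measurable_funTS.
- by move=> t z _ /setDE z0; apply: mule_ge0 => //; exact: hU0.
Qed.

Let F10 (t : R) : 0 <= F1 t.
Proof. by apply: integral_ge0 => z /setDE z0; apply: mule_ge0 => //; exact: h0. Qed.

Let F20 (t : R) : 0 <= F2 t.
Proof. by apply: integral_ge0 => z /setDE z0; apply: mule_ge0 => //; exact: hU0. Qed.

Let cap_integral_le (t : R) : (0 < t)%R ->
  \int[mu]_(z in D) ((cap z t `^ p^-1)%:E * h z) <=
  F1 t + (U t `^ (- p^-1))%:E * F2 t.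
Proof.
move=> t0; have Ut := U0 t0.
have mlt : measurable_fun D (fun z : R => (t < z)%R%:R%:E * h z).
  apply: emeasurable_funM => //; apply/measurable_EFinP; apply: measurable_boolR.
  by apply: measurable_fun_ltr => //; exact: measurable_cst.
have mle : measurable_fun D (fun z : R =>
    (z <= t)%R%:R%:E * (h z * (U z `^ p^-1)%:E)).
  apply: emeasurable_funM => //; apply/measurable_EFinP; apply: measurable_boolR.
  by apply: measurable_fun_ler => //; exact: measurable_cst.
have Up : (0 <= U t `^ (- p^-1))%R by exact: powR_ge0.
rewrite -ge0_integralZl_EFin//; last first.
  by move=> z /setDE z0; apply: mule_ge0 => //; exact: hU0.
rewrite -ge0_integralD//; last 3 first.
- by move=> z /setDE z0; apply: mule_ge0 => //; exact: h0.
- by move=> z /setDE z0; do 2!apply: mule_ge0 => //; exact: hU0.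
- exact: measurable_funeM.
apply: ge0_le_integral => //.
- move=> z /setDE z0; apply: mule_ge0; last exact: h0.
  by rewrite lee_fin; exact: powR_ge0.
- apply: emeasurable_funM => //; apply/measurable_EFinP.
  exact: (measurable_section2 mD mD (setDI t0) (measurable_cap_powR p hu hU)).
- by apply: emeasurable_funD => //; exact: measurable_funeM.
- move=> z /setDE z0; have [tz|zt] := ltP t z.
    rewrite mul0e mule0 adde0 mul1e (cap1 hu hU t0 (ltW tz)) powR1 mul1e.
    exact: lexx.
  rewrite mul0e add0e mul1e muleCA -EFinM muleC.
  apply: lee_wpmul2l; first exact: h0.
  rewrite lee_fin (cap_quot hu hU t0 zt) powRM ?invr_ge0 ?(ltW Ut) ?(ltW (U0 _))//.
  by rewrite -[((U t)^-1)%R]powR_inv1 ?(ltW Ut)// -powRrM mulN1r mulrC.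
Qed.

(** 16 = 2 (4 + 4): the two parts cost 4 each and the quasi-triangle inequality 2. The power 1/q
    turns the exponent 1 - q of J into (1 - q) / q = 1/s, and 1/G <= v closes the estimate. *)
Lemma hardy_sufficiency_lt1 :
  hardy_lhs p q u w h <= (16 `^ q^-1)%:E * J `^ s^-1 *
    \int[mu]_(z in D) (h z * (v z)%:E).
Proof.
apply: (le_trans (hardy_lhs_le hp hq hu hU hw hh)).
have qV : (0 <= q^-1)%R by rewrite invr_ge0 ltW.
set F := fun t : R => \int[mu]_(z in D) ((cap z t `^ p^-1)%:E * h z).
have F0 (t : R) : 0 <= F t.
  apply: integral_ge0 => z /setDE z0; apply: mule_ge0; last exact: h0.
  by rewrite lee_fin; exact: powR_ge0.
have mF : measurable_fun D F by exact: (measurable_cap_integral p hu hU hh).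
have K0 : 0 <= K.
  apply: integral_ge0 => z /setDE z0; apply: mule_ge0; first exact: h0.
  by rewrite lee_fin invr_ge0; exact: ltW (G0 z0).
have J0 : 0 <= J.
  apply: integral_ge0 => x /setDE x0; rewrite lee_fin; apply: mulr_ge0; last exact: w0.
  by apply: mulr_ge0; exact: powR_ge0.
have mF1q : measurable_fun D (fun t => F1 t `^ q * (w t)%:E).
  apply: emeasurable_funM; last exact/measurable_EFinP.
  exact: (measurableT_comp (measurable_poweR q) mF1).
have mF2q : measurable_fun D (fun t => F2 t `^ q * (wd t)%:E).
  apply: emeasurable_funM; last exact/measurable_EFinP.
  exact: (measurableT_comp (measurable_poweR q) mF2).
have F1q0 t : D t -> 0 <= F1 t `^ q * (w t)%:E.
  by move=> /setDE t0; apply: mule_ge0; [exact: poweR_ge0|rewrite lee_fin; exact: w0].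
have F2q0 t : D t -> 0 <= F2 t `^ q * (wd t)%:E.
  by move=> /setDE t0; apply: mule_ge0; [exact: poweR_ge0|rewrite lee_fin; exact: wd0].
have intF : \int[mu]_(t in D) (F t `^ q * (w t)%:E) <= 16%:E * J `^ (1 - q) * K `^ q.
  apply: (@le_trans _ _ (\int[mu]_(t in D)
      (2%:E * (F1 t `^ q * (w t)%:E + F2 t `^ q * (wd t)%:E)))).
    apply: ge0_le_integral => //.
    - move=> t /setDE t0; apply: mule_ge0; first exact: poweR_ge0.
      by rewrite lee_fin; exact: w0.
    - apply: emeasurable_funM; last exact/measurable_EFinP.
      exact: (measurableT_comp (measurable_poweR q) mF).
    - by apply: measurable_funeM; exact: emeasurable_funD.
    - move=> t /setDE t0; have Ut := U0 t0.
      have Up : 0 <= (U t `^ (- p^-1))%:E by rewrite lee_fin; exact: powR_ge0.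
      have UF2 : 0 <= (U t `^ (- p^-1))%:E * F2 t by exact: mule_ge0.
      have q01' : (0 <= q <= 1)%R by rewrite !ltW.
      have -> : F1 t `^ q * (w t)%:E + F2 t `^ q * (wd t)%:E =
          (F1 t `^ q + ((U t `^ (- p^-1))%:E * F2 t) `^ q) * (w t)%:E.
        rewrite ge0_muleDl ?poweR_ge0//; congr (_ + _).
        rewrite poweRM// poweR_EFin -powRrM mulNr [(p^-1 * q)%R]mulrC powRN.
        by rewrite muleC -muleA [_ * (w t)%:E]muleC muleA -EFinM [(_ * w t)%R]mulrC.
      rewrite muleA; apply: lee_wpmul2r; first by rewrite lee_fin; exact: w0.
      apply: le_trans (poweRD_le2 q01' (F10 t) UF2).
      apply: (gt0_ler_poweR (ltW hq)); rewrite ?in_itv/= ?leey ?andbT//.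
        exact: adde_ge0.
      exact: cap_integral_le.
  rewrite ge0_integralZl_EFin//; last 2 first.
  - by move=> t Dt; rewrite adde_ge0 ?F1q0 ?F2q0.
  - exact: emeasurable_funD.
  rewrite ge0_integralD//.
  apply: le_trans (lee_wpmul2l (_ : 0 <= 2%:E) (leeD near_part far_part)) _ => //.
  rewrite -ge0_muleDl ?mule_ge0 ?poweR_ge0// -ge0_muleDl ?poweR_ge0//.
  rewrite !muleA -EFinD -EFinM.
  have -> : (2 * (4 + 4) = 16 :> R)%R by ring.
  exact: lexx.
have intF0 : 0 <= \int[mu]_(t in D) (F t `^ q * (w t)%:E).
  apply: integral_ge0 => t /setDE t0; apply: mule_ge0; first exact: poweR_ge0.
  by rewrite lee_fin; exact: w0.
apply: (@le_trans _ _ ((16%:E * J `^ (1 - q) * K `^ q) `^ q^-1)).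
  apply: (gt0_ler_poweR qV); rewrite ?in_itv/= ?leey ?andbT//.
  by rewrite !mule_ge0 ?poweR_ge0.
rewrite !poweRM ?mule_ge0 ?poweR_ge0// poweR_EFin -!poweRrM.
rewrite mulfV ?gt_eqF// poweRe1// -[((1 - q) * q^-1)%R]/((1 - q) / q)%R.
have -> : s^-1%R = ((1 - q) / q)%R by rewrite /s invf_div.
apply: lee_wpmul2l; first by rewrite mule_ge0 ?poweR_ge0// lee_fin powR_ge0.
apply: ae_ge0_le_integral => //.
- move=> z /setDE z0; apply: mule_ge0; first exact: h0.
  by rewrite lee_fin invr_ge0; exact: ltW (G0 z0).
- apply: emeasurable_funM => //; apply/measurable_EFinP.
  by apply: measurable_fun_invr_gt0 => // z /setDE; exact: G0.
- move=> z /setDE z0; apply: mule_ge0; first exact: h0.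
  by rewrite lee_fin; exact: v0.
- by apply: emeasurable_funM => //; exact/measurable_EFinP.
- apply: (@filterS _ _ (ae_filter_ringOfSetsType mu) _ _ _ Gv) => z H Dz.
  by apply: lee_wpmul2l; [exact: h0 (setDE Dz)|rewrite lee_fin H].
Qed.

End below_one.
End fixed_function.
End hardy_sufficiency.

(** * Necessity *)

Section hardy_necessity.
Context (R : realType) (u v w : R -> R) (p q : R).
Local Notation mu := (@lebesgue_measure R).
Local Notation D := (`]0%R, +oo[%classic : set R).
Local Notation U := (fine_primitive u).
Local Notation cap := (cap u).
Local Notation Phi := (Phi u w (q / p)).
Local Notation S := (weight_sup u v p).
Local Notation V t := (ess_sup_inv v `]t, +oo[).
Hypotheses (hp : (1 <= p)%R) (hq : (0 < q)%R).
Hypotheses (hu : weight u) (hU : admissible_wt (primitive_wt u)) (hw : weight w)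
  (hv : weight v) (hnd : nondegenerate_wrt (primitive_wt u) (q / p) w).

Let p0 : (0 < p)%R. Proof. exact: lt_le_trans hp. Qed.
Let r0 : (0 < q / p)%R. Proof. exact: divr_gt0. Qed.
Let mD : measurable D. Proof. exact: measurableD0. Qed.
Let mu_ : measurable_fun D u. Proof. by case: hu => -[]. Qed.
Let mw : measurable_fun D w. Proof. by case: hw => -[]. Qed.
Let mv : measurable_fun D v. Proof. by case: hv => -[]. Qed.
Let u0 (t : R) : (0 < t)%R -> (0 <= u t)%R. Proof. by case: hu => _; exact. Qed.
Let w0 (t : R) : (0 < t)%R -> (0 <= w t)%R. Proof. by case: hw => _; exact. Qed.
Let v0 (t : R) : (0 < t)%R -> (0 <= v t)%R. Proof. by case: hv => _; exact. Qed.
Let U0 (t : R) : (0 < t)%R -> (0 < U t)%R. Proof. exact: fine_primitive_gt0. Qed.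
Let Phi0 (t : R) : (0 < t)%R -> (0 < Phi t)%R. Proof. exact: Phi_gt0. Qed.

(** Discarding the points s >= z leaves a^p times the u-mass of (0, min(z, t)), which is a^p U(t)
    cap(z, t). *)
Lemma hardy_operator_ge (h : R -> \bar R) (z a t : R) : nonneg_measurable h ->
  (0 < z)%R -> (0 <= a)%R -> (0 < t)%R ->
  (forall s : R, (0 < s)%R -> (s < z)%R -> a%:E <= \int[mu]_(y in `]s, +oo[) h y) ->
  (a `^ q * cap z t `^ (q / p))%:E <= ((primitive_wt u t)^-1 *
    \int[mu]_(s in `]0%R, t[) ((\int[mu]_(y in `]s, +oo[) h y) `^ p * (u s)%:E))
    `^ (q / p).
Proof.
move=> hh z0 a0 t0 ha; have Ut := U0 t0.
have Dt (s : R) : `]0%R, t[%classic s -> (0 < s)%R.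
  by rewrite /= in_itv/= => /andP[].
have mDt : measurable (`]0%R, t[%classic : set R) by exact: measurable_itv.
have DtD : `]0%R, t[%classic `<=` D by apply: subset_itvl; rewrite bnd_simp.
have mut : measurable_fun (`]0%R, t[%classic : set R) u by exact: measurable_funS mu_.
have ap0 : (0 <= a `^ p)%R by exact: powR_ge0.
have -> : (a `^ q * cap z t `^ (q / p) = (a `^ p * cap z t) `^ (q / p))%R.
  rewrite powRM ?(ltW (cap_gt0 hu hU z0 t0))// -powRrM; congr (_ `^ _ * _)%R.
  by rewrite mulrCA divff ?gt_eqF// mulr1.
have I0 : 0 <= \int[mu]_(s in `]0%R, t[)
    ((\int[mu]_(y in `]s, +oo[) h y) `^ p * (u s)%:E).
  apply: integral_ge0 => s /Dt s0; apply: mule_ge0; first exact: poweR_ge0.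
  by rewrite lee_fin; exact: u0.
have tV : 0 <= (primitive_wt u t)^-1.
  by rewrite fine_primitiveE ?(ltW t0)// inve_ge0 lee_fin ltW.
rewrite -poweR_EFin; apply: (gt0_ler_poweR (ltW r0)).
- by rewrite in_itv/= leey andbT lee_fin mulr_ge0// ltW// cap_gt0.
- by rewrite in_itv/= leey andbT; exact: mule_ge0.
have -> : (a `^ p * cap z t)%:E =
    (primitive_wt u t)^-1 * ((a `^ p)%:E * (Num.min (U z) (U t))%:E).
  rewrite fine_primitiveE ?(ltW t0)// inver (gt_eqF Ut) -!EFinM; congr EFin.
  have -> : (cap z t = Num.min (U z) (U t) / U t)%R.
    rewrite cap.unlock minr_pMl ?invr_ge0 ?(ltW Ut)// divff ?gt_eqF//.
    by rewrite minC.
  by ring.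
apply: lee_wpmul2l => //; rewrite -(integral_weight_min hu hU t0 z0).
have mlt : measurable_fun (`]0%R, t[%classic : set R)
    (fun s : R => ((s < z)%R%:R * u s)%:E).
  apply/measurable_EFinP; apply: measurable_funM => //; apply: measurable_boolR.
  by apply: measurable_fun_ltr => //; exact: measurable_cst.
rewrite -ge0_integralZl_EFin//; last first.
  by move=> s /Dt s0; rewrite lee_fin; apply: mulr_ge0 => //; exact: u0.
apply: ge0_le_integral => //.
- move=> s /Dt s0; apply: mule_ge0 => //; rewrite lee_fin; apply: mulr_ge0 => //.
  exact: u0.
- exact: measurable_funeM.
- apply: emeasurable_funM; last exact/measurable_EFinP.
  apply: (measurableT_comp (measurable_poweR p)).
  exact: measurable_funS (measurable_tail_integral hh).
- move=> s /Dt s0; have [sz|_] := ltP s z; last first.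
    rewrite mul0r mule0; apply: mule_ge0; first exact: poweR_ge0.
    by rewrite lee_fin; exact: u0.
  rewrite mul1r; apply: lee_wpmul2r; first by rewrite lee_fin; exact: u0.
  rewrite -poweR_EFin; apply: (gt0_ler_poweR (ltW p0)); rewrite ?in_itv/= ?leey ?andbT//.
  + exact: (tail_integral_ge0 hh).
  + exact: ha.
Qed.

Variable c : R.
Hypotheses (c0 : (0 <= c)%R) (hc : hardy_ineq p q u v w c).

(* Test with [h = \sum_(i in Z) a i * \1_(E i) / mu (E i)], where [E i] is a set
   of finite measure in [(z i, +oo)] on which [1/v >= rho i]. *)
Lemma hardy_test_functions (I : finType) (Z : {set I}) (z rho a : I -> R)
    (f : R -> R) :
  (forall i, (0 < z i)%R) -> (forall i, (0 < rho i)%R) -> (forall i, (0 <= a i)%R) ->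
  (forall i, i \in Z -> (rho i)%:E < V (z i)) ->
  measurable_fun D f -> (forall t, (0 < t)%R -> (0 <= f t)%R) ->
  (forall t, (0 < t)%R -> (0 < f t)%R -> exists2 i, i \in Z &
    (f t <= a i `^ q * cap (z i) t `^ (q / p))%R) ->
  (\int[mu]_(t in D) (f t * w t)%:E) `^ q^-1 <=
    (c * \sum_(i in Z) a i / rho i)%:E.
Proof.
move=> z0 rho0 a0 rhoV mf f0 fle.
(* Indices outside Z receive the empty set, so that E is total and measurable; the sums below run
   over Z only. *)
have [E HE] : {E : I -> set R & forall i, measurable (E i) /\ (i \in Z -> [/\
    E i `<=` `]z i, +oo[%classic, 0 < mu (E i), mu (E i) < +oo &
    forall s, E i s -> (v s <= (rho i)^-1)%R])}.
  apply: (@choice _ _ (fun i E => measurable E /\ (i \in Z -> [/\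
    E `<=` `]z i, +oo[%classic, 0 < mu E, mu E < +oo &
    forall s, E s -> (v s <= (rho i)^-1)%R]))) => i.
  have [iZ|] := boolP (i \in Z); last by exists set0.
  have [E [? ? ? ? ?]] :=
    ess_sup_inv_witness mv (ltW (z0 i)) (rho0 i) (rhoV i iZ).
  by exists E.
have mEi i : measurable (E i) by case: (HE i).
pose m i := fine (mu (E i)).
have mE i : i \in Z -> (m i)%:E = mu (E i).
  by case: (HE i) => _ H /H[_ E0 Efin _]; rewrite fineK// gt0_fin_numE.
have m_gt0 i : i \in Z -> (0 < m i)%R.
  by move=> iZ; rewrite -lte_fin mE//; case: (HE i) => _ /(_ iZ)[].
have m0 i : (0 <= m i)%R by apply: fine_ge0; exact: measure_ge0.
have ED i : i \in Z -> E i `<=` D.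
  case: (HE i) => _ H /H[Ez _ _ _]; apply: (subset_trans Ez).
  by apply: subset_itvr; rewrite bnd_simp; exact: ltW.
pose k i (y : R) : R := (a i / m i * \1_(E i) y)%R.
have k0 i y : (0 <= k i y)%R by rewrite /k !mulr_ge0 ?invr_ge0.
have mk i A : measurable_fun A (k i).
  by apply: measurable_funM => //; exact: measurable_indic.
pose h (y : R) : \bar R := (\sum_(i <- enum Z) k i y)%:E.
have mh : measurable_fun D h.
  by apply/measurable_EFinP; apply: measurable_sum => i; exact: mk.
have hh : nonneg_measurable h.
  by split => // t _; rewrite lee_fin sumr_ge0.
have h_ge i y : i \in Z -> (k i y)%:E <= h y.
  move=> iZ; rewrite lee_fin /h big_enum/= (bigD1 i)//= lerDl.
  by apply: sumr_ge0 => j _; exact: k0.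
have tail i (s : R) : i \in Z -> (0 < s)%R -> (s < z i)%R ->
    (a i)%:E <= \int[mu]_(y in `]s, +oo[) h y.
  move=> iZ s0 sz; have mS : measurable (`]s, +oo[%classic : set R).
    exact: measurable_itv.
  have SD : `]s, +oo[%classic `<=` D.
    by apply: subset_itvr; rewrite bnd_simp; exact: ltW.
  apply: (@le_trans _ _ (\int[mu]_(y in `]s, +oo[) (k i y)%:E)).
    under eq_integral do rewrite EFinM.
    rewrite ge0_integralZl_EFin//; last 2 first.
    - by apply/measurable_EFinP; apply: measurable_indic; exact: mEi.
    - by rewrite divr_ge0.
    rewrite integral_indic//; last exact: mEi.
    have -> : E i `&` `]s, +oo[ = E i.
      apply/setIidPl; case: (HE i) => _ /(_ iZ)[Ez _ _ _]; apply: (subset_trans Ez).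
      by apply: subset_itvr; rewrite bnd_simp; exact: ltW.
    rewrite [X in _ * X](_ : _ = (m i)%:E); last by rewrite mE.
    by rewrite -EFinM divfK// gt_eqF// m_gt0.
  apply: ge0_le_integral => //.
  - by move=> y _; rewrite lee_fin.
  - by apply/measurable_EFinP; exact: mk.
  - exact: measurable_funS mh.
  - by move=> y _; exact: h_ge.
have cost : \int[mu]_(y in D) (h y * (v y)%:E) <= (\sum_(i in Z) a i / rho i)%:E.
  rewrite (_ : \int[mu]_(y in D) _ =
      \int[mu]_(y in D) \sum_(i <- enum Z) (k i y * v y)%:E); last first.
    by apply: eq_integral => y _; rewrite -EFinM mulr_suml sumEFin.
  have kv0 i y : D y -> 0 <= (k i y * v y)%:E.
    by move=> /setDE y0; rewrite lee_fin mulr_ge0// v0.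
  rewrite ge0_integral_sum//; last first.
    by move=> i; apply/measurable_EFinP; apply: measurable_funM => //; exact: mk.
  rewrite -sumEFin big_enum/=; apply: lee_sum => i iZ.
  apply: (@le_trans _ _ (\int[mu]_(y in D) ((a i / m i / rho i)%:E * (\1_(E i) y)%:E))).
    apply: ge0_le_integral => //.
    - by move=> y; exact: kv0.
    - by apply/measurable_EFinP; apply: measurable_funM => //; exact: mk.
    - apply: measurable_funeM; apply/measurable_EFinP; apply: measurable_indic.
      exact: mEi.
    - move=> y /setDE y0; rewrite -EFinM lee_fin /k -!mulrA.
      apply: ler_wpM2l; first exact: a0.
      apply: ler_wpM2l; first by rewrite invr_ge0.
      rewrite indicE; have [yE|_] := boolP (y \in E i).
        rewrite mul1r mulr1; case: (HE i) => _ /(_ iZ)[_ _ _ vE].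
        by apply: vE; exact: set_mem.
      by rewrite mul0r mulr0.
  rewrite ge0_integralZl_EFin//; last 2 first.
  - by apply/measurable_EFinP; apply: measurable_indic; exact: mEi.
  - by rewrite !divr_ge0// ltW.
  rewrite integral_indic//; last exact: mEi.
  have -> : E i `&` D = E i by apply/setIidPl; exact: ED.
  rewrite [X in _ * X](_ : _ = (m i)%:E); last by rewrite mE.
  rewrite -EFinM lee_fin mulrAC divfK//.
  by rewrite gt_eqF// m_gt0.
have := hc hh.
have qV : (0 <= q^-1)%R by rewrite invr_ge0 ltW.
move=> lhs_le; rewrite EFinM; apply: le_trans (lee_wpmul2l (_ : 0 <= c%:E) cost) => //.
apply: le_trans lhs_le; rewrite /hardy_lhs; apply: (gt0_ler_poweR qV).
- rewrite in_itv/= leey andbT; apply: integral_ge0 => t /setDE t0.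
  by rewrite lee_fin mulr_ge0 ?f0 ?w0.
- rewrite in_itv/= leey andbT; apply: integral_ge0 => t /setDE t0.
  exact: hardy_integrand_ge0.
apply: ge0_le_integral => //.
- by move=> t /setDE t0; rewrite lee_fin mulr_ge0 ?f0 ?w0.
- by apply/measurable_EFinP; exact: measurable_funM.
- exact: measurable_hardy_integrand.
- move=> t /setDE t0; rewrite EFinM; apply: lee_wpmul2r.
    by rewrite lee_fin w0.
  (* Since h dominates each of its terms, a single index controlling f t suffices; where f vanishes
     none is provided and none is needed. *)
  have := f0 t t0; rewrite le_eqVlt => /predU1P[<-|ft0]; first exact: poweR_ge0.
  have [i iZ fi] := fle t t0 ft0.
  apply: (@le_trans _ _ (a i `^ q * cap (z i) t `^ (q / p))%:E); first by rewrite lee_fin.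
  by apply: hardy_operator_ge => // s s0 sz; exact: tail.
Qed.

(** Test with one bump of unit mass beyond t: its image controls cap(t, .)^(q/p), whose w-integral
    is Phi t, and its cost is at most 1 / rho. *)
Lemma Phi_powR_le (t rho : R) : (0 < t)%R -> (0 < rho)%R -> rho%:E < V t ->
  (Phi t `^ q^-1 * rho <= c)%R.
Proof.
move=> t0 rho0 rhoV.
have := @hardy_test_functions unit finset.setT (fun=> t) (fun=> rho) (fun=> 1%R)
  (fun x => cap t x `^ (q / p))%R.
move=> /(_ (fun=> t0) (fun=> rho0) (fun=> ler01) (fun _ _ => rhoV)).
have mcap : measurable_fun D (fun x => cap t x `^ (q / p))%R.
  exact: (measurableT_comp (measurable_powR _) (measurable_capr hu hU t)).
move=> /(_ mcap (fun _ _ => powR_ge0 _ _)); rewrite -/(fundamental u w (q / p) t).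
rewrite (PhiE hu hU hw r0 hnd t0) poweR_EFin lee_fin.
rewrite (eq_bigl xpredT) => [|i]; last by rewrite !inE.
rewrite big_const card_unit/= addr0 div1r -ler_pdivrMr ?invr_gt0// invrK; apply.
by move=> x x0 _; exists tt; rewrite ?inE// powR1 mul1r.
Qed.

(** [Phi_powR_le] bounds V t by c Phi(t)^(-1/q), and [Phi_cap] moves this bound from t to x. A real
    rho below V t is inserted because V t is not yet known to be finite; finiteness of S follows
    from this lemma. *)
Lemma weight_sup_le (x : R) : (0 < x)%R ->
  S x <= (c * U x `^ p^-1 / Phi x `^ q^-1)%:E.
Proof.
move=> x0; have Px := Phi0 x0; have Ux := U0 x0.
have Pq : (0 < Phi x `^ q^-1)%R by exact: powR_gt0.
rewrite (weight_supE _ _ hu hU); apply: ge_ereal_sup => _ [t tx <-].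
move: tx; rewrite /= in_itv/= => /andP[t0 tx]; have Ut := U0 t0.
have Upt : (0 < U t `^ p^-1)%R by exact: powR_gt0.
have Upx : (0 < U x `^ p^-1)%R by exact: powR_gt0.
set b := (c * (U x `^ p^-1 / U t `^ p^-1) / Phi x `^ q^-1)%R.
have b0 : (0 <= b)%R by rewrite /b !mulr_ge0 ?invr_ge0 ?(ltW Upt) ?(ltW Upx) ?(ltW Pq).
suff Vb : V t <= b%:E.
  apply: (le_trans (lee_wpmul2l _ Vb)); first by rewrite lee_fin ltW.
  rewrite -EFinM lee_fin /b le_eqVlt; apply/predU1P; left.
  by field; rewrite !gt_eqF.
rewrite leNgt; apply/negP => bV.
have [rho /andP[brho rhoV]] : exists rho : R, (b < rho)%R && (rho%:E < V t).
  move: bV; case: (V t) => [n||//]; last by exists (b + 1)%R; rewrite ltrDl ltr01 ltry.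
  by rewrite lte_fin => bn; exists ((b + n) / 2)%R; rewrite lte_fin midf_lt// midf_lt.
have rho0 : (0 < rho)%R by exact: le_lt_trans brho.
have := Phi_powR_le t0 rho0 rhoV; rewrite leNgt => /negP; apply.
have Pt := Phi0 t0.
have : (U t `^ p^-1 / U x `^ p^-1 * Phi x `^ q^-1 <= Phi t `^ q^-1)%R.
  have := Phi_cap hu hU hw r0 hnd t0 x0.
  have Pcap : (0 <= cap t x `^ (q / p) * Phi x)%R by rewrite mulr_ge0 ?powR_ge0// ltW.
  move=> /(ge0_ler_powR (_ : 0 <= q^-1)%R).
  rewrite !nnegrE invr_ge0 (ltW hq) Pcap (ltW Pt).
  move=> /(_ isT isT isT); rewrite powRM ?powR_ge0 ?(ltW Px)// -powRrM.
  have -> : (q / p * q^-1 = p^-1)%R by rewrite mulrAC divff ?gt_eqF// mul1r.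
  rewrite (cap_quot hu hU x0 (ltW tx)) powRM ?invr_ge0 ?(ltW Ut) ?(ltW Ux)//.
  by rewrite -[((U x)^-1)%R]powR_inv1 ?(ltW Ux)// -powRrM mulN1r powRN.
move=> H; apply: (@lt_le_trans _ _ (U t `^ p^-1 / U x `^ p^-1 * Phi x `^ q^-1 * rho)%R).
  have c_eq : (c = U t `^ p^-1 / U x `^ p^-1 * Phi x `^ q^-1 * b)%R.
    by rewrite /b; field; rewrite !gt_eqF.
  by rewrite [ltLHS]c_eq ltr_pM2l// !mulr_gt0 ?invr_gt0.
by rewrite ler_wpM2r// ltW.
Qed.

End hardy_necessity.

(** Brings a bump into the form min(b, e y) of [sparse_subset], with y = U(t)^(-r) carrying all the
    dependence on t. *)
Lemma cap_powR_min (R : realType) (u : R -> R) (r b z t : R) :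
  weight u -> admissible_wt (primitive_wt u) -> (0 <= r)%R -> (0 <= b)%R ->
  (0 < z)%R -> (0 < t)%R -> (b * cap u z t `^ r =
    Num.min b (b * fine_primitive u z `^ r * (fine_primitive u t `^ r)^-1))%R.
Proof.
move=> hu hU r0 b0 z0 t0.
have Uz := fine_primitive_gt0 hu hU z0; have Ut := fine_primitive_gt0 hu hU t0.
have qE : ((fine_primitive u z / fine_primitive u t) `^ r =
    fine_primitive u z `^ r * (fine_primitive u t `^ r)^-1)%R.
  rewrite powRM ?invr_ge0 ?(ltW Uz) ?(ltW Ut)//; congr (_ * _)%R.
  by rewrite -powR_inv1 ?(ltW Ut)// -powRrM mulN1r powRN.
rewrite -mulrA -qE -[X in Num.min X _]mulr1 -minr_pMr//; congr (_ * _)%R.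
have q0 : (0 <= fine_primitive u z / fine_primitive u t)%R.
  by rewrite divr_ge0 ?(ltW Uz) ?(ltW Ut).
rewrite cap.unlock; have [h1|h1] := leP 1%R (fine_primitive u z / fine_primitive u t)%R.
  rewrite powR1; apply/esym/min_idPl.
  have -> : (1 = 1 `^ r :> R)%R by rewrite powR1.
  by apply: ge0_ler_powR; rewrite ?nnegrE.
apply/esym/min_idPr; have -> : (1 = 1 `^ r :> R)%R by rewrite powR1.
by apply: ge0_ler_powR; rewrite ?nnegrE// ltW.
Qed.

Lemma measurable_bigmaxr d (T : measurableType d) (R : realType) (I : Type)
    (A : set T) (r : seq I) (P : pred I) (f : I -> T -> R) :
  (forall i, measurable_fun A (f i)) ->
  measurable_fun A (fun t => \big[Num.max/0%R]_(i <- r | P i) f i t).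
Proof.
move=> mf; elim: r => [|i r IH].
  by under eq_fun do rewrite big_nil; exact: measurable_cst.
under eq_fun do rewrite big_cons; case: (P i) => //.
exact: measurable_maxr.
Qed.

(** * The lower bound for q < 1: maxima of bumps *)

Section hardy_necessity_lt1.
Context (R : realType) (u v w : R -> R) (p q : R).
Local Notation mu := (@lebesgue_measure R).
Local Notation D := (`]0%R, +oo[%classic : set R).
Local Notation U := (fine_primitive u).
Local Notation cap := (cap u).
Local Notation Phi := (Phi u w (q / p)).
Local Notation V t := (ess_sup_inv v `]t, +oo[).
Hypotheses (hp : (1 <= p)%R) (hq : (0 < q)%R) (q1 : (q < 1)%R).
Hypotheses (hu : weight u) (hU : admissible_wt (primitive_wt u)) (hw : weight w)
  (hv : weight v) (hnd : nondegenerate_wrt (primitive_wt u) (q / p) w).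
Variable c : R.
Hypotheses (c0 : (0 <= c)%R) (hc : hardy_ineq p q u v w c).

Let s := (q / (1 - q))%R.
Let p0 : (0 < p)%R. Proof. exact: lt_le_trans hp. Qed.
Let q1' : (0 < 1 - q)%R. Proof. by rewrite subr_gt0. Qed.
Let s0 : (0 < s)%R. Proof. exact: divr_gt0. Qed.
Let r0 : (0 < q / p)%R. Proof. exact: divr_gt0. Qed.
Let mD : measurable D. Proof. exact: measurableD0. Qed.
Let mw : measurable_fun D w. Proof. by case: hw => -[]. Qed.
Let w0 (t : R) : (0 < t)%R -> (0 <= w t)%R. Proof. by case: hw => _; exact. Qed.
Let U0 (t : R) : (0 < t)%R -> (0 < U t)%R. Proof. exact: fine_primitive_gt0. Qed.
Let Phi0 (t : R) : (0 < t)%R -> (0 < Phi t)%R. Proof. exact: Phi_gt0. Qed.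

(* The [q]-th power of the image of a mass [(rho * Phi z)^(s/q)] at [z]. With
   this mass, the cost [(rho * Phi z)^(s/q) / rho] equals the [w]-integral of
   the bump. *)
Let bump (z rho t : R) := ((rho * Phi z) `^ s * cap z t `^ (q / p))%R.

Let bump_ge0 z rho t : (0 <= bump z rho t)%R.
Proof. by rewrite mulr_ge0 ?powR_ge0. Qed.

Let mbump z rho : measurable_fun D (bump z rho).
Proof.
apply: measurable_funM => //.
exact: (measurableT_comp (measurable_powR _) (measurable_capr hu hU z)).
Qed.

Let mbumpw z rho : measurable_fun D (fun t => (bump z rho t * w t)%:E).
Proof. by apply/measurable_EFinP; apply: measurable_funM => //; exact: mbump. Qed.

Let bumpw_ge0 z rho t : D t -> 0 <= (bump z rho t * w t)%:E.
Proof. by move=> /setDE t0; rewrite lee_fin mulr_ge0 ?w0. Qed.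

Let bump_integral z rho : (0 < z)%R ->
  \int[mu]_(t in D) (bump z rho t * w t)%:E = ((rho * Phi z) `^ s * Phi z)%:E.
Proof.
move=> z0; rewrite EFinM -(PhiE hu hU hw r0 hnd z0) /fundamental.
rewrite -ge0_integralZl_EFin ?powR_ge0//; first last.
- apply/measurable_EFinP; apply: measurable_funM => //.
  exact: (measurableT_comp (measurable_powR _) (measurable_capr hu hU z)).
- by move=> t /setDE t0; rewrite lee_fin mulr_ge0 ?w0 ?powR_ge0.
by apply: eq_integral => t _; rewrite -EFinM /bump mulrA.
Qed.

(** Cancelling one power of Y leaves Y^(1/q - 1) <= k, and 1/q - 1 = 1/s. *)
Let lt_le_powR (Y k : R) : (0 <= Y)%R -> (0 <= k)%R ->
  (Y `^ q^-1 <= k * Y)%R -> (Y <= k `^ s)%R.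
Proof.
rewrite le_eqVlt => /predU1P[<- _ _|Y0 k0 H]; first exact: powR_ge0.
have sV : (q^-1 - 1 = s^-1)%R by rewrite /s; field; rewrite !gt_eqF.
have Yk : (Y `^ s^-1 <= k)%R.
  by rewrite -sV powRDgt0// powR_inv1 ?(ltW Y0)// ler_pdivrMr.
have -> : Y = ((Y `^ s^-1) `^ s)%R by rewrite -powRrM mulVf ?gt_eqF// powRr1// ltW.
by apply: ge0_ler_powR; rewrite ?nnegrE ?powR_ge0 ?(ltW s0).
Qed.

(** On the thinned family Z' the integrals Y of the maximum and N of the sum satisfy Y <= N <= 4 Y.
    The cost of the test function is N, so Y^(1/q) <= c N <= 4 c Y and [lt_le_powR] applies. The
    outer factor 2 is the loss of the maximum in passing from Z to Z'. *)
Lemma bump_max_integral_le (I : finType) (Z : {set I}) (z rho : I -> R) :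
  (forall i, (0 < z i)%R) -> (forall i, (0 < rho i)%R) ->
  (forall i, i \in Z -> (rho i)%:E < V (z i)) ->
  \int[mu]_(t in D) ((\big[Num.max/0%R]_(i in Z) bump (z i) (rho i) t) * w t)%:E <=
    (2 * (4 * c) `^ s)%:E.
Proof.
move=> z0 rho0 rhoV.
pose b i := ((rho i * Phi (z i)) `^ s)%R.
pose e i := (b i * U (z i) `^ (q / p))%R.
pose f i t := bump (z i) (rho i) t.
have rP i : (0 < rho i * Phi (z i))%R by rewrite mulr_gt0 ?Phi0.
have b0 i : (0 < b i)%R by exact: powR_gt0.
have e0 i : (0 < e i)%R by rewrite mulr_gt0 ?powR_gt0 ?U0.
have fE i t : (0 < t)%R -> f i t = Num.min (b i) (e i * (U t `^ (q / p))^-1)%R.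
  by move=> t0; exact: cap_powR_min hu hU (ltW r0) (ltW (b0 i)) (z0 i) t0.
have [Z' [Z'Z dom sparse]] := @sparse_subset R I b e Z b0 e0.
pose F (A : {set I}) t := \big[Num.max/0%R]_(i in A) f i t.
have F0 A t : (0 <= F A t)%R by exact: bigmax_ge_id.
have mF A : measurable_fun D (F A) by apply: measurable_bigmaxr => i; exact: mbump.
have mFw A : measurable_fun D (fun t => (F A t * w t)%:E).
  by apply/measurable_EFinP; exact: measurable_funM.
have Fw0 A t : D t -> 0 <= (F A t * w t)%:E.
  by move=> /setDE t0; rewrite lee_fin mulr_ge0 ?w0.
have FZ t : (0 < t)%R -> (F Z t <= 2 * F Z' t)%R.
  move=> t0; apply/bigmax_leP; split => [|i iZ]; first by rewrite mulr_ge0.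
  have [j jZ' [bj ej]] := dom i iZ.
  apply: (@le_trans _ _ (2 * f j t)%R); last first.
    by rewrite ler_pM2l//; exact: le_bigmax_cond.
  rewrite !fE// minr_pMr// le_min; apply/andP; split.
    by rewrite ge_min bj.
  rewrite ge_min mulrA; apply/orP; right; apply: ler_wpM2r => //.
  by rewrite invr_ge0 powR_ge0.
have sumF t : (0 < t)%R -> (\sum_(i in Z') f i t <= 4 * F Z' t)%R.
  move=> t0; under eq_bigr do rewrite (fE _ _ t0).
  apply: sparse => [||i iZ'].
  - by rewrite invr_gt0 powR_gt0 ?U0.
  - exact: F0.
  - by rewrite -fE//; exact: le_bigmax_cond.
pose N := (\sum_(i in Z') b i * Phi (z i))%R.
have NE : N%:E = \int[mu]_(t in D) ((\sum_(i in Z') f i t) * w t)%:E.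
  rewrite /N -sumEFin.
  under eq_bigr => i _ do rewrite -(bump_integral (rho i) (z0 i)).
  rewrite -big_enum/= -ge0_integral_sum//; last 2 first.
  - by move=> i; exact: mbumpw.
  - by move=> i t; exact: bumpw_ge0.
  by apply: eq_integral => t _; rewrite -big_enum/= mulr_suml sumEFin.
set Y := \int[mu]_(t in D) (F Z' t * w t)%:E.
have Y0 : 0 <= Y by apply: integral_ge0 => t Dt; exact: Fw0.
have NY : N%:E <= 4%:E * Y.
  rewrite NE /Y -ge0_integralZl_EFin//; last 2 first.
- by move=> t; exact: Fw0.
- exact: mFw.
  apply: ge0_le_integral => //.
  - move=> t /setDE t0; rewrite lee_fin mulr_ge0 ?w0// sumr_ge0// => i _.
    exact: bump_ge0.
  - apply/measurable_EFinP; apply: measurable_funM => //.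
    have : measurable_fun D (fun t => \sum_(i <- enum Z') f i t)%R.
      by apply: measurable_sum => i; exact: mbump.
    by apply: eq_measurable_fun => t _; rewrite big_enum.
  - by apply: measurable_funeM; exact: mFw.
  - move=> t /setDE t0; rewrite -EFinM lee_fin mulrA; apply: ler_wpM2r; first exact: w0.
    exact: sumF.
have YN : Y <= N%:E.
  rewrite NE; apply: ge0_le_integral => //.
  - by move=> t; exact: Fw0.
  - exact: mFw.
  - apply/measurable_EFinP; apply: measurable_funM => //.
    have : measurable_fun D (fun t => \sum_(i <- enum Z') f i t)%R.
      by apply: measurable_sum => i; exact: mbump.
    by apply: eq_measurable_fun => t _; rewrite big_enum.
  - move=> t /setDE t0; rewrite lee_fin; apply: ler_wpM2r; first exact: w0.
    apply/bigmax_leP; split => [|i iZ]; first by apply: sumr_ge0 => i _; exact: bump_ge0.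
    by rewrite (bigD1 i)//= lerDl; apply: sumr_ge0 => j _; exact: bump_ge0.
(* Finiteness of the family enters here: Y <= N is a finite number and may be cancelled. *)
have [y y0 YE] : exists2 y : R, (0 <= y)%R & Y = y%:E.
  exists (fine Y); first exact: fine_ge0.
  by rewrite fineK// ge0_fin_numE//; apply: le_lt_trans YN _; exact: ltry.
have aE i : ((b i `^ q^-1) `^ q = b i)%R.
  by rewrite -powRrM mulVf ?gt_eqF// powRr1// ltW.
have aD i : (b i `^ q^-1 / rho i = b i * Phi (z i))%R.
  have -> : (b i `^ q^-1 = b i * (rho i * Phi (z i)))%R.
    have rPi := rP i.
    rewrite /b -powRrM.
    have -> : (s / q = s + 1)%R by rewrite /s; field; rewrite !gt_eqF.
    by rewrite powRDgt0 ?powRr1 ?(ltW rPi).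
  by have := rho0 i => /lt0r_neq0 rhoi; field.
have test := @hardy_test_functions _ _ v _ _ _ hp hq hu hU hw hv c c0 hc I Z' z rho
  (fun i => b i `^ q^-1)%R (F Z') z0 rho0 (fun i => powR_ge0 _ _).
have {test} : Y `^ q^-1 <= (c * N)%:E.
  rewrite /N -(eq_bigr _ (fun i _ => aD i)); apply: test => //.
  - by move=> i /(fintype.subsetP Z'Z)/rhoV.
  - move=> t t0 Ft0.
    have [j jZ'] : exists j, j \in Z'.
      have [/eqP Z0|/set0Pn//] := boolP (Z' == finset.set0).
      by move: Ft0; rewrite /F Z0 big_pred0 ?ltxx// => i; rewrite inE.
    have [i iZ' FE] := @eq_bigmax _ R I 0%R j (mem Z') (f ^~ t) jZ'
      (fun i _ => bump_ge0 (z i) (rho i) t).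
    by exists i => //; rewrite aE /F FE.
rewrite YE poweR_EFin lee_fin => yN.
have {}yN : (y <= (4 * c) `^ s)%R.
  apply: lt_le_powR => //; first by rewrite mulr_ge0.
  apply: (le_trans yN); rewrite [(4 * c)%R]mulrC -mulrA; apply: ler_wpM2l => //.
  by move: NY; rewrite YE -EFinM lee_fin.
apply: (@le_trans _ _ (2%:E * Y)); last by rewrite YE -EFinM lee_fin ler_pM2l.
rewrite /Y -ge0_integralZl_EFin//; last 2 first.
- by move=> t; exact: Fw0.
- exact: mFw.
apply: ge0_le_integral => //.
- by move=> t; exact: Fw0.
- exact: mFw.
- by apply: measurable_funeM; exact: mFw.
- move=> t /setDE t0; rewrite -EFinM lee_fin mulrA; apply: ler_wpM2r; first exact: w0.
  exact: FZ.
Qed.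

Let S_fin (x : R) : (0 < x)%R -> weight_sup u v p x < +oo.
Proof.
move=> x0; have := weight_sup_le hp hq hu hU hw hv hnd c0 hc x0.
by move=> /le_lt_trans; apply; exact: ltry.
Qed.

(** [Phi_cap] replaces Phi a by cap(a, x)^(q/p) Phi x. With the factor already present in the bump,
    the total exponent of cap(a, x) is (q/p) s + q/p = s/p, exactly what k <= rho cap(a, x)^(1/p)
    absorbs. *)
Let bump_ge (a rho x k : R) : (0 < a)%R -> (a < x)%R -> (0 < rho)%R -> (0 <= k)%R ->
  (k * U x `^ p^-1 < rho * U a `^ p^-1)%R ->
  (Phi x `^ s * k `^ s <= bump a rho x)%R.
Proof.
move=> a0 ax rho0 k0 kU; have x0 := lt_trans a0 ax.
have Ux := U0 x0; have Ua := U0 a0; have Px := Phi0 x0; have Pa := Phi0 a0.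
have cap0 := cap_gt0 hu hU a0 x0.
have k_le : (k <= rho * cap a x `^ p^-1)%R.
  have -> : (cap a x `^ p^-1 = U a `^ p^-1 / U x `^ p^-1)%R.
    rewrite (cap_quot hu hU x0 (ltW ax)) powRM ?invr_ge0 ?(ltW Ua) ?(ltW Ux)//.
    by rewrite -[((U x)^-1)%R]powR_inv1 ?(ltW Ux)// -powRrM mulN1r powRN.
  by rewrite mulrA ler_pdivlMr ?powR_gt0// ltW.
have -> : (bump a rho x = (rho * Phi a) `^ s * cap a x `^ (q / p))%R by [].
apply: (@le_trans _ _ ((rho * (cap a x `^ (q / p) * Phi x)) `^ s * cap a x `^ (q / p))%R);
    last first.
  apply: ler_wpM2r; first exact: powR_ge0.
  have H := Phi_cap hu hU hw r0 hnd a0 x0.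
  apply: ge0_ler_powR; rewrite ?nnegrE ?(ltW s0)// ?ler_wpM2l ?mulr_ge0 ?powR_ge0//;
    exact: ltW.
have -> : ((rho * (cap a x `^ (q / p) * Phi x)) `^ s * cap a x `^ (q / p) =
    Phi x `^ s * (rho * cap a x `^ p^-1) `^ s)%R.
  rewrite !powRM ?mulr_ge0 ?powR_ge0 ?(ltW rho0) ?(ltW Px)// -!powRrM.
  have <- : (q / p * s + q / p = p^-1 * s)%R.
    by rewrite /s; field; rewrite !gt_eqF.
  by rewrite powRDgt0//; ring.
apply: ler_wpM2l; first exact: powR_ge0.
by apply: ge0_ler_powR; rewrite ?nnegrE ?(ltW s0)// mulr_ge0 ?powR_ge0 ?(ltW rho0).
Qed.

Lemma profile_integral_le :
  \int[mu]_(x in D) (Phi x `^ s * profile u v p x `^ s * w x)%:E <=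
    (2 * (4 * c) `^ s)%:E.
Proof.
pose valid (ar : rat * rat) := [&& (0 < ratr ar.1 :> R)%R, (0 < ratr ar.2 :> R)%R &
  (ratr ar.2)%:E < V (ratr ar.1 : R)].
(* Codes without a valid pair are sent to (1, 1), which keeps both coordinates positive for all n;
   [ok] discards this pair too when it is not valid. *)
pose pt n : rat * rat :=
  if unpickle n is Some ar then if valid ar then ar else (1, 1)%R else (1, 1)%R.
pose ok n := valid (pt n).
pose z n : R := ratr (pt n).1; pose rho n : R := ratr (pt n).2.
have pt0 n : (0 < z n)%R /\ (0 < rho n)%R.
  rewrite /z /rho /pt; case: (unpickle n) => [ar|]; last by rewrite rmorph1.
  by case: ifPn => [/and3P[]//|_]; rewrite rmorph1.
pose F n t := \big[Num.max/0%R]_(i < n | ok i) bump (z i) (rho i) t.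
have F0 n t : (0 <= F n t)%R by exact: bigmax_ge_id.
have mFw n : measurable_fun D (fun t => (F n t * w t)%:E).
  apply/measurable_EFinP; apply: measurable_funM => //.
  by apply: measurable_bigmaxr => i; exact: mbump.
have Fw0 n t : D t -> 0 <= (F n t * w t)%:E.
  by move=> /setDE t0; rewrite lee_fin mulr_ge0 ?w0.
have Fnd t : D t -> {homo (fun n => (F n t * w t)%:E) : m n / (m <= n)%N >-> m <= n}.
  move=> /setDE t0 m n mn; rewrite lee_fin; apply: ler_wpM2r; first exact: w0.
  exact: (@le_bigmax_ord _ _ 0%R m n ok (fun i => bump (z i) (rho i) t)).
have Fle n : \int[mu]_(t in D) (F n t * w t)%:E <= (2 * (4 * c) `^ s)%:E.
  have := @bump_max_integral_le _ [set i : 'I_n | ok i]%SET (fun i => z i)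
    (fun i => rho i) (fun i => (pt0 i).1) (fun i => (pt0 i).2).
  under eq_integral do under eq_bigl do rewrite inE.
  by apply => i; rewrite inE => /and3P[].
pose L t := limn (fun n => (F n t * w t)%:E).
have cvgL t : D t -> (fun n => (F n t * w t)%:E) @ \oo --> L t.
  by move=> Dt; apply: ereal_nondecreasing_is_cvgn; exact: Fnd.
have mL : measurable_fun D L by apply: emeasurable_fun_cvg mFw _ => t; exact: cvgL.
have T0 x : D x -> 0 <= (Phi x `^ s * profile u v p x `^ s * w x)%:E.
  by move=> /setDE x0; rewrite lee_fin !mulr_ge0 ?powR_ge0 ?w0.
apply: (@le_trans _ _ (\int[mu]_(x in D) L x)); last first.
  rewrite monotone_convergence//.
  apply: lime_le; last by apply: nearW => n; exact: Fle.
  apply: ereal_nondecreasing_is_cvgn => m n mn; apply: ge0_le_integral => //.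
  - by move=> t; exact: Fw0.
  - exact: mFw.
  - exact: mFw.
  - by move=> t Dt; exact: Fnd.
apply: ge0_le_integral => //.
  apply/measurable_EFinP; apply: measurable_funM => //; apply: measurable_funM.
    exact: (measurableT_comp (measurable_powR _) (measurable_Phi _ hu hU hw)).
  exact: (measurableT_comp (measurable_powR _) (measurable_profile hu hU hv S_fin)).
move=> x Dx; apply/lee_mul01Pr => [|eta /andP[eta0 eta1]]; first exact: T0.
have x0 := setDE Dx; have Gx := profile_gt0 hu hU hv S_fin x0.
(* A loss eta on the integrand is a loss th on the profile, as th^s = eta. Since th < 1, the reduced
   value lies strictly below the profile and some rational bump exceeds it. *)
pose th := (eta `^ s^-1)%R.
have th0 : (0 <= th)%R by exact: powR_ge0.
have thE : (th `^ s = eta)%R by rewrite /th -powRrM mulVf ?gt_eqF// powRr1// ltW.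
have th1 : (th < 1)%R.
  have <- : (1 `^ s^-1 = 1 :> R)%R by rewrite powR1.
  by apply: gt0_ltr_powR; rewrite ?nnegrE ?invr_gt0// ltW.
have kG : (th * profile u v p x < profile u v p x)%R by rewrite gtr_pMl.
have k0 : (0 <= th * profile u v p x)%R by rewrite mulr_ge0// ltW.
have [a [b [a0 ax b0 bV kU]]] := profile_rat_approx p0 hu hU hv S_fin x0 k0 kG.
have := bump_ge a0 ax b0 k0 kU; rewrite powRM ?(ltW Gx)// thE => H.
pose n := pickle (a, b).
have ptE : pt n = (a, b) by rewrite /pt /n pickleK /valid/= a0 b0 bV.
have okn : ok n by rewrite /ok ptE /valid/= a0 b0 bV.
apply: (@le_trans _ _ (F n.+1 x * w x)%:E).
  rewrite -EFinM lee_fin mulrA; apply: ler_wpM2r; first exact: w0.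
  apply: (@le_trans _ _ (bump (z n) (rho n) x)).
    by rewrite /z /rho ptE/=; apply: le_trans H; rewrite mulrCA mulrA.
  exact: (@le_bigmax_cond _ _ _ 0%R ord_max (fun i : 'I_n.+1 => ok i)
    (fun i : 'I_n.+1 => bump (z i) (rho i) x)).
apply: lime_ge; first by apply: ereal_nondecreasing_is_cvgn; exact: Fnd.
by exists n.+1 => // m /= nm; exact: Fnd.
Qed.

End hardy_necessity_lt1.

(** * The characterization *)

(** When I is finite, K I competes in the infimum; in all cases I / L is below every admissible
    constant. The infimum +oo of the empty set covers an infinite I. *)
Lemma best_constant_approx (R : realType) (p q : R) (u v w : R -> R) (I : \bar R)
    (K L l : R) : (0 < l)%R -> (0 <= K <= l)%R -> (0 < L <= l)%R -> 0 <= I ->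
  (forall c : R, (0 <= c)%R -> hardy_ineq p q u v w c -> I <= (L * c)%:E) ->
  (forall c : R, (0 <= c)%R -> I <= c%:E -> hardy_ineq p q u v w (K * c)) ->
  ((exists c : R, (0 <= c)%R /\ hardy_ineq p q u v w c) <-> I < +oo) /\
  approx_by l (best_constant p q u v w) I.
Proof.
move=> l0 /andP[K0 Kl] /andP[L0 Ll] I0 nec suf.
have best0 : 0 <= best_constant p q u v w.
  by apply: le_ereal_inf_tmp => _ [c [c0 _] <-]; rewrite lee_fin.
have fineI : I < +oo -> (0 <= fine I)%R /\ (fine I)%:E = I.
  by move=> Ioo; rewrite fine_ge0// fineK// ge0_fin_numE.
split; first split.
- move=> [c [c0 hc]]; apply: le_lt_trans (nec c c0 hc) _; exact: ltry.
- move=> /fineI[f0 fE]; exists (K * fine I)%R; split; first exact: mulr_ge0.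
  by apply: suf => //; rewrite fE.
split.
- have [Ioo|] := ltP I +oo; last by rewrite leye_eq => /eqP ->; exact: leey.
  have [f0 fE] := fineI Ioo.
  rewrite lee_pdivrMl// -fE -EFinM.
  apply: (@le_trans _ _ (K * fine I)%:E); last by rewrite lee_fin ler_wpM2r.
  apply: ereal_inf_lbound; exists (K * fine I)%R => //; split; first exact: mulr_ge0.
  by apply: suf => //; rewrite fE.
- apply: (@le_trans _ _ (L%:E * best_constant p q u v w)); last first.
    by apply: lee_wpmul2r; rewrite ?lee_fin.
  rewrite -lee_pdivrMl//; apply: le_ereal_inf_tmp => _ [c [c0 hc] <-].
  by rewrite lee_pdivrMl// -EFinM; exact: nec.
Qed.

Section characterization.
Context (R : realType) (u v w : R -> R) (p q : R).
Local Notation mu := (@lebesgue_measure R).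
Local Notation D := (`]0%R, +oo[%classic : set R).
Local Notation U := (fine_primitive u).
Local Notation Phi := (Phi u w (q / p)).
Local Notation S := (weight_sup u v p).
Local Notation G := (profile u v p).
Local Notation avg x := (\int[mu]_(t in D)
  (Uquot (primitive_wt u) x t `^ (q / p) * (w t)%:E)).
Hypotheses (hp : (1 <= p)%R) (hq : (0 < q)%R).
Hypotheses (hu : weight u) (hU : admissible_wt (primitive_wt u)) (hw : weight w)
  (hv : weight v) (hnd : nondegenerate_wrt (primitive_wt u) (q / p) w).

Let p0 : (0 < p)%R. Proof. exact: lt_le_trans hp. Qed.
Let r0 : (0 < q / p)%R. Proof. exact: divr_gt0. Qed.
Let mD : measurable D. Proof. exact: measurableD0. Qed.
Let mw : measurable_fun D w. Proof. by case: hw => -[]. Qed.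
Let w0 (t : R) : (0 < t)%R -> (0 <= w t)%R. Proof. by case: hw => _; exact. Qed.
Let U0 (t : R) : (0 < t)%R -> (0 < U t)%R. Proof. exact: fine_primitive_gt0. Qed.
Let Phi0 (t : R) : (0 < t)%R -> (0 < Phi t)%R. Proof. exact: Phi_gt0. Qed.

Let avg_ge0 (x : R) : 0 <= avg x.
Proof.
apply: integral_ge0 => t /setDE t0; apply: mule_ge0; first exact: poweR_ge0.
by rewrite lee_fin w0.
Qed.

Let avg_val (x : R) : (0 < x)%R -> exists2 A : R, avg x = A%:E &
  [/\ (0 < A)%R, (A <= Phi x)%R & (Phi x <= 2 `^ (q / p) * A)%R].
Proof.
move=> x0; have le1 := avg_le_Phi hu hU hw r0 hnd x0.
have := Phi_le_avg hu hU hw r0 hnd x0.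
have [A AE] : exists A, avg x = A%:E.
  exists (fine (avg x)); rewrite fineK// ge0_fin_numE//.
  by apply: le_lt_trans le1 _; exact: ltry.
move: le1; rewrite AE -EFinM !lee_fin => le1 le2; exists A => //; split => //.
have := lt_le_trans (Phi0 x0) le2.
by rewrite pmulr_rgt0// powR_gt0.
Qed.

Let I3_term (x A : R) : (0 < x)%R -> (0 < A)%R -> avg x = A%:E ->
  avg x `^ q^-1 / primitive_wt u x `^ p^-1 *
    ereal_sup [set primitive_wt u t `^ p^-1 * ess_sup_inv v `]t, +oo[
              | t in `]0%R, x[] =
  (A `^ q^-1 / U x `^ p^-1)%:E * S x.
Proof.
move=> x0 A0 ->; rewrite weight_sup.unlock fine_primitiveE ?(ltW x0)// !poweR_EFin inver.
by rewrite gt_eqF ?powR_gt0 ?U0// -EFinM.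
Qed.

Lemma I3_ge0 : 0 <= I3 p q u v w.
Proof.
have [A AE [A0 _ _]] := avg_val ltr01.
apply: (@le_trans _ _ ((A `^ q^-1 / U 1 `^ p^-1)%:E * S 1%R)).
  apply: mule_ge0; first by rewrite lee_fin divr_ge0 ?powR_ge0.
  by apply: ltW; exact: weight_sup_gt0.
rewrite -(I3_term ltr01 A0 AE).
by apply: ereal_sup_ubound; exists 1%R => //; exact: setDI.
Qed.

Lemma I3_le (c : R) : (0 <= c)%R -> hardy_ineq p q u v w c ->
  I3 p q u v w <= c%:E.
Proof.
move=> c0 hc; apply: ge_ereal_sup => _ [x /setDE x0 <-].
have [A AE [A0 A1 _]] := avg_val x0; rewrite (I3_term x0 A0 AE).
have Ux := U0 x0; have Px := Phi0 x0.
have Upx : (0 < U x `^ p^-1)%R by exact: powR_gt0.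
have Ppx : (0 < Phi x `^ q^-1)%R by exact: powR_gt0.
have := weight_sup_le hp hq hu hU hw hv hnd c0 hc x0.
move=> /(lee_wpmul2l (_ : 0 <= (A `^ q^-1 / U x `^ p^-1)%:E)).
rewrite lee_fin divr_ge0 ?powR_ge0// => /(_ isT) /le_trans; apply.
rewrite -EFinM lee_fin.
have -> : (A `^ q^-1 / U x `^ p^-1 * (c * U x `^ p^-1 / Phi x `^ q^-1) =
   c * (A `^ q^-1 / Phi x `^ q^-1))%R by field; rewrite !gt_eqF.
rewrite ler_piMr// ler_pdivrMr// mul1r.
by apply: ge0_ler_powR; rewrite ?nnegrE ?invr_ge0 ?(ltW hq) ?(ltW A0) ?(ltW Px).
Qed.

(** The factor 2^(1/p) is the q-th root of the constant 2^(q/p) comparing Phi with the integral in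
    I_3. Finiteness of S, required for the profile, holds because its coefficient in I_3 is
    positive. *)
Lemma hardy_of_I3 (c : R) : (1 <= q)%R -> (0 <= c)%R -> I3 p q u v w <= c%:E ->
  hardy_ineq p q u v w (2 `^ p^-1 * c).
Proof.
move=> q1 c0 Ic.
have term_le (x A : R) : (0 < x)%R -> (0 < A)%R -> avg x = A%:E ->
    (A `^ q^-1 / U x `^ p^-1)%:E * S x <= c%:E.
  move=> x0 A0 AE; apply: le_trans Ic; rewrite -(I3_term x0 A0 AE).
  by apply: ereal_sup_ubound; exists x => //; exact: setDI.
have S_fin (x : R) : (0 < x)%R -> S x < +oo.
  move=> x0; have [A AE [A0 _ _]] := avg_val x0.
  have := term_le x A x0 A0 AE; apply: contraTT; rewrite -leNgt leye_eq => /eqP ->.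
  by rewrite gt0_muley -?ltNge ?ltry// lte_fin divr_gt0 ?powR_gt0 ?U0.
have Kc0 : (0 <= 2 `^ p^-1 * c)%R by rewrite mulr_ge0 ?powR_ge0.
move=> h hh; apply: (hardy_sufficiency_ge1 hp hq hu hU hw hv hnd hh q1 Kc0).
have := profile_inv_le p0 hu hU hv S_fin.
apply: (@filterS _ _ (ae_filter_ringOfSetsType mu)) => x Gv Dx.
have {}Gv := Gv Dx; have x0 := setDE Dx; have Gx := profile_gt0 hu hU hv S_fin x0.
have [A AE [A0 _ A2]] := avg_val x0; have := term_le x A x0 A0 AE.
have Upx : (0 < U x `^ p^-1)%R by rewrite powR_gt0 ?U0.
rewrite -(profileE hu hU hv S_fin x0) -EFinM lee_fin => AG.
have {}AG : (A `^ q^-1 * G x <= c)%R.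
  apply: le_trans AG; rewrite le_eqVlt; apply/predU1P; left.
  by field; rewrite gt_eqF.
apply: (@le_trans _ _ (2 `^ p^-1 * (A `^ q^-1))%R).
  have -> : (2 `^ p^-1 * A `^ q^-1 = (2 `^ (q / p) * A) `^ q^-1)%R.
    rewrite powRM ?powR_ge0 ?(ltW A0)// -powRrM; congr (_ `^ _ * _)%R.
    by rewrite mulrAC divff ?mul1r// gt_eqF.
  by apply: ge0_ler_powR; rewrite ?nnegrE ?invr_ge0 ?(ltW hq) ?(ltW (Phi0 x0)) ?mulr_ge0
    ?powR_ge0 ?(ltW A0).
rewrite -mulrA; apply: ler_wpM2l; first exact: powR_ge0.
apply: (@le_trans _ _ (c * (G x)^-1)%R); last by rewrite ler_wpM2l.
by rewrite ler_pdivlMr.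
Qed.

Hypothesis q1 : (q < 1)%R.
Let s := (q / (1 - q))%R.
Let q1' : (0 < 1 - q)%R. Proof. by rewrite subr_gt0. Qed.
Let s0 : (0 < s)%R. Proof. exact: divr_gt0. Qed.

Local Notation I4_integrand x :=
  (avg x `^ s / primitive_wt u x `^ (s / p)
   * ereal_sup [set primitive_wt u t `^ (s / p) * ess_sup_inv v `]t, +oo[ `^ s
               | t in `]0%R, x[]
   * (w x)%:E).

Let I4E : I4 p q u v w = (\int[mu]_(x in D) I4_integrand x) `^ s^-1.
Proof. by []. Qed.

Let I4_term (x A : R) : (0 < x)%R -> (0 < A)%R -> avg x = A%:E ->
  I4_integrand x = (A `^ s / U x `^ (s / p))%:E * S x `^ s * (w x)%:E.
Proof.
move=> x0 A0 ->; rewrite weight_sup_powE// fine_primitiveE ?(ltW x0)// !poweR_EFin inver.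
by rewrite gt_eqF ?powR_gt0 ?U0// -EFinM.
Qed.

Let I4_term_fin (S_fin : forall x : R, (0 < x)%R -> S x < +oo) (x A : R) :
  (0 < x)%R -> (0 < A)%R -> avg x = A%:E ->
  I4_integrand x = (A `^ s * G x `^ s * w x)%:E.
Proof.
move=> x0 A0 AE; rewrite (I4_term x0 A0 AE) -(profileE hu hU hv S_fin x0).
have Gx := profile_gt0 hu hU hv S_fin x0.
rewrite poweR_EFin -!EFinM powRM ?powR_ge0 ?(ltW Gx)// -powRrM.
rewrite [(p^-1 * s)%R]mulrC; congr ((_ * _)%:E).
by field; rewrite gt_eqF// powR_gt0 ?U0.
Qed.

Let mtarget (S_fin : forall x : R, (0 < x)%R -> S x < +oo) :
  measurable_fun D (fun x => (Phi x `^ s * G x `^ s * w x)%:E).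
Proof.
apply/measurable_EFinP; apply: measurable_funM => //; apply: measurable_funM.
  exact: (measurableT_comp (measurable_powR _) (measurable_Phi _ hu hU hw)).
exact: (measurableT_comp (measurable_powR _) (measurable_profile hu hU hv S_fin)).
Qed.

Let mavg : measurable_fun D (fun x => avg x).
Proof.
have mU : measurable_fun D U by exact: measurable_fine_primitive.
have mUx : measurable_fun (D `*` D) (fun xt => U xt.1).
  exact: (measurable_fst_rectangle mD mU).
have mUt : measurable_fun (D `*` D) (fun xt => U xt.2).
  exact: (measurable_snd_rectangle mD mU).
have mUV : measurable_fun (D `*` D) (fun xt => (U xt.2 + U xt.1)^-1%R).
  apply: measurable_fun_invr_gt0; first exact: measurable_funD mUt mUx.
  by move=> -[x t] [/= /setDE x0 /setDE t0]; rewrite addr_gt0 ?U0.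
have mf : measurable_fun D (fun x => \int[mu]_(t in D)
    ((U x / (U t + U x)) `^ (q / p) * w t)%:E).
  apply: (@measurable_integral2 _ _ _ _ _ mu D D
    (fun xt => ((U xt.1 / (U xt.2 + U xt.1)) `^ (q / p) * w xt.2)%:E)) => //.
  - apply/measurable_EFinP; apply: measurable_funM.
      apply: (measurableT_comp (measurable_powR _)).
      exact: measurable_funM mUx mUV.
    exact: (measurable_snd_rectangle mD mw).
  - move=> x t /setDE x0 /setDE t0; rewrite lee_fin.
    by apply: mulr_ge0; [exact: powR_ge0|exact: w0].
apply: eq_measurable_fun mf => x /[1!inE] /setDE x0.
apply: eq_integral => t /[1!inE] /setDE t0.
by rewrite (UquotE hu hU)// poweR_EFin -EFinM.
Qed.

Let mI4 (S_fin : forall x : R, (0 < x)%R -> S x < +oo) :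
  measurable_fun D (fun x => I4_integrand x).
Proof.
have mg : measurable_fun D (fun x => avg x `^ s * (G x `^ s * w x)%:E).
  apply: emeasurable_funM; first exact: (measurableT_comp (measurable_poweR _) mavg).
  apply/measurable_EFinP; apply: measurable_funM => //.
  exact: (measurableT_comp (measurable_powR _) (measurable_profile hu hU hv S_fin)).
apply: eq_measurable_fun mg => x /[1!inE] /setDE x0.
have [A AE [A0 _ _]] := avg_val x0.
by rewrite (I4_term_fin S_fin x0 A0 AE) AE poweR_EFin -EFinM mulrA.
Qed.

Lemma I4_ge0 : 0 <= I4 p q u v w.
Proof. exact: poweR_ge0. Qed.

Lemma I4_le (c : R) : (0 <= c)%R -> hardy_ineq p q u v w c ->
  I4 p q u v w <= (2 `^ s^-1 * 4 * c)%:E.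
Proof.
move=> c0 hc.
have S_fin (x : R) : (0 < x)%R -> S x < +oo.
  move=> x0; have := weight_sup_le hp hq hu hU hw hv hnd c0 hc x0.
  by move=> /le_lt_trans; apply; exact: ltry.
have term_ge0 x : D x -> 0 <= I4_integrand x.
  move=> /setDE x0; have [A AE [A0 _ _]] := avg_val x0.
  by rewrite (I4_term_fin S_fin x0 A0 AE) lee_fin !mulr_ge0 ?powR_ge0 ?w0.
(* The s-th root of the bound of [profile_integral_le]. *)
have -> : (2 `^ s^-1 * 4 * c = (2 * (4 * c) `^ s) `^ s^-1)%R.
  rewrite powRM ?powR_ge0// -powRrM mulfV ?gt_eqF// powRr1 ?mulr_ge0//.
  by rewrite mulrA.
have sV : (0 <= s^-1)%R by rewrite invr_ge0 ltW.
rewrite I4E -poweR_EFin; apply: (gt0_ler_poweR sV).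
- by rewrite in_itv/= leey andbT; exact: integral_ge0.
- by rewrite in_itv/= leey andbT lee_fin mulr_ge0 ?powR_ge0.
apply: le_trans (profile_integral_le hp hq q1 hu hU hw hv hnd c0 hc).
apply: ge0_le_integral => //.
- exact: mI4.
- exact: mtarget.
- move=> x /setDE x0; have [A AE [A0 A1 _]] := avg_val x0.
  rewrite (I4_term_fin S_fin x0 A0 AE) lee_fin.
  apply: ler_wpM2r; first exact: w0.
  apply: ler_wpM2r; first exact: powR_ge0.
  by apply: ge0_ler_powR; rewrite ?nnegrE ?(ltW s0) ?(ltW A0) ?(ltW (Phi0 x0)).
Qed.

(** If S is infinite at one point it is infinite everywhere, and the integrand of I_4 is +oo times
    w. By convention this is 0 where w vanishes, but it still dominates w, whose integral over (1,
    oo) is infinite. *)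
Let weight_sup_lty_of_I4 (c : R) : I4 p q u v w <= c%:E ->
  forall x : R, (0 < x)%R -> S x < +oo.
Proof.
move=> Ic; have [S1|] := ltP (S 1%R) +oo.
  exact: (weight_sup_lty (lt_le_trans ltr01 hp) hu hU hv ltr01 S1).
rewrite leye_eq => /eqP S1; exfalso.
have S_oo x : (0 < x)%R -> S x = +oo.
  move=> x0; apply/eqP; rewrite -leye_eq leNgt; apply/negP => Sx.
  by have := weight_sup_lty p0 hu hU hv x0 Sx ltr01; rewrite S1 ltxx.
have mwE : measurable_fun D (fun t => (w t)%:E) by exact/measurable_EFinP.
have wE0 t : D t -> 0 <= (w t)%:E by move=> /setDE t0; rewrite lee_fin w0.
suff : I4 p q u v w = +oo by move=> I4oo; move: Ic; rewrite I4oo leye_eq.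
rewrite I4E (_ : \int[mu]_(x in D) I4_integrand x = +oo).
  by rewrite poweRyr// gt_eqF// invr_gt0.
apply/eqP; rewrite -leye_eq; case: hnd => _ _ <-.
apply: (@le_trans _ _ (\int[mu]_(x in D) (w x)%:E)).
  apply: ge0_subset_integral => //.
  by apply: subset_itvr; rewrite bnd_simp.
rewrite (_ : \int[mu]_(x in D) I4_integrand x =
    \int[mu]_(x in D) (+oo * (w x)%:E)); last first.
  apply: eq_integral => x /[1!inE] /setDE x0; have [A AE [A0 _ _]] := avg_val x0.
  rewrite (I4_term x0 A0 AE) S_oo// poweRyr ?gt_eqF//.
  by rewrite gt0_muley// lte_fin divr_gt0 ?powR_gt0 ?U0.
apply: ge0_le_integral => //.
- exact: measurable_funeM.
- move=> x Dx; have := wE0 x Dx; rewrite le_eqVlt => /predU1P[<-|wx0].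
    by rewrite mule0.
  by rewrite gt0_mulye// leey.
Qed.

(** The comparison Phi <= 2^(q/p) avg enters J with the power s, which the root 1/s undoes; 16^(1/q)
    comes from [hardy_sufficiency_lt1]. *)
Lemma hardy_of_I4 (c : R) : (0 <= c)%R -> I4 p q u v w <= c%:E ->
  hardy_ineq p q u v w (16 `^ q^-1 * 2 `^ (q / p) * c).
Proof.
move=> c0 Ic; have S_fin := weight_sup_lty_of_I4 Ic.
pose J := \int[mu]_(x in D) (Phi x `^ s * G x `^ s * w x)%:E.
have J0 : 0 <= J.
  by apply: integral_ge0 => x /setDE x0; rewrite lee_fin !mulr_ge0 ?powR_ge0 ?w0.
have term_ge0 x : D x -> 0 <= I4_integrand x.
  move=> /setDE x0; have [A AE [A0 _ _]] := avg_val x0.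
  by rewrite (I4_term_fin S_fin x0 A0 AE) lee_fin !mulr_ge0 ?powR_ge0 ?w0.
have X0 : 0 <= \int[mu]_(x in D) I4_integrand x by exact: integral_ge0.
have J_le : J <= ((2 `^ (q / p)) `^ s)%:E * \int[mu]_(x in D) I4_integrand x.
  rewrite -ge0_integralZl_EFin ?powR_ge0//; last exact: mI4.
  apply: ge0_le_integral => //.
  - by move=> x /setDE x0; rewrite lee_fin !mulr_ge0 ?powR_ge0 ?w0.
  - exact: mtarget.
  - by apply: measurable_funeM; exact: mI4.
  - move=> x /setDE x0; have [A AE [A0 _ A2]] := avg_val x0.
    rewrite (I4_term_fin S_fin x0 A0 AE) -EFinM lee_fin !mulrA.
    apply: ler_wpM2r; first exact: w0.
    apply: ler_wpM2r; first exact: powR_ge0.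
    rewrite -powRM ?powR_ge0 ?(ltW A0)//.
    by apply: ge0_ler_powR; rewrite ?nnegrE ?(ltW s0) ?(ltW (Phi0 x0)) ?mulr_ge0 ?powR_ge0
      ?(ltW A0).
have sV : (0 <= s^-1)%R by rewrite invr_ge0 ltW.
have JI : J `^ s^-1 <= (2 `^ (q / p) * c)%:E.
  apply: (@le_trans _ _ ((2 `^ (q / p))%:E * I4 p q u v w)); last first.
    by rewrite EFinM; apply: lee_wpmul2l => //; rewrite lee_fin powR_ge0.
  have -> : (2 `^ (q / p))%:E = (((2 `^ (q / p)) `^ s)%:E) `^ s^-1 :> \bar R.
    by rewrite poweR_EFin -powRrM mulfV ?gt_eqF// powRr1// powR_ge0.
  rewrite I4E -poweRM ?lee_fin ?powR_ge0//; apply: (gt0_ler_poweR sV) => //.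
  - by rewrite in_itv/= leey andbT.
  - by rewrite in_itv/= leey andbT mule_ge0// lee_fin powR_ge0.
have J_fin : J < +oo.
  have := le_lt_trans JI (ltry _); apply: contraTT; rewrite -!leNgt !leye_eq => /eqP ->.
  by rewrite poweRyr// gt_eqF// invr_gt0.
move=> h hh.
have mG := measurable_profile hu hU hv S_fin.
have G0 := profile_gt0 hu hU hv S_fin.
have := hardy_sufficiency_lt1 hp hq hu hU hw hv hnd hh q1 mG (fun t => @G0 t)
  (fun x y => @profile_nincr _ _ _ _ p0 hu hU hv S_fin x y)
  (fun x y => @profile_ndecr _ _ _ _ hu hU hv S_fin x y)
  (profile_inv_le p0 hu hU hv S_fin) J_fin.
move=> /le_trans; apply; apply: lee_wpmul2r.
  apply: integral_ge0 => z /setDE z0; apply: mule_ge0; first by case: hh => _; exact.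
  by rewrite lee_fin; case: hv => _; exact.
by rewrite -mulrA EFinM; apply: lee_wpmul2l => //; rewrite lee_fin powR_ge0.
Qed.

End characterization.

Theorem theorem4p2 (R : realType) (p q : R) (hp : (1 <= p)%R) (hq : (0 < q)%R) :
  exists lambda : R, (0 < lambda)%R /\
  forall u v w : R -> R,
    weight u -> weight v -> weight w ->
    ess_sup_inv v `]t, +oo[ @[t --> +oo%R] --> 0 ->
    (forall t : R, (0 < t)%R -> 0 < primitive_wt u t) ->
    admissible_wt (primitive_wt u) ->
    nondegenerate_wrt (primitive_wt u) (q / p) w ->
    ((1 <= q)%R ->
      ((exists c : R, (0 <= c)%R /\ hardy_ineq p q u v w c) <->
        I3 p q u v w < +oo) /\
      approx_by lambda (best_constant p q u v w) (I3 p q u v w)) /\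
    ((q < 1)%R ->
      ((exists c : R, (0 <= c)%R /\ hardy_ineq p q u v w c) <->
        I4 p q u v w < +oo) /\
      approx_by lambda (best_constant p q u v w) (I4 p q u v w)).
Proof.
set s := (q / (1 - q))%R.
have K3 : (0 <= 2 `^ p^-1 :> R)%R by exact: powR_ge0.
have L4 : (0 < 2 `^ s^-1 * 4 :> R)%R by rewrite mulr_gt0// powR_gt0.
have K4 : (0 <= 16 `^ q^-1 * 2 `^ (q / p) :> R)%R by rewrite mulr_ge0 ?powR_ge0.
(* All terms are nonnegative, so l dominates the constants K and L of both cases; the 1 is the
   constant L for q >= 1. *)
pose l : R := (1 + 2 `^ p^-1 + 2 `^ s^-1 * 4 + 16 `^ q^-1 * 2 `^ (q / p))%R.
have l0 : (0 < l)%R by rewrite /l; lra.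
exists l; split => // u v w hu hv hw _ _ hU hnd; split => q1.
- apply: (@best_constant_approx _ _ _ _ _ _ _ (2 `^ p^-1)%R 1%R l l0).
  + by apply/andP; split => //; rewrite /l; lra.
  + by apply/andP; split => //; rewrite /l; lra.
  + exact: I3_ge0.
  + by move=> c c0 hc; rewrite mul1r; exact: I3_le.
  + by move=> c c0 Ic; exact: hardy_of_I3.
- apply: (@best_constant_approx _ _ _ _ _ _ _ (16 `^ q^-1 * 2 `^ (q / p))%R
    (2 `^ s^-1 * 4)%R l l0).
  + by apply/andP; split => //; rewrite /l; lra.
  + by apply/andP; split => //; rewrite /l; lra.
  + exact: I4_ge0.
  + by move=> c c0 hc; exact: I4_le.
  + by move=> c c0 Ic; exact: hardy_of_I4.
Qed.
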